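(* Let $\nu>-1$ with $\nu\neq-\frac12$ and $\tau>0$, and let $w_\nu(x)=|x|^{2\nu+1}$. If $f\in C(\mathbb{R}\setminus\{0\})$ with $fw_\nu\in L^\infty(\mathbb{R})$, then the series $$G_{\nu,\tau}f(z)=\sum_{t\in\mathcal{T}_\nu}f(\tau^{-1}t)\frac{A_\nu^2(\tau z)}{A_\nu'(t)^2(\tau z-t)^2},\qquad H_{\nu,\tau}f(z)=\sum_{t\in\mathcal{T}_{\nu+1}}f(\tau^{-1}t)\frac{B_\nu^2(\tau z)}{B_\nu'(t)^2(\tau z-t)^2}$$ define entire functions of exponential type $2\tau$. If in addition $fw_\nu$ has a uniformly continuous extension to $\mathbb{R}$ with $\lim_{x\to0}f(x)w_\nu(x)=0$, then (a) for $\nu>-\frac12$, $\lim_{\tau\to\infty}\|(G_{\nu,\tau}f-f)w_\nu\|_\infty=0$; (b) for $-1<\nu<-\frac12$, $\lim_{\tau\to\infty}\|(H_{\nu,\tau}f-f)w_\nu\|_\infty=0$.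
   Context: $J_\nu$ is the Bessel function of the first kind of order $\nu$. For $\nu>-1$, $$A_\nu(z)=\Gamma(\nu+1)(z/2)^{-\nu}J_\nu(z),\qquad B_\nu(z)=\Gamma(\nu+1)(z/2)^{-\nu}J_{\nu+1}(z),$$ which are entire functions. $\mathcal{T}_\nu=\{\pm\xi:\ J_\nu(\xi)=0,\ \xi>0\}$. Each summand in the series is an entire function of $z$, its value at $\tau z=t$ being defined by continuity. An entire function $F$, not identically zero, has exponential type if $\tau(F)=\limsup_{|z|\to\infty}|z|^{-1}\log|F(z)|$ is finite; the nonnegative number $\tau(F)$ is called the exponential type of $F$. For $f$ continuous on $\mathbb{R}\setminus\{0\}$ such that $fw_\nu$ has a limit at the origin, ''$fw_\nu$ has a uniformly continuous extension to $\mathbb{R}$'' means that, after defining the value of $fw_\nu$ at the origin to be this limit, the resulting function is uniformly continuous on $\mathbb{R}$. $\|\cdot\|_\infty$ is the norm of $L^\infty(\mathbb{R})$.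
   Formalization: ''Of exponential type 2τ'' is proved as type at most 2τ, with the zero function allowed; equality fails for f=0, and for ν=1/2, τ=1, f(x)=(1−cos x)/x², where Gf=f has type 1. *)

(* Defs.v *)
From HB Require Import structures.
From mathcomp Require Import all_boot all_order all_algebra.
From mathcomp Require Import finmap complex.
From mathcomp Require Import all_classical all_reals all_analysis.
Set Implicit Arguments.
Unset Strict Implicit.
Unset Printing Implicit Defensive.
Import Order.TTheory GRing.Theory Num.Theory.
Import numFieldNormedType.Exports.
Local Open Scope classical_set_scope.
Local Open Scope ring_scope.

(* R[i] carries no topology by itself (its canonical module structure is over
   R); packing it as a numClosedFieldType gives it the topology of its norm
   and makes [derivable F z 1] and [derive1] denote complex differentiation. *)
Definition C (R : realType) : numClosedFieldType := R[i]%C.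

Definition toC (R : realType) (x : R) : C R := real_complex R x.

(* [`|z|] has type [C R]; this is the same modulus as an element of [R]. *)
Definition cabs (R : realType) (z : C R) : R := ComplexField.Normc.normc z.

(* g, with its value at a (re)defined by continuity *)
Definition cont_ext (U : topologicalType) (V : ptopologicalType)
    (g : U -> V) (a z : U) : V :=
  if z == a then lim (g y @[y --> a^']) else g z.

(* principal argument, in ]-pi, pi], for z != 0 *)
Definition carg (R : realType) (z : C R) : R :=
  let th := acos (complex.Re z / cabs z) in
  if 0 <= complex.Im z then th else - th.

(* principal branch of z^a, for z != 0 *)
Definition cpow (R : realType) (z : C R) (a : R) : C R :=
  Complex (cabs z `^ a * cos (a * carg z)) (cabs z `^ a * sin (a * carg z)).

(* meaningful for 0 < x only *)
Definition Gamma (R : realType) (x : R) : R :=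
  \int[@lebesgue_measure R]_(t in `]0, +oo[) (t `^ (x - 1) * expR (- t)).

(* meaningful for nu > -1 and z != 0 *)
Definition besselJ (R : realType) (nu : R) (z : C R) : C R :=
  cpow (z / 2) nu *
  limn (series (fun n : nat =>
    (-1) ^+ n / (n`!%:R * toC (Gamma (n%:R + nu + 1))) * (z / 2) ^+ (2 * n))).

Definition besselA (R : realType) (nu : R) : C R -> C R :=
  cont_ext (fun z : C R => toC (Gamma (nu + 1)) * cpow (z / 2) (- nu) * besselJ nu z) 0.

Definition besselB (R : realType) (nu : R) : C R -> C R :=
  cont_ext
    (fun z : C R => toC (Gamma (nu + 1)) * cpow (z / 2) (- nu) * besselJ (nu + 1) z) 0.

Definition bessel_zeros (R : realType) (nu : R) : set R :=
  [set t | exists xi : R,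
     [/\ 0 < xi, besselJ nu (toC xi) = 0 & t = xi \/ t = - xi]].

(* Sums over a set T of indices are unordered: they are limits of the finite
   partial sums along the inclusion order on finite sets, so that convergence
   is unconditional (equivalently, absolute). *)
Definition finsets (I : choiceType) : set_system {fset I} :=
  filter_from setT (fun A : {fset I} => [set B : {fset I} | (A `<=` B)%fset]).

Definition partial_sum (R : realType) (I : choiceType) (T : set I)
    (u : I -> C R) (B : {fset I}) : C R :=
  \sum_(t <- B | t \in T) u t.

Definition summable_on (R : realType) (I : choiceType) (T : set I)
    (u : I -> C R) : Prop :=
  cvg (partial_sum T u B @[B --> @finsets I]).

Definition sum_on (R : realType) (I : choiceType) (T : set I)
    (u : I -> C R) : C R :=
  lim (partial_sum T u B @[B --> @finsets I]).

(* the summand of index t, E being A_nu or B_nu *)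
Definition interp_term (R : realType) (E : C R -> C R) (tau : R) (f : R -> C R)
    (z : C R) (t : R) : C R :=
  cont_ext (fun y : C R => f (tau^-1 * t) *
      (E (toC tau * y) ^+ 2 /
       ((derive1 E (toC t)) ^+ 2 * (toC tau * y - toC t) ^+ 2)))
    (toC (tau^-1 * t)) z.

Definition G_summable (R : realType) (nu tau : R) (f : R -> C R) : Prop :=
  forall z, summable_on (bessel_zeros nu) (interp_term (besselA nu) tau f z).

Definition G_op (R : realType) (nu tau : R) (f : R -> C R) (z : C R) : C R :=
  sum_on (bessel_zeros nu) (interp_term (besselA nu) tau f z).

Definition H_summable (R : realType) (nu tau : R) (f : R -> C R) : Prop :=
  forall z,
    summable_on (bessel_zeros (nu + 1)) (interp_term (besselB nu) tau f z).

Definition H_op (R : realType) (nu tau : R) (f : R -> C R) (z : C R) : C R :=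
  sum_on (bessel_zeros (nu + 1)) (interp_term (besselB nu) tau f z).

Definition entire (R : realType) (F : C R -> C R) : Prop :=
  forall z, derivable F z 1.

(* the filter |z| -> oo *)
Definition cinfty (R : realType) : set_system (C R) :=
  filter_from setT (fun M : R => [set z : C R | M < cabs z]).

(* limsup of log|F(z)| / |z| as |z| -> oo, with log 0 = -oo *)
Definition exp_type (R : realType) (F : C R -> C R) : \bar R :=
  limf_esup (fun z : C R => (((cabs z)^-1)%:E * lne (cabs (F z))%:E)%E)
    (@cinfty R).

(* An interpolation formula yields only an upper bound for the type: the
   function may vanish identically (its exp_type is then -oo), or be nonzero
   of strictly smaller type. *)
Definition entire_of_exp_type (R : realType) (a : R) (F : C R -> C R) : Prop :=
  entire F /\ (exp_type F <= a%:E)%E.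

Definition weight (R : realType) (nu x : R) : R := `|x| `^ (2 * nu + 1).

Definition Linfty_norm (R : realType) (g : R -> C R) : \bar R :=
  Lnorm (@lebesgue_measure R) +oo%E (fun x : R => (cabs (g x))%:E).

(* Main.v *)
(* A_mu is the even power series [bA], with A_mu' = -z A_(mu+1) / (2(mu+1)), and
   A_nu = bA nu, B_nu = z / (2(nu+1)) * bA (nu+1); hence both parts are instances,
   with mu = nu or mu = nu+1 (so mu > -1/2 in (a) and (b)), of one statement about
   E(z) = k z^j A_mu(z).

   The zeros t of A_mu have gaps bounded below, |f(t/tau)| is O(|t|^(-2nu-1)) and
   |t|^(2mu+1) A_mu'(t)^2 is bounded below; since t A_mu(z)/(z-t) = z A_mu(z)/(z-t) - A_mu(z)
   is bounded uniformly in t, locally and by e^(lambda|z|) for every lambda > 1,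
   the series is dominated by the sum of 1/t^2. This gives entire sums of the right type.

   With g = f w_nu, the weighted series at y = tau x is the sum of K(y,t) g(t/tau), where
   K(y,t) = |y|^(2mu+1) A_mu(y)^2 / (|t|^(2mu+1) A_mu'(t)^2 (y-t)^2) >= 0. It suffices
   that (i) the sums of K(y,.) are bounded, (ii) the part over |y-t| >= M is O(1/M), and
   (iii) the sum of K(y,.) tends to 1 as |y| -> oo; near y = 0, where (iii) fails, g is small.
   For (iii), u(x) = x^(mu+1/2) A_mu(x) satisfies u'' = (q/x^2 - 1) u, so that
   u = r sin(phi) with r nearly constant and phi' nearly 1 at infinity, and
   K(y,t) is close to sin^2(phi(y)) / (phi(y) - phi(t))^2 with phi(t) running through
   the large multiples of pi; one concludes by the expansion of 1/sin^2 in partial fractions. *)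
Require Import Defs.
From HB Require Import structures.
From mathcomp Require Import all_boot all_order all_algebra.
From mathcomp Require Import finmap complex.
From mathcomp Require Import all_classical all_reals all_analysis.
From mathcomp Require Import measurable_realfun ess_sup_inf zify ring lra.
Import Order.TTheory GRing.Theory Num.Theory.
Import numFieldNormedType.Exports.
Set Implicit Arguments.
Unset Strict Implicit.
Unset Printing Implicit Defensive.
Local Open Scope classical_set_scope.
Local Open Scope ring_scope.

(** * Complex modulus and unordered sums *)

(** The two cases come from the origin: the factor |y|^(2mu+1) of the kernel must stay bounded
    there. This fails for A_nu when nu < -1/2, while the extra factor z of B_nu raises the exponent
    by 2, to the one belonging to nu + 1. Two obstacles lie between the formulas and the estimates.
    The quotient A_mu(z)/(z-t) has to be bounded and differentiated with constants independent of t
    although z may be close to t: for t near z it is expanded in divided differences of the power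
    series, otherwise 1/(z-t) is harmless. And K(y,t) degenerates when y is itself a zero; there all
    terms but one vanish and the series returns f(x) exactly. What is used about the zeros comes
    from the equation for u: their separation from Rolle's theorem, the lower bound on A_mu'(t)
    because at a zero the energy u^2 + u'^2 reduces to |t|^(2mu+1) A_mu'(t)^2, and the presence of
    enough zeros because the phase crosses every large multiple of pi. The last point is what the
    lower half of (iii) rests on: only multiples of pi below the starting value of the phase are
    missed, and these are far from phi(y). *)

Lemma normCE (R : realType) (z : C R) : `|z| = toC (cabs z).
Proof. by []. Qed.
Lemma toCB (R : realType) (x y : R) : toC (x - y) = toC x - toC y.
Proof. by rewrite /toC rmorphB. Qed.
Lemma toCD (R : realType) (x y : R) : toC (x + y) = toC x + toC y.
Proof. by rewrite /toC rmorphD. Qed.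
Lemma toCM (R : realType) (x y : R) : toC (x * y) = toC x * toC y.
Proof. by rewrite /toC rmorphM. Qed.
Lemma toCN (R : realType) (x : R) : toC (- x) = - toC x.
Proof. by rewrite /toC rmorphN. Qed.
Lemma toCX (R : realType) (x : R) n : toC (x ^+ n) = toC x ^+ n.
Proof. by rewrite /toC rmorphXn. Qed.
Lemma toCV (R : realType) (x : R) : toC (x^-1) = (toC x)^-1.
Proof. by rewrite /toC fmorphV. Qed.
Lemma toC_nat (R : realType) (n : nat) : toC (n%:R : R) = n%:R.
Proof. by rewrite /toC rmorph_nat. Qed.
Lemma le_toC (R : realType) (x y : R) : (toC x <= toC y) = (x <= y).
Proof. by rewrite /toC lecR. Qed.
Lemma lt_toC (R : realType) (x y : R) : (toC x < toC y) = (x < y).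
Proof. by rewrite /toC ltcR. Qed.
Lemma toC_inj (R : realType) : injective (@toC R).
Proof. by move=> x y []. Qed.
Lemma cabs_ge0 (R : realType) (z : C R) : 0 <= cabs z.
Proof. by rewrite -le_toC -normCE normr_ge0. Qed.
Lemma cabsM (R : realType) (z w : C R) : cabs (z * w) = cabs z * cabs w.
Proof. by apply: toC_inj; rewrite toCM -!normCE normrM. Qed.
Lemma cabs_toC (R : realType) (x : R) : cabs (toC x) = `|x|.
Proof. apply: toC_inj; rewrite -normCE. by rewrite /toC normc_def /= expr0n addr0 sqrtr_sqr. Qed.
Lemma cabsD (R : realType) (z w : C R) : cabs (z + w) <= cabs z + cabs w.
Proof. by rewrite -le_toC toCD -!normCE ler_normD. Qed.
Lemma cabsB (R : realType) (z w : C R) : cabs (z - w) <= cabs z + cabs w.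
Proof. by rewrite -le_toC toCD -!normCE ler_normB. Qed.
Lemma cabsN (R : realType) (z : C R) : cabs (- z) = cabs z.
Proof. by apply: toC_inj; rewrite -!normCE normrN. Qed.
Lemma cabsX (R : realType) (z : C R) n : cabs (z ^+ n) = cabs z ^+ n.
Proof. by apply: toC_inj; rewrite toCX -!normCE normrX. Qed.
Lemma cabsV (R : realType) (z : C R) : cabs (z^-1) = (cabs z)^-1.
Proof. by apply: toC_inj; rewrite toCV -!normCE normfV. Qed.
Lemma cabs0 (R : realType) : cabs (0 : C R) = 0.
Proof. by apply: toC_inj; rewrite -!normCE normr0. Qed.
Lemma cabs_eq0 (R : realType) (z : C R) : (cabs z == 0) = (z == 0).
Proof. by rewrite -(inj_eq (@toC_inj R)) -normCE -(normr_eq0 z). Qed.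
Lemma cabs_nat (R : realType) n : cabs (n%:R : C R) = n%:R.
Proof. by rewrite -toC_nat cabs_toC normr_nat. Qed.
Lemma cabs_sum (R : realType) (I : Type) (s : seq I) (P : pred I) (F : I -> C R) :
  cabs (\sum_(i <- s | P i) F i) <= \sum_(i <- s | P i) cabs (F i).
Proof.
elim: s => [|i s IH]; first by rewrite !big_nil cabs0.
rewrite !big_cons; case: ifP => // _.
by apply: (le_trans (cabsD _ _)); rewrite lerD2l.
Qed.
Lemma gt0_toC (R : realType) (e : C R) : 0 < e -> exists2 d : R, 0 < d & e = toC d.
Proof.
case: e => a b; rewrite ltcE /= => /andP[/eqP -> a0]. by exists a.
Qed.
Lemma Re_le (R : realType) (z : C R) : `|complex.Re z| <= cabs z.
Proof.
case: z => a b /=; rewrite -sqrtr_sqr /cabs/= ler_sqrt; last by rewrite addr_ge0 ?sqr_ge0.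
by rewrite lerDl sqr_ge0.
Qed.
Lemma Im_le (R : realType) (z : C R) : `|complex.Im z| <= cabs z.
Proof.
case: z => a b /=; rewrite -sqrtr_sqr /cabs/= ler_sqrt; last by rewrite addr_ge0 ?sqr_ge0.
by rewrite lerDr sqr_ge0.
Qed.

(** The index set is the whole type: a sum over [T] is written with terms that vanish outside [T].
    Errors are measured in [R], since [C R] is only partially ordered. *)
Definition has_sum (R : realType) (I : choiceType) (u : I -> C R) (l : C R) : Prop :=
  forall e : R, 0 < e -> exists A : {fset I}, forall B : {fset I},
    (A `<=` B)%fset -> cabs (\sum_(i <- B) u i - l) < e.

(** Passes estimates on finite sums to the limit. Only finite sets beyond some [A] have to be
    controlled, which matters when the sums come near [c] only after enough zeros are included. *)
Lemma has_sum_near (R : realType) (I : choiceType) (u : I -> C R) (l c : C R) (M : R) (A : {fset I}) :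
  has_sum u l -> (forall B : {fset I}, (A `<=` B)%fset -> cabs (\sum_(i <- B) u i - c) <= M) ->
  cabs (l - c) <= M.
Proof.
move=> hu hM; apply/ler_addgt0Pr => e e0.
have [A' hA'] := hu e e0.
have h1 := hA' (A `|` A')%fset (fsubsetUr _ _).
have h2 := hM (A `|` A')%fset (fsubsetUl _ _).
set S := \sum_(i <- _) _ in h1 h2.
have -> : l - c = (S - c) - (S - l) by ring.
apply: le_trans (cabsB _ _) _. by rewrite lerD// ltW.
Qed.

Lemma has_sum_le (R : realType) (I : choiceType) (u : I -> C R) (l : C R) (M : R) :
  has_sum u l -> (forall B : {fset I}, cabs (\sum_(i <- B) u i) <= M) -> cabs l <= M.
Proof.
move=> hu hM; rewrite -[l]subr0; apply: (has_sum_near (A := fset0) hu) => B _.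
by rewrite subr0.
Qed.

Lemma has_sum_unique (R : realType) (I : choiceType) (u : I -> C R) (l l' : C R) :
  has_sum u l -> has_sum u l' -> l = l'.
Proof.
move=> h h'; apply/eqP; rewrite -subr_eq0 -cabs_eq0 eq_le cabs_ge0 andbT.
apply/ler_addgt0Pr => e e0; rewrite add0r.
have [A hA] := h' e e0.
by apply: (has_sum_near (A := A) h) => B /hA /ltW.
Qed.

Lemma has_sumD (R : realType) (I : choiceType) (u v : I -> C R) (l l' : C R) :
  has_sum u l -> has_sum v l' -> has_sum (fun i => u i + v i) (l + l').
Proof.
move=> h h' e e0; have e20 : 0 < e / 2 by rewrite divr_gt0.
have [A hA] := h _ e20; have [A' hA'] := h' _ e20.
exists (A `|` A')%fset => B; rewrite fsubUset => /andP[/hA h1 /hA' h2].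
rewrite big_split /= (_ : _ + _ - _ = (\sum_(i <- B) u i - l) + (\sum_(i <- B) v i - l')); last by ring.
apply: le_lt_trans (cabsD _ _) _. by rewrite [e]splitr ltrD.
Qed.

Lemma has_sumZ (R : realType) (I : choiceType) (u : I -> C R) (l c : C R) :
  has_sum u l -> has_sum (fun i => c * u i) (c * l).
Proof.
move=> h e e0. have c0 : 0 < cabs c + 1 by rewrite ltr_wpDl// cabs_ge0.
have [A hA] := h _ (divr_gt0 e0 c0); exists A => B /hA hB.
rewrite -mulr_sumr -mulrBr cabsM.
apply: (@le_lt_trans _ _ ((cabs c + 1) * cabs (\sum_(i <- B) u i - l))).
  by rewrite ler_wpM2r ?cabs_ge0// lerDl.
by rewrite mulrC -ltr_pdivlMr.
Qed.

Lemma has_sumB (R : realType) (I : choiceType) (u v : I -> C R) (l l' : C R) :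
  has_sum u l -> has_sum v l' -> has_sum (fun i => u i - v i) (l - l').
Proof.
move=> h h'; have := has_sumD h (has_sumZ (-1) h'); rewrite mulN1r.
by congr (has_sum _ _); apply: funext => i; rewrite mulN1r.
Qed.

Lemma ler_sum_fsub (R : realType) (I : choiceType) (v : I -> R) (A B : {fset I}) :
  (forall i, 0 <= v i) -> (A `<=` B)%fset -> \sum_(i <- A) v i <= \sum_(i <- B) v i.
Proof.
move=> v0 AB; rewrite (big_fsetID _ (mem A) B) /=.
have -> : [fset x in B | x \in A]%fset = A.
  by apply/fsetP => x; rewrite !inE/= andb_idl// => /(fsubsetP AB).
by rewrite lerDl sumr_ge0.
Qed.

Lemma has_sum_nneg (R : realType) (I : choiceType) (v : I -> R) (M : R) :
  (forall i, 0 <= v i) -> (forall B : {fset I}, \sum_(i <- B) v i <= M) ->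
  exists s : R, has_sum (fun i => toC (v i)) (toC s).
Proof.
move=> v0 hM; pose E := [set \sum_(i <- B) v i | B in [set: {fset I}]].
have supE : has_sup E.
  split; first by exists (\sum_(i <- fset0) v i); exists fset0.
  by exists M => _ [B _ <-].
exists (sup E) => e e0.
have [_ [A _ <-] hA] := sup_adherent e0 supE.
exists A => B AB.
have h1 := ler_sum_fsub v0 AB.
have h2 : \sum_(i <- B) v i <= sup E by apply: sup_upper_bound => //; exists B.
have -> : \sum_(i <- B) toC (v i) - toC (sup E) = toC (\sum_(i <- B) v i - sup E).
  rewrite toCB; congr (_ - _).
  by elim/big_rec2 : _ => [|i x y _ ->]; rewrite /toC ?rmorph0 ?rmorphD.
rewrite cabs_toC ler0_norm ?subr_le0// opprB ltrBlDr -ltrBlDl.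
exact: lt_le_trans hA h1.
Qed.

(** A real component [p] with |p z| <= |z| is the difference of the nonnegative families [p + cabs]
    and [cabs], whose finite sums are bounded; this is applied to the real and imaginary parts. *)
Lemma has_sum_ex (R : realType) (I : choiceType) (u : I -> C R) (M : R) :
  (forall B : {fset I}, \sum_(i <- B) cabs (u i) <= M) -> exists l, has_sum u l.
Proof.
move=> hM.
have [s0 h0] := has_sum_nneg (fun i => cabs_ge0 (u i)) hM.
have key (p : C R -> R) : (forall z, `|p z| <= cabs z) -> exists l, has_sum (fun i => toC (p (u i))) l.
  move=> pz.
  have [s h] : exists s, has_sum (fun i => toC (p (u i) + cabs (u i))) (toC s).
    apply: (@has_sum_nneg _ _ _ (M + M)) => [i|B].
      by rewrite -lerBlDr sub0r; have := pz (u i); rewrite ler_norml => /andP[].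
    rewrite big_split /= lerD//; apply: le_trans (hM B); apply: ler_sum => i _.
    exact: le_trans (ler_norm _) (pz _).
  exists (toC s - toC s0); have := has_sumB h h0.
  by congr has_sum; apply: funext => i; rewrite toCD addrK.
have [a ha] := key _ (@Re_le R).
have [b hb] := key _ (@Im_le R).
exists (a + (Complex 0 1 : C R) * b); have := has_sumD ha (has_sumZ (Complex 0 1 : C R) hb).
congr has_sum; apply: funext => i; case: (u i) => x y /=.
by rewrite /toC /=; apply/eqP; rewrite eq_complex /=; apply/andP; split; apply/eqP; ring.
Qed.

Lemma sum_cabs_bound (R : realType) (I : choiceType) (u : I -> C R) (v : I -> R) (M : R) :
  (forall i, cabs (u i) <= v i) -> (forall B : {fset I}, \sum_(i <- B) v i <= M) ->
  (forall B : {fset I}, \sum_(i <- B) cabs (u i) <= M).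
Proof. by move=> h hM B; apply: le_trans (hM B); apply: ler_sum => i _. Qed.

Lemma finsets_proper (I : choiceType) : ProperFilter (@finsets I).
Proof.
apply: filter_from_proper; last by move=> A _; exists A => /=.
apply: filter_from_filter; first by exists fset0.
move=> A B _ _; exists (A `|` B)%fset => // D /=.
by rewrite fsubUset => /andP[].
Qed.

Lemma has_sum_cvg (R : realType) (I : choiceType) (T : set I) (u : I -> C R) (l : C R) :
  has_sum (fun i => if i \in T then u i else 0) l ->
  partial_sum T u B @[B --> @finsets I] --> l.
Proof.
move=> h. have FF := finsets_proper I.
apply/cvgrPdist_lt => e /gt0_toC[d d0 ->].
have [A hA] := h d d0.
exists A => // B /= /hA hB.
rewrite distrC normCE lt_toC /partial_sum [X in cabs (X - _)](_ : _ = \sum_(i <- B) (if i \in T then u i else 0)) //.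
by rewrite [LHS]big_mkcond.
Qed.

Lemma has_sum_summable (R : realType) (I : choiceType) (T : set I) (u : I -> C R) (l : C R) :
  has_sum (fun i => if i \in T then u i else 0) l ->
  summable_on T u /\ sum_on T u = l.
Proof.
move=> /has_sum_cvg h. have FF := finsets_proper I.
split; first by apply/cvg_ex; exists l.
by apply: cvg_lim => //; exact: norm_hausdorff.
Qed.

Lemma has_sum_iota (R : realType) (u : nat -> C R) (l : C R) :
  has_sum u l -> forall e, 0 < e -> exists N, forall n, (N <= n)%N ->
    cabs (\sum_(0 <= i < n) u i - l) < e.
Proof.
move=> h e /h[A hA]; exists (\max_(i <- A) i.+1)%N => n hn.
rewrite /index_iota subn0.
have -> : \sum_(i <- iota 0 n) u i = \sum_(i <- [fset x | x in iota 0 n]%fset) u i.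
  apply: perm_big; apply: uniq_perm; rewrite ?iota_uniq ?fset_uniq//.
  by move=> x; rewrite !inE.
apply: hA; apply/fsubsetP => i iA; rewrite !inE /= mem_iota /= add0n.
by apply: leq_trans hn; apply: leq_bigmax_seq iA _.
Qed.

Lemma has_sum_series (R : realType) (u : nat -> C R) (l : C R) :
  has_sum u l -> series u @ \oo --> l.
Proof.
move=> /has_sum_iota h; apply/cvgrPdist_lt => e /gt0_toC[d d0 ->].
have [N hN] := h d d0; exists N => // n /= /hN hn.
by rewrite distrC normCE lt_toC /series/=.
Qed.

(** * Quantitative complex differentiability *)

(* F is bounded by K at z and approximated to second order by z + h |-> F z + h F1, with the same K:
   this is stable under products and under sums with summable constants, so that
   series can be differentiated termwise. *)
Definition qbound (R : realType) (F : C R -> C R) (z F1 : C R) (K : R) : Prop :=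
  [/\ cabs (F z) <= K, cabs F1 <= K &
     forall h, cabs h <= 1 -> cabs (F (z + h) - F z - h * F1) <= K * cabs h ^+ 2].

Lemma qbound_derive (R : realType) (F : C R -> C R) (z F1 : C R) (K : R) :
  qbound F z F1 K -> is_derive z 1 F F1.
Proof.
move=> [K1 K2 hK]. have K0 : 0 <= K by apply: le_trans K1; exact: cabs_ge0.
have hl : (fun h : C R => h^-1 *: (F (h *: 1 + z) - F z)) @ 0^' --> F1.
  apply/cvgrPdist_lt => e /gt0_toC[d d0 ->].
  have d1 : 0 < Num.min 1 (d / (K + 1)) by rewrite lt_min ltr01 divr_gt0// ltr_wpDl.
  exists (toC (Num.min 1 (d / (K + 1)))) => /=.
    by rewrite (_ : 0 = toC 0)// lt_toC.
  move=> h /=; rewrite sub0r normrN normCE lt_toC lt_min => /andP[h1 hd] h0.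
  rewrite normCE lt_toC.
  have := hK h (ltW h1).
  have -> : F1 - h^-1 *: (F (h *: 1 + z) - F z) = - (h^-1 * (F (z + h) - F z - h * F1)).
    rewrite -[h *: 1]/(h * 1) mulr1 (addrC h z).
    rewrite -[_ *: _]/(h^-1 * _). field. exact: h0.
  rewrite cabsN cabsM cabsV.
  set X := cabs (F _ - _ - _) => hX.
  have ch : 0 < cabs h by rewrite lt_neqAle cabs_ge0 andbT eq_sym cabs_eq0.
  rewrite mulrC ltr_pdivrMr//; apply: le_lt_trans hX _.
  rewrite expr2 mulrA ltr_pM2r//.
  apply: (@le_lt_trans _ _ ((K + 1) * cabs h)); first by rewrite ler_wpM2r ?cabs_ge0// lerDl.
  by rewrite mulrC -ltr_pdivlMr// ltr_wpDl.
apply: DeriveDef; first by apply/cvg_ex; exists F1.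
by apply: cvg_lim => //; exact: norm_hausdorff.
Qed.

Lemma qboundM (R : realType) (F G : C R -> C R) (z F1 G1 : C R) (K L : R) :
  qbound F z F1 K -> qbound G z G1 L ->
  qbound (fun w => F w * G w) z (F1 * G z + F z * G1) (6 * K * L).
Proof.
move=> [f0 f1 f2] [g0 g1 g2].
have K0 : 0 <= K by apply: le_trans f0; exact: cabs_ge0.
have L0 : 0 <= L by apply: le_trans g0; exact: cabs_ge0.
have KL : 0 <= K * L by exact: mulr_ge0.
split.
- rewrite cabsM; apply: (@le_trans _ _ (K * L)); first by rewrite ler_pM ?cabs_ge0.
  by lra.
- apply: le_trans (cabsD _ _) _; rewrite !cabsM.
  apply: (@le_trans _ _ (K * L + K * L)); first by rewrite lerD// ler_pM ?cabs_ge0.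
  by lra.
move=> h h1.
have := f2 h h1; have := g2 h h1.
set r := F _ - _ - _; set s := G _ - _ - _ => hs hr.
(* The four remainders are bounded by 1, 2, 2 and 1 times K L |h|^2, using |h| <= 1; hence the
   constant 6. *)
have -> : F (z + h) * G (z + h) - F z * G z - h * (F1 * G z + F z * G1) =
   h ^+ 2 * (F1 * G1) + r * (G z + h * G1) + s * (F z + h * F1) + r * s.
  by rewrite /r /s; ring.
set a := cabs h in h1 hs hr *.
have a0 : 0 <= a := cabs_ge0 _.
have a2 : 0 <= a ^+ 2 := sqr_ge0 _.
have a21 : a ^+ 2 <= 1 by rewrite expr_le1.
have hG : cabs (G z + h * G1) <= 2 * L.
  apply: le_trans (cabsD _ _) _; rewrite cabsM mulr2n mulrDl mul1r lerD//.
  by apply: le_trans (_ : 1 * cabs G1 <= _); [rewrite ler_wpM2r ?cabs_ge0|rewrite mul1r].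
have hF : cabs (F z + h * F1) <= 2 * K.
  apply: le_trans (cabsD _ _) _; rewrite cabsM mulr2n mulrDl mul1r lerD//.
  by apply: le_trans (_ : 1 * cabs F1 <= _); [rewrite ler_wpM2r ?cabs_ge0|rewrite mul1r].
have b1 : cabs (h ^+ 2 * (F1 * G1)) <= a ^+ 2 * (K * L).
  by rewrite cabsM cabsX cabsM ler_wpM2l// ler_pM ?cabs_ge0.
have b2 : cabs (r * (G z + h * G1)) <= K * a ^+ 2 * (2 * L).
  by rewrite cabsM ler_pM ?cabs_ge0.
have b3 : cabs (s * (F z + h * F1)) <= L * a ^+ 2 * (2 * K).
  by rewrite cabsM ler_pM ?cabs_ge0.
have b4 : cabs (r * s) <= K * a ^+ 2 * L.
  rewrite cabsM ler_pM ?cabs_ge0//; apply: le_trans hs _.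
  by rewrite -[leRHS]mulr1 ler_wpM2l.
rewrite (_ : 6 * K * L * a ^+ 2 = a ^+ 2 * (K * L) + K * a ^+ 2 * (2 * L) + L * a ^+ 2 * (2 * K) + K * a ^+ 2 * L); last by ring.
by do 3 (apply: le_trans (cabsD _ _) _; apply: lerD => //).
Qed.

Lemma qboundB (R : realType) (F G : C R -> C R) (z F1 G1 : C R) (K L : R) :
  qbound F z F1 K -> qbound G z G1 L ->
  qbound (fun w => F w - G w) z (F1 - G1) (K + L).
Proof.
move=> [f0 f1 f2] [g0 g1 g2]; split.
- by apply: le_trans (cabsB _ _) _; rewrite lerD.
- by apply: le_trans (cabsB _ _) _; rewrite lerD.
move=> h h1.
have -> : F (z + h) - G (z + h) - (F z - G z) - h * (F1 - G1) =
  (F (z + h) - F z - h * F1) - (G (z + h) - G z - h * G1) by ring.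
by apply: le_trans (cabsB _ _) _; rewrite mulrDl lerD// ?f2 ?g2.
Qed.

Lemma qboundZ (R : realType) (F : C R -> C R) (z F1 c : C R) (K L : R) :
  cabs c <= L -> qbound F z F1 K -> qbound (fun w => c * F w) z (c * F1) (L * K).
Proof.
move=> cL [f0 f1 f2].
split; rewrite ?cabsM ?ler_pM ?cabs_ge0// => h h1.
rewrite mulrCA -!mulrBr cabsM -mulrA ler_pM ?cabs_ge0//. exact: f2.
Qed.

Lemma qbound_le (R : realType) (F : C R -> C R) (z F1 : C R) (K L : R) :
  K <= L -> qbound F z F1 K -> qbound F z F1 L.
Proof.
move=> KL [f0 f1 f2]; split; [exact: le_trans KL|exact: le_trans KL|].
by move=> h h1; apply: le_trans (f2 h h1) _; rewrite ler_wpM2r ?sqr_ge0.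
Qed.

(** The derivatives are dominated by the same summable [K i], and the remainder of the sum is the
    sum of the remainders; this takes the place of locally uniform convergence. *)
Lemma qbound_sum (R : realType) (I : choiceType) (u : I -> C R -> C R) (z : C R)
  (v : I -> C R) (K : I -> R) (M : R) (F : C R -> C R) :
  (forall i, qbound (u i) z (v i) (K i)) ->
  (forall B : {fset I}, \sum_(i <- B) K i <= M) ->
  (forall w, has_sum (fun i => u i w) (F w)) ->
  exists2 V, has_sum v V & qbound F z V M.
Proof.
move=> hu hK hF.
have [V hV] : exists V, has_sum v V.
  apply: (@has_sum_ex _ _ _ M); apply: (sum_cabs_bound (v := K)) => // i.
  by have [] := hu i.
have tri (w : I -> C R) l k : 0 <= k -> has_sum w l -> (forall i, cabs (w i) <= K i * k) -> cabs l <= M * k.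
  move=> k0 hw hb; apply: (has_sum_le hw) => B; apply: le_trans (cabs_sum _ _ _) _.
  apply: le_trans (_ : \sum_(i <- B) (K i * k) <= _); first by apply: ler_sum.
  by rewrite -mulr_suml ler_wpM2r.
exists V => //; split.
- rewrite -[M]mulr1; apply: (tri _ _ _ _ (hF z)) => // i; rewrite mulr1.
  by have [] := hu i.
- rewrite -[M]mulr1; apply: (tri _ _ _ _ hV) => // i; rewrite mulr1.
  by have [] := hu i.
move=> h h1; apply: (tri _ _ _ (sqr_ge0 _) (has_sumB (has_sumB (hF (z + h)) (hF z)) (has_sumZ h hV))) => i.
by have [_ _ ->] := hu i.
Qed.

(** * The Gamma function *)

Lemma is_derive_powR (R : realType) (a x : R) : 0 < x ->
  is_derive x 1 (fun t : R => t `^ a) (a * x `^ (a - 1)).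
Proof.
move=> x0; have xin : x \in `]0, +oo[ by rewrite in_itv/= andbT.
apply: DeriveDef; first exact: derivable_powR.
by rewrite -derive1E powR_derive1.
Qed.

Lemma is_derive_continuous (R : realType) (f : R -> R) (x d : R) :
  is_derive x 1 f d -> {for x, continuous f}.
Proof. by move=> [h _]; apply/differentiable_continuous/derivable1_diffP. Qed.

Lemma continuous_scale (R : realType) (f : R -> R) (c x : R) :
  {for x, continuous f} -> {for x, continuous (fun t => c * f t)}.
Proof. by move=> h; exact: (cvgM (cvg_cst c) h). Qed.

Lemma powR_le_expR (R : realType) (p : R) : 0 <= p ->
  exists C, forall t : R, 0 < t -> t `^ p <= C * expR (t / 2).
Proof.
move=> p0; have [n pn] : exists n : nat, p <= n%:R.
  by exists (Num.truncn p).+1; apply/ltW/truncnS_gt.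
(* For t <= 1 the summand 1 suffices; for t > 1 the term of order n+1 in the series of exp(t/2)
   dominates t^p. *)
exists (1 + 2 ^+ n.+1 * (n.+1)`!%:R) => t t0.
have e1 : 1 <= expR (t / 2) by rewrite ltW// expR_gt1 divr_gt0.
have h0 : 0 <= 2 ^+ n.+1 * (n.+1)`!%:R :> R by rewrite mulr_ge0// ?exprn_ge0.
have [t1|t1] := lerP t 1.
  apply: (@le_trans _ _ 1).
    by rewrite -(powRr0 t) ger_powR// t0.
  by apply: le_trans e1 _; rewrite -[leLHS]mul1r ler_wpM2r ?expR_ge0// lerDl.
apply: (@le_trans _ _ (t ^+ n.+1)).
  rewrite -powR_mulrn ?(ltW t0)// ler_powR ?(ltW t1)//.
  by apply: (le_trans pn); rewrite ler_nat.
have := @expR_ge1Dxn _ (t / 2) n (ltW (divr_gt0 t0 (ltr0Sn _ 1))).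
rewrite expr_div_n => h.
have {}h : t ^+ n.+1 / 2 ^+ n.+1 / (n.+1)`!%:R <= expR (t / 2).
  by apply: le_trans h; rewrite lerDr.
rewrite mulrDl mul1r; apply: (@le_trans _ _ (2 ^+ n.+1 * (n.+1)`!%:R * expR (t / 2))); last first.
  by rewrite lerDr expR_ge0.
rewrite -ler_pdivrMl; last by rewrite mulr_gt0// ?exprn_gt0// ltr0n fact_gt0.
by apply: le_trans h; rewrite invfM mulrC mulrA mulrAC.
Qed.

Definition gamma_fun (R : realType) (x t : R) : R := t `^ (x - 1) * expR (- t).

Lemma gamma_fun_continuous (R : realType) (x t : R) : 0 < t ->
  {for t, continuous (gamma_fun x)}.
Proof.
move=> t0; have := is_derive_powR (x - 1) t0.
move=> h1; have h2 := @is_deriveM _ _ (fun t => t `^ (x - 1)) (fun t => expR (- t)) t 1 _ _ h1 (is_derive1_comp (is_derive_expR _) _).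
exact: is_derive_continuous (h2 _ _).
Qed.

Lemma gamma_fun_ge0 (R : realType) (x t : R) : 0 <= gamma_fun x t.
Proof. by rewrite mulr_ge0// ?powR_ge0 ?expR_ge0. Qed.

Lemma gamma_fun_measurable (R : realType) (x : R) :
  measurable_fun (`]0, +oo[%classic : set R) (EFin \o gamma_fun x).
Proof.
apply/measurable_EFinP; apply: open_continuous_measurable_fun => //.
by move=> t; rewrite inE/= in_itv/= andbT; exact: gamma_fun_continuous.
Qed.

(** For x < 1 the integrand of Gamma is singular at 0, so the half-line is exhausted by compact
    intervals, on which integration by parts is legitimate. *)
Definition gamma_itv (R : realType) (n : nat) : set R := `[n.+1%:R^-1, n.+1%:R]%classic.
Arguments gamma_itv : clear implicits.

Lemma gamma_itv_pos (R : realType) n (t : R) : gamma_itv R n t -> 0 < t.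
Proof. by rewrite /gamma_itv/= in_itv/= => /andP[h _]; apply: (lt_le_trans _ h); rewrite invr_gt0. Qed.

Lemma gamma_itv_cup (R : realType) : \bigcup_n gamma_itv R n = `]0, +oo[%classic.
Proof.
apply/seteqP; split => [t [n _] /gamma_itv_pos|t] /=; rewrite in_itv/= andbT//.
move=> t0; exists (maxn (Num.truncn t) (Num.truncn t^-1)) => //=.
rewrite /gamma_itv /= in_itv/=; apply/andP; split.
  rewrite invf_ple ?posrE//; apply: le_trans (ltW (truncnS_gt _)) _.
  by rewrite ler_nat ltnS leq_maxr.
apply: le_trans (ltW (truncnS_gt _)) _.
by rewrite ler_nat ltnS leq_maxl.
Qed.

Lemma gamma_fun_integrable (R : realType) (x : R) n :
  (@lebesgue_measure R).-integrable (gamma_itv R n) (EFin \o gamma_fun x).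
Proof.
apply: continuous_compact_integrable; first exact: segment_compact.
apply: continuous_in_subspaceT => t; rewrite inE => /gamma_itv_pos.
exact: gamma_fun_continuous.
Qed.

Lemma gamma_fun_cvg (R : realType) (x : R) :
  (\int[@lebesgue_measure R]_(t in gamma_itv R n) (gamma_fun x t)%:E)%E @[n --> \oo] -->
  (\int[@lebesgue_measure R]_(t in `]0%R, +oo[) (gamma_fun x t)%:E)%E.
Proof.
rewrite -gamma_itv_cup; apply: ge0_nondecreasing_set_cvg_integral.
- move=> m n mn; rewrite subsetEset => t; rewrite /gamma_itv /= !in_itv /= => /andP[h1 h2].
  apply/andP; split.
    by apply: le_trans h1; rewrite lef_pV2 ?posrE// ler_nat ltnS.
  by apply: le_trans h2 _; rewrite ler_nat ltnS.
- by move=> n; exact: measurable_itv.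
- move=> n; have := gamma_fun_measurable x; apply: measurable_funS => //.
  by rewrite -gamma_itv_cup; exact: bigcup_sup.
- by move=> n t _; rewrite lee_fin gamma_fun_ge0.
Qed.

(** The majorant is C exp(-t/2). Arguments in ]0, 1[ are reached from [x + 1] in [Gamma_rec_int]. *)
Lemma gamma_fin (R : realType) (x : R) : 1 <= x ->
  (\int[@lebesgue_measure R]_(t in `]0%R, +oo[) (gamma_fun x t)%:E < +oo)%E.
Proof.
move=> x1; have [C hC] := @powR_le_expR R (x - 1) (ltac:(by rewrite subr_ge0)).
have C0 : 0 <= C.
  have := hC 1 ltr01; rewrite powR1 => h.
  have : 0 <= C * expR (1 / 2) by exact: le_trans h.
  by rewrite pmulr_lge0// expR_gt0.
pose g (t : R) := C * expR (- (t / 2)).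
have dg (t : R) : is_derive t 1 (fun t : R => - 2 * C * expR (- (t / 2))) (g t).
  have h : is_derive t (1:R) (fun t : R => - (t / 2)) (- 2^-1).
    by apply: is_derive_eq; rewrite [X in - X](_ : _ = 2^-1) //; rewrite /GRing.scale/=; ring.
  have := is_deriveZ _ (is_derive1_comp (is_derive_expR _) h).
  move=> /(_ (- 2 * C)) h'; apply: is_derive_eq h' _.
  by rewrite /g /GRing.scale/=; field.
have cg : continuous g.
  move=> t; have h : is_derive t (1:R) (fun t : R => - (t / 2)) (- 2^-1).
    by apply: is_derive_eq; rewrite [X in - X](_ : _ = 2^-1) //; rewrite /GRing.scale/=; ring.
  exact: is_derive_continuous (is_deriveZ _ (is_derive1_comp (is_derive_expR _) h)).
have h1 : (\int[@lebesgue_measure R]_(t in `[0%R, +oo[) (g t)%:E = 0%:E - (- 2 * C * expR (- (0 / 2)))%:E)%E.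
  apply: (@ge0_continuous_FTC2y _ g (fun t => - 2 * C * expR (- (t / 2)))).
  - by move=> t _; rewrite mulr_ge0 ?expR_ge0.
  - exact: continuous_subspaceT.
  - rewrite -[0 in X in _ --> X](mulr0 (- 2 * C)); apply: cvgM; first exact: cvg_cst.
    apply: (@cvg_comp _ _ _ (fun t : R => t / 2) (fun t => expR (- t)) _ (+oo : set_system R)); last exact: cvgr_expR.
    apply/gt0_cvgMly => //; exact: cvg_id.
  - by move=> t _; have [] := dg t.
  - by apply: cvg_at_right_filter; exact: (is_derive_continuous (dg 0)).
  - by move=> t _; rewrite derive1E; have [_ ->] := dg t.
apply: (@le_lt_trans _ _ (\int[@lebesgue_measure R]_(t in `[0%R, +oo[) (g t)%:E)%E); last by rewrite h1 ltry.
have mg D : measurable_fun (D : set R) (EFin \o g).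
  by apply/measurable_EFinP; apply: measurable_funTS; exact: continuous_measurable_fun.
rewrite -integral_itv_obnd_cbnd//.
apply: ge0_le_integral => //.
- by move=> t _; rewrite lee_fin gamma_fun_ge0.
- exact: gamma_fun_measurable.
- exact: mg.
- move=> t /=; rewrite in_itv/= andbT => t0; rewrite lee_fin /gamma_fun /g.
  apply: (@le_trans _ _ (C * expR (t / 2) * expR (- t))).
    by rewrite ler_wpM2r ?expR_ge0// hC.
  by rewrite -mulrA -expRD (_ : t / 2 + - t = - (t / 2)) //; lra.
Qed.

Lemma gamma_boundary (R : realType) (x : R) : 0 < x ->
  (n.+1%:R `^ x * expR (- n.+1%:R) - (n.+1%:R^-1) `^ x * expR (- n.+1%:R^-1) : R) @[n --> \oo] --> 0.
Proof.
move=> x0; rewrite -[X in _ --> X](subr0 0); apply: cvgB.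
  have [C hC] := powR_le_expR (ltW x0).
  apply: (@squeeze_cvgr _ _ _ _ (cst 0) (fun n => C * expR (- (n.+1%:R / 2)))).
  - apply: nearW => n; rewrite mulr_ge0 ?powR_ge0 ?expR_ge0//=.
    apply: (@le_trans _ _ (C * expR (n.+1%:R / 2) * expR (- n.+1%:R))).
      by rewrite ler_wpM2r ?expR_ge0// hC.
    by rewrite -mulrA -expRD (_ : _ / 2 + - _ = - (n.+1%:R / 2)) //; lra.
  - exact: cvg_cst.
  - rewrite -[X in _ --> X](mulr0 C); apply: cvgM; first exact: cvg_cst.
    apply: (@cvg_comp _ _ _ (fun n : nat => n.+1%:R / 2 : R) (fun t => expR (- t)) _ (+oo : set_system R)); last exact: cvgr_expR.
    apply: (@cvg_comp _ _ _ (fun n : nat => n.+1%:R : R) (fun t => t / 2) _ (+oo : set_system R)); last by apply: gt0_cvgMly => //; exact: cvg_id.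
    rewrite (cvg_shiftS (fun n => n%:R : R)). exact: cvgr_idn.
apply: (@squeeze_cvgr _ _ _ _ (cst 0) (fun n => (n.+1%:R^-1) `^ x)).
- apply: nearW => n; rewrite mulr_ge0 ?powR_ge0 ?expR_ge0//=.
  by rewrite -[leRHS]mulr1 ler_wpM2l ?powR_ge0// expR_le1 oppr_le0.
- exact: cvg_cst.
apply: (@cvg_comp _ _ _ (fun n : nat => n.+1%:R^-1 : R) (fun t => t `^ x) _ (0^'+)); last exact: powR_cvg0.
move=> A [e /= e0 hA].
have [N _ hN] := near_infty_natSinv_lt (PosNum e0).
exists N => // n /= Nn; apply: hA; last by rewrite invr_gt0.
by rewrite /= sub0r normrN ger0_norm// hN.
Qed.

Lemma gamma_parts (R : realType) (x : R) n : 0 < x ->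
  Rintegral (@lebesgue_measure R) (gamma_itv R n) (gamma_fun (x + 1)) =
  x * Rintegral (@lebesgue_measure R) (gamma_itv R n) (gamma_fun x) -
  (n.+1%:R `^ x * expR (- n.+1%:R) - (n.+1%:R^-1) `^ x * expR (- n.+1%:R^-1)).
Proof.
move=> x0.
have mI : measurable (gamma_itv R n) by exact: measurable_itv.
suff : x * Rintegral (@lebesgue_measure R) (gamma_itv R n) (gamma_fun x) - Rintegral (@lebesgue_measure R) (gamma_itv R n) (gamma_fun (x + 1)) = n.+1%:R `^ x * expR (- n.+1%:R) - (n.+1%:R^-1) `^ x * expR (- n.+1%:R^-1).
  by move=> <-; rewrite subKr.
rewrite -RintegralZl//; last exact: gamma_fun_integrable.
rewrite -RintegralB//; last 2 first.
- apply: continuous_compact_integrable; first exact: segment_compact.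
  apply: continuous_in_subspaceT => t; rewrite inE => /gamma_itv_pos t0.
  have h : {for t, continuous (fun u : R => x * gamma_fun x u)} by apply: continuous_scale; exact: gamma_fun_continuous.
  exact: h.
- exact: gamma_fun_integrable.
pose F (t : R) := t `^ x * expR (- t).
have dF (t : R) : 0 < t -> is_derive t 1 F (x * gamma_fun x t - gamma_fun (x + 1) t).
  move=> t0; have h : is_derive t (1 : R) (fun t : R => - t) (-1) by apply: is_derive_eq.
  have := is_deriveM (is_derive_powR x t0) (is_derive1_comp (is_derive_expR (- t)) h).
  move=> h'; apply: is_derive_eq h' _.
  by rewrite /gamma_fun addrK /GRing.scale/=; ring.
rewrite /Rintegral.
(* For n = 0 the interval is the single point 1, where the fundamental theorem does not apply but
   both sides vanish. *)
case: n mI => [|n] mI.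
  by rewrite /gamma_itv invr1 set_itv1 integral_set1/= subrr.
rewrite (@continuous_FTC2 _ _ F)//.
- rewrite invf_plt ?posrE// (@lt_trans _ _ 1) ?invf_lt1//; by rewrite ltr1n.
- apply: continuous_in_subspaceT => t; rewrite inE => /gamma_itv_pos t0.
  have h : {for t, continuous (fun u : R => x * gamma_fun x u)} by apply: continuous_scale; exact: gamma_fun_continuous.
  have h' : {for t, continuous (fun u : R => x * gamma_fun x u - gamma_fun (x + 1) u)}.
    by apply: continuousB; [exact: h|exact: gamma_fun_continuous].
  exact: h'.
- split.
  + move=> t ht; have t0 : 0 < t by move: ht; rewrite in_itv/= => /andP[h _]; apply: (lt_trans _ h); rewrite invr_gt0.
    by have [] := dF t t0.
  + by apply: cvg_at_right_filter; apply: is_derive_continuous (dF _ _); rewrite invr_gt0.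
  + by apply: cvg_at_left_filter; apply: is_derive_continuous (dF _ _).
- move=> t ht; have t0 : 0 < t by move: ht; rewrite in_itv/= => /andP[h _]; apply: (lt_trans _ h); rewrite invr_gt0.
  by rewrite derive1E; have [_ ->] := dF t t0.
Qed.

(** Stated for the extended integral, so that finiteness at [x] follows from finiteness at [x + 1]
    together with the functional equation. *)
Lemma Gamma_rec_int (R : realType) (x : R) : 0 < x ->
  (\int[@lebesgue_measure R]_(t in `]0%R, +oo[) (gamma_fun x t)%:E = (x^-1 * Gamma (x + 1))%:E)%E.
Proof.
move=> x0.
have fin1 : (\int[@lebesgue_measure R]_(t in `]0%R, +oo[) (gamma_fun (x + 1) t)%:E \is a fin_num)%E.
  rewrite ge0_fin_numE ?gamma_fin ?lerDr ?(ltW x0)//.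
  by apply: integral_ge0 => t _; rewrite lee_fin gamma_fun_ge0.
have h1 : Rintegral (@lebesgue_measure R) (gamma_itv R n) (gamma_fun (x + 1)) @[n --> \oo] --> Gamma (x + 1).
  apply: fine_cvg; rewrite /Gamma /Rintegral (fineK fin1); exact: gamma_fun_cvg.
have h2 : Rintegral (@lebesgue_measure R) (gamma_itv R n) (gamma_fun x) @[n --> \oo] --> x^-1 * Gamma (x + 1).
  have -> : (fun n => Rintegral (@lebesgue_measure R) (gamma_itv R n) (gamma_fun x)) =
     (fun n => x^-1 * (Rintegral (@lebesgue_measure R) (gamma_itv R n) (gamma_fun (x + 1)) +
      (n.+1%:R `^ x * expR (- n.+1%:R) - (n.+1%:R^-1) `^ x * expR (- n.+1%:R^-1)))).
    by apply/funext => n; rewrite gamma_parts// subrK mulKf// gt_eqF.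
  apply: cvgM; first exact: cvg_cst.
  rewrite -[X in _ --> X]addr0; apply: cvgD => //; exact: gamma_boundary.
have h3 := @gamma_fun_cvg R x; rewrite -(cvg_lim _ h3)//; apply: cvg_lim => //.
apply: cvg_EFin => //; apply: nearW => n.
by apply: integrable_fin_num; [exact: measurable_itv|exact: gamma_fun_integrable].
Qed.

Lemma GammaS (R : realType) (x : R) : 0 < x -> Gamma (x + 1) = x * Gamma x.
Proof.
move=> x0; rewrite [in RHS]/Gamma /Rintegral Gamma_rec_int//= mulVKf ?gt_eqF//.
Qed.

Lemma Gamma_gt0 (R : realType) (x : R) : 0 < x -> 0 < Gamma x.
Proof.
move=> x0; rewrite /Gamma /Rintegral.
have fin1 : (\int[@lebesgue_measure R]_(t in `]0%R, +oo[) (gamma_fun x t)%:E \is a fin_num)%E.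
  by rewrite Gamma_rec_int.
(* A lower bound of the integrand on [1, 2]: t^(x-1) is monotone there, so its minimum is taken at
   an end point. *)
pose c : R := expR (- 2) * Num.min 1 (2 `^ (x - 1)).
have c0 : 0 < c by rewrite mulr_gt0 ?expR_gt0// lt_min ltr01 powR_gt0.
rewrite -lte_fin fineK//; apply: (@lt_le_trans _ _ (c%:E)); first by rewrite lte_fin.
apply: (@le_trans _ _ (\int[@lebesgue_measure R]_(t in `[1%R, 2%R]) (gamma_fun x t)%:E)%E); last first.
  apply: ge0_subset_integral => //.
  - exact: gamma_fun_measurable.
  - by move=> t _; rewrite lee_fin gamma_fun_ge0.
  - by move=> t /=; rewrite !in_itv/= andbT => /andP[h _]; apply: lt_le_trans h.
have -> : c%:E = (\int[@lebesgue_measure R]_(t in `[1%R, 2%R]) (cst c%:E t))%E.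
  rewrite integral_cst//= lebesgue_measure_itv/= lte_fin ltr1n/= -EFinB -EFinM.
  by congr EFin; rewrite (_ : 2 - 1 = 1) ?mulr1//; ring.
apply: ge0_le_integral => //.
- by move=> t _ /=; rewrite lee_fin ltW.
- apply: measurable_funS (gamma_fun_measurable x) => //.
  by move=> t /=; rewrite !in_itv/= andbT => /andP[h _]; apply: lt_le_trans h.
- move=> t /=; rewrite in_itv/= => /andP[t1 t2]; rewrite lee_fin /gamma_fun mulrC.
  apply: ler_pM; rewrite ?expR_ge0 ?powR_ge0//.
  + by rewrite ler_expR lerN2.
  + have t0 : 0 < t by exact: lt_le_trans t1.
    rewrite ge_min; have [h|h] := lerP 1 x; apply/orP; [left|right].
      by rewrite -[leLHS](powRr0 (t : R)); apply: ler_powR => //; rewrite subr_ge0.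
    rewrite -[x - 1]opprB !powRN lef_pV2 ?posrE ?powR_gt0//.
    by apply: ge0_ler_powR => //; rewrite ?nnegrE ?subr_ge0 ?(ltW h)// ltW.
Qed.

(** * The entire function A_mu *)

(** The product is Gamma(n + mu + 1) / Gamma(mu + 1), see [GammaD]; in this form the coefficients do
    not involve Gamma. *)
Definition bessel_coef (R : realType) (mu : R) (n : nat) : R :=
  (-1) ^+ n / (4 ^+ n * n`!%:R * \prod_(i < n) (mu + 1 + i%:R)).

Definition bterm (R : realType) (mu : R) (z : C R) (n : nat) : C R :=
  toC (bessel_coef mu n) * z ^+ (2 * n).

(* A_mu; here and below, the suffix 1 denotes the derivative. *)
HB.lock Definition bA (R : realType) (mu : R) (z : C R) : C R := limn (series (bterm mu z)).

Lemma bcoef_rec (R : realType) (mu : R) n : -1 < mu ->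
  bessel_coef mu n.+1 = - bessel_coef mu n / (4 * n.+1%:R * (mu + 1 + n%:R)).
Proof.
move=> mu1; rewrite /bessel_coef big_ord_recr /= factS natrM !exprS !invfM.
have h1 : mu + 1 + n%:R != 0 by rewrite gt_eqF// ltr_wpDr// -ltrBlDr sub0r.
ring.
Qed.

Lemma bcoef_shift (R : realType) (mu : R) n : -1 < mu ->
  bessel_coef mu n.+1 * (2 * n.+1)%:R = - (2^-1 / (mu + 1)) * bessel_coef (mu + 1) n.
Proof.
move=> mu1; rewrite /bessel_coef big_ord_recl /= factS !natrM !exprS !invfM addr0.
have -> : \prod_(i < n) (mu + 1 + (bump 0 i)%:R) = \prod_(i < n) (mu + 1 + 1 + i%:R) :> R.
  by apply: eq_bigr => i _; rewrite /bump add1n -natr1; ring.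
have h : n.+1%:R * n.+1%:R^-1 = 1 :> R by rewrite divff.
have e : (4:R)^-1 * 2 = 2^-1 by field.
set a := 4^-1 in e *; set b := 4 ^- n; set c := n.+1%:R^-1 in h *.
set d := (n`!)%:R^-1; set m := (mu + 1)^-1; set p := (\prod_(i < n) _)^-1.
transitivity (- (a * 2) * (n.+1%:R * c) * (-1) ^+ n * b * d * m * p); first by ring.
by rewrite h e; ring.
Qed.

(** The three-term recurrence of Bessel functions, read on coefficients. Through [bA_contig] it
    yields the second derivative of A_mu without a second termwise differentiation. *)
Lemma bcoef_contig (R : realType) (mu : R) n : -1 < mu ->
  bessel_coef mu n.+1 = bessel_coef (mu + 1) n.+1 - (4 * (mu + 1) * (mu + 1 + 1))^-1 * bessel_coef (mu + 1 + 1) n.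
Proof.
move=> mu1; have mu2 : -1 < mu + 1 by lra.
have s := bcoef_shift n mu1; have s2 := bcoef_shift n mu2.
have n0 : (2 * n.+1)%:R != 0 :> R by rewrite pnatr_eq0.
apply: (mulIf n0); rewrite s mulrBl s2.
have r : bessel_coef (mu + 1) n = bessel_coef (mu + 1 + 1) n * (mu + 1 + 1 + n%:R) / (mu + 1 + 1).
  have e : bessel_coef (mu + 1) n * \prod_(i < n) (mu + 1 + 1 + i%:R) =
           bessel_coef (mu + 1 + 1) n * \prod_(i < n) (mu + 1 + 1 + 1 + i%:R).
    have p1 : \prod_(i < n) (mu + 1 + 1 + i%:R) != 0 :> R.
      by apply/prodf_neq0 => i _; rewrite gt_eqF// ltr_wpDr//; lra.
    have p2 : \prod_(i < n) (mu + 1 + 1 + 1 + i%:R) != 0 :> R.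
      by apply/prodf_neq0 => i _; rewrite gt_eqF// ltr_wpDr//; lra.
    by rewrite /bessel_coef !invfM !mulrA !divfK.
  have p1 : \prod_(i < n) (mu + 1 + 1 + i%:R) != 0 :> R.
    by apply/prodf_neq0 => i _; rewrite gt_eqF// ltr_wpDr//; lra.
  have m2 : mu + 1 + 1 != 0 by rewrite gt_eqF//; lra.
  have hP : \prod_(i < n) (mu + 1 + 1 + 1 + i%:R) = \prod_(i < n) (mu + 1 + 1 + i%:R) * (mu + 1 + 1 + n%:R) / (mu + 1 + 1).
    apply: (mulIf m2); rewrite divfK//.
    transitivity (\prod_(i < n.+1) (mu + 1 + 1 + i%:R)); last by rewrite big_ord_recr.
    rewrite big_ord_recl /= addr0 mulrC; congr (_ * _).
    by apply: eq_bigr => i _; rewrite /bump add1n -natr1; ring.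
  apply: (mulIf p1); rewrite {}e {}hP; ring.
rewrite r natrM -natr1.
have m2 : mu + 1 + 1 != 0 by rewrite gt_eqF//; lra.
have m1 : mu + 1 != 0 by rewrite gt_eqF//; lra.
field. by apply/andP.
Qed.

(** [b n] compares the coefficient with that of cosh(lam x). The ratio b(n+1)/b(n) is (2n+1) /
    (2(mu+1+n) lam^2), at most 1 as soon as n(2 lam^2 - 2) >= 1, which fixes [N]. The sum of the
    first [N.+1] values, all nonnegative, serves as a bound for each of them. *)
Lemma bcoef_growth (R : realType) (mu lam : R) : -1 < mu -> 1 < lam ->
  exists2 K, 0 <= K & forall n, `|bessel_coef mu n| <= K * (lam ^+ (2 * n) / (2 * n)`!%:R).
Proof.
move=> mu1 l1; pose b n := `|bessel_coef mu n| * (2 * n)`!%:R / lam ^+ (2 * n).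
have l0 : 0 < lam by lra.
have lp m : 0 < lam ^+ m by exact: exprn_gt0.
have b0 n : 0 <= b n by rewrite mulr_ge0// ?invr_ge0 ?ltW// mulr_ge0.
pose N := (Num.truncn (2 * lam ^+ 2 - 2)^-1).+1.
have l2 : 0 < 2 * lam ^+ 2 - 2 by rewrite expr2; nra.
have step n : (N <= n)%N -> b n.+1 <= b n.
  move=> Nn; have hn : (2 * lam ^+ 2 - 2)^-1 <= n%:R.
    by apply: le_trans (ltW (truncnS_gt _)) _; rewrite ler_nat.
  have hn' : 1 <= n%:R * (2 * lam ^+ 2 - 2) by rewrite -ler_pdivrMr// mul1r.
  have d0 : 0 < mu + 1 + n%:R by rewrite ltr_wpDr//; lra.
  rewrite /b bcoef_rec// normrM normrN normfV.
  rewrite (ger0_norm (x := 4 * _ * _)); last by rewrite !mulr_ge0// ltW.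
  rewrite (_ : (2 * n.+1)%N = (2 * n).+2); last by rewrite mulnS.
  rewrite !factS !natrM !exprS.
  have -> : (2 * n).+2%:R = 2 * n.+1%:R :> R by rewrite -natrM; congr (_%:R); rewrite mulnS.
  rewrite [leLHS](_ : _ = `|bessel_coef mu n| * ((4 * n.+1%:R * (mu + 1 + n%:R))^-1 * (2 * n.+1%:R * ((2 * n).+1%:R * (2 * n)`!%:R) /
      (lam * (lam * lam ^+ (2 * n)))))); last by ring.
  rewrite [leRHS](_ : _ = `|bessel_coef mu n| * ((lam ^+ (2 * n))^-1 * (2 * n)`!%:R)); last by ring.
  rewrite ler_wpM2l//.
  have f0 : 0 < (2 * n)`!%:R :> R by rewrite ltr0n fact_gt0.
  rewrite -subr_ge0.
  have -> : (lam ^+ (2 * n))^-1 * (2 * n)`!%:R -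
     (4 * n.+1%:R * (mu + 1 + n%:R))^-1 * (2 * n.+1%:R * ((2 * n).+1%:R * (2 * n)`!%:R) /
      (lam * (lam * lam ^+ (2 * n)))) =
     (2 * n)`!%:R / (lam ^+ (2 * n)) / (2 * (mu + 1 + n%:R) * lam ^+ 2) *
      (2 * (mu + 1 + n%:R) * lam ^+ 2 - (2 * n).+1%:R).
    have nn : n.+1%:R != 0 :> R by rewrite pnatr_eq0.
    have nn' : 1 + n%:R != 0 :> R by rewrite addrC natr1.
    have d1 := gt_eqF d0; have l3 := gt_eqF l0; have l4 := gt_eqF (lp (2 * n)%N).
    field. by rewrite ?nn ?nn' ?d1 ?l3 ?l4.
  apply: mulr_ge0.
    by rewrite divr_ge0 ?divr_ge0 ?ltW// mulr_gt0 ?mulr_gt0.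
  rewrite subr_ge0 -natr1 natrM.
  have : 0 <= 2 * (mu + 1) * lam ^+ 2 by rewrite !mulr_ge0 ?sqr_ge0//; lra.
  move: hn'; rewrite !mulrDr !mulrDl; lra.
exists (\sum_(i < N.+1) b i); first by apply: sumr_ge0.
move=> n; have f0 : 0 < (2 * n)`!%:R :> R by rewrite ltr0n fact_gt0.
rewrite mulrA ler_pdivlMr// -ler_pdivrMr// -/(b n).
elim: n f0 => [|n IH] f0.
  by rewrite (bigD1 ord0)//= lerDl sumr_ge0.
have [Nn|nN] := leqP N n.
  by apply: (le_trans (step _ Nn)); apply: IH; rewrite ltr0n fact_gt0.
by rewrite (bigD1 (Ordinal (n:=N.+1) (m:=n.+1) nN))//= lerDl sumr_ge0.
Qed.

Lemma ler_sum_expR (R : realType) (y : R) n : 0 <= y ->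
  \sum_(0 <= i < n) y ^+ i / i`!%:R <= expR y.
Proof.
move=> y0; have nd : nondecreasing_seq (series (exp_coeff y)).
  by apply: nondecreasing_series => i _ _; exact: exp_coeff_ge0.
exact: (nondecreasing_cvgn_le nd (is_cvg_series_exp_coeff y) n).
Qed.

Lemma ler_sum_expR_even (R : realType) (y : R) (B : {fset nat}) : 0 <= y ->
  \sum_(i <- B) y ^+ (2 * i) / (2 * i)`!%:R <= expR y.
Proof.
move=> y0; pose N := (\max_(i <- B) i.+1)%N.
have h0 i : 0 <= y ^+ i / i`!%:R by rewrite divr_ge0// exprn_ge0.
apply: (@le_trans _ _ (\sum_(i <- [fset x | x in iota 0 N]%fset) y ^+ (2 * i) / (2 * i)`!%:R)).
  apply: ler_sum_fsub => // ; apply/fsubsetP => i iA; rewrite !inE /= mem_iota /= add0n.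
  exact: leq_bigmax_seq iA _.
rewrite (perm_big (iota 0 N)); last first.
  apply: uniq_perm; rewrite ?iota_uniq ?fset_uniq//.
  by move=> x; rewrite !inE.
apply: le_trans (ler_sum_expR (2 * N) y0).
elim: N => [|N IH]; first by rewrite big_nil sumr_ge0.
rewrite -addn1 iotaD big_cat big_seq1 add0n /= mulnDr /= muln1 addn2 !big_nat_recr//=.
rewrite -addrA lerD//= lerDl. exact: h0.
Qed.

Lemma bcoef_sum (R : realType) (mu lam : R) : -1 < mu -> 1 < lam ->
  exists2 K, 0 <= K & forall (x : R) (B : {fset nat}), 0 <= x ->
    \sum_(n <- B) `|bessel_coef mu n| * x ^+ (2 * n) <= K * expR (lam * x).
Proof.
move=> mu1 l1; have [K K0 hK] := bcoef_growth mu1 l1; exists K => // x B x0.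
apply: (@le_trans _ _ (\sum_(n <- B) K * ((lam * x) ^+ (2 * n) / (2 * n)`!%:R))).
  apply: ler_sum => n _; apply: le_trans (ler_wpM2r (exprn_ge0 _ x0) (hK n)) _.
  by rewrite exprMn [leRHS](_ : _ = K * (lam ^+ (2 * n) / (2 * n)`!%:R) * x ^+ (2 * n))//; ring.
rewrite -mulr_sumr ler_wpM2l// ler_sum_expR_even// mulr_ge0//; lra.
Qed.

Lemma cabs_bterm (R : realType) (mu : R) (z : C R) n :
  cabs (bterm mu z n) = `|bessel_coef mu n| * cabs z ^+ (2 * n).
Proof. by rewrite /bterm cabsM cabs_toC cabsX. Qed.

Lemma bA_has_sum (R : realType) (mu : R) (z : C R) : -1 < mu ->
  has_sum (bterm mu z) (bA mu z).
Proof.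
move=> mu1; have [K K0 hK] := bcoef_sum mu1 (ltac:(lra) : (1 : R) < 2).
have [l hl] : exists l, has_sum (bterm mu z) l.
  apply: (@has_sum_ex _ _ _ (K * expR (2 * cabs z))) => B.
  under eq_bigr do rewrite cabs_bterm.
  exact/hK/cabs_ge0.
suff -> : bA mu z = l by [].
by rewrite bA.unlock; apply: cvg_lim; [exact: norm_hausdorff|exact: has_sum_series].
Qed.

Lemma bA_growth (R : realType) (mu lam : R) : -1 < mu -> 1 < lam ->
  exists2 K, 0 <= K & forall z : C R, cabs (bA mu z) <= K * expR (lam * cabs z).
Proof.
move=> mu1 l1; have [K K0 hK] := bcoef_sum mu1 l1; exists K => // z.
apply: (has_sum_le (bA_has_sum z mu1)) => B; apply: le_trans (cabs_sum _ _ _) _.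
under eq_bigr do rewrite cabs_bterm.
exact/hK/cabs_ge0.
Qed.

Lemma qbound_id (R : realType) (z : C R) : qbound id z 1 (cabs z + 1).
Proof.
split; first by rewrite lerDl.
  by rewrite -[1]/(1%:R) cabs_nat lerDr cabs_ge0.
move=> h _; rewrite (_ : z + h - z - h * 1 = 0); last by ring.
by rewrite cabs0 mulr_ge0 ?sqr_ge0// addr_ge0 ?cabs_ge0.
Qed.

(** The factor 6 in [X] pays for the constant of [qboundM] at each multiplication by w, so that the
    bound stays geometric in n. *)
Lemma qbound_exp (R : realType) (z : C R) (n : nat) (X : R) : 6 * (cabs z + 1) <= X ->
  qbound (fun w => w ^+ n) z (n%:R * z ^+ n.-1) (X ^+ n).
Proof.
move=> hX; have c0 := cabs_ge0 z; elim: n => [|n IH].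
  split.
  - by rewrite expr0 -[X in cabs X]/(1%:R) cabs_nat.
  - by rewrite mul0r cabs0.
  - by move=> h _; rewrite !expr0 mul0r mulr0 !subr0 subrr cabs0 mul1r sqr_ge0.
have := qboundM (qbound_id z) IH.
have -> : 1 * z ^+ n + z * (n%:R * z ^+ n.-1) = n.+1%:R * z ^+ n.
  by case: n {IH} => [|n]; rewrite -natr1 /= ?exprS; ring.
move=> h; have := @qbound_le _ _ _ _ _ (X ^+ n.+1) _ h.
have -> : (fun w : C R => id w * w ^+ n) = (fun w => w ^+ n.+1).
  by apply/funext => w; rewrite exprS.
by apply; rewrite exprS ler_wpM2r// exprn_ge0//; lra.
Qed.

Lemma has_sum_shift (R : realType) (u v : nat -> C R) (l l' : C R) :
  has_sum u l -> has_sum v l' -> v 0%N = 0 -> (forall n, v n.+1 = u n) -> l' = l.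
Proof.
move=> hu hv v0 vS; apply/eqP; rewrite -subr_eq0 -cabs_eq0 eq_le cabs_ge0 andbT.
apply/ler_addgt0Pr => e e0; rewrite add0r.
have e20 : 0 < e / 2 by rewrite divr_gt0.
have [N hN] := has_sum_iota hu e20; have [M hM] := has_sum_iota hv e20.
have h1 := hN (maxn N M) (leq_maxl _ _).
have h2 := hM (maxn N M).+1 (leq_trans (leq_maxr N M) (leqnSn _)).
rewrite big_nat_recl// v0 add0r (eq_bigr u) in h2; last by move=> i _; exact: vS.
set S := \sum_(_ <= _ < _) _ in h1 h2.
have -> : l' - l = (S - l) - (S - l') by ring.
by apply: le_trans (cabsB _ _) _; rewrite [e]splitr lerD// ltW.
Qed.

Lemma le_of_eq (R : realType) (x y : R) : x = y -> x <= y.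
Proof. by move=> ->. Qed.

Definition bA1 (R : realType) (mu : R) (z : C R) : C R :=
  - (toC (2^-1 / (mu + 1)) * z * bA (mu + 1) z).

(** The series of derivatives stays in the statement for [bQ_has_sum]: at a node the divided
    differences of the powers become their derivatives. *)
Lemma bA_qbound_sum (R : realType) (mu : R) (z : C R) : -1 < mu ->
  has_sum (fun n => toC (bessel_coef mu n) * ((2 * n)%:R * z ^+ (2 * n).-1)) (bA1 mu z) /\
  exists K, qbound (bA mu) z (bA1 mu z) K.
Proof.
move=> mu1; have [K K0 hK] := bcoef_sum mu1 (ltac:(lra) : (1 : R) < 2).
have c0 := cabs_ge0 z.
pose X := 6 * (cabs z + 1).
have [V hV qV] := @qbound_sum R nat (fun n w => bterm mu w n) z
   (fun n => toC (bessel_coef mu n) * ((2 * n)%:R * z ^+ (2 * n).-1))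
   (fun n => `|bessel_coef mu n| * X ^+ (2 * n)) (K * expR (2 * X)) (bA mu)
   (fun n => qboundZ (le_of_eq (cabs_toC (bessel_coef mu n))) (qbound_exp (2 * n) (lexx X)))
   (fun B => hK X B (ltac:(rewrite /X; lra))) (fun w => bA_has_sum w mu1).
suff -> : bA1 mu z = V by split => //; exists (K * expR (2 * X)).
symmetry; rewrite /bA1 -mulNr.
have mu2 : -1 < mu + 1 by lra.
apply: (has_sum_shift (has_sumZ (- (toC (2^-1 / (mu + 1)) * z)) (bA_has_sum z mu2)) hV).
  by rewrite muln0 mul0r mulr0.
move=> n; rewrite mulrA -toC_nat -toCM bcoef_shift// /bterm mulnS /= exprS.
by rewrite toCM toCN; ring.
Qed.

Lemma bA_qbound (R : realType) (mu : R) (z : C R) : -1 < mu ->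
  exists K, qbound (bA mu) z (bA1 mu z) K.
Proof. by move=> /(bA_qbound_sum z) []. Qed.

Lemma bA_contig (R : realType) (mu : R) (z : C R) : -1 < mu ->
  bA mu z = bA (mu + 1) z - toC (4 * (mu + 1) * (mu + 1 + 1))^-1 * z ^+ 2 * bA (mu + 1 + 1) z.
Proof.
move=> mu1; have mu2 : -1 < mu + 1 by lra.
have mu3 : -1 < mu + 1 + 1 by lra.
apply/eqP; rewrite addrC -subr_eq; apply/eqP; rewrite -mulNr.
apply: (has_sum_shift (has_sumZ _ (bA_has_sum z mu3)) (has_sumB (bA_has_sum z mu1) (bA_has_sum z mu2))).
  by rewrite /bterm /bessel_coef !muln0 !expr0 !big_ord0 subrr.
move=> n; rewrite /bterm bcoef_contig// mulnS exprD toCB toCM; ring.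
Qed.

Lemma bA_even (R : realType) (mu : R) (z : C R) : bA mu (- z) = bA mu z.
Proof.
rewrite !bA.unlock; congr (limn (series _)); apply/funext => n.
by rewrite /bterm exprM sqrrN -exprM.
Qed.

Lemma bA0 (R : realType) (mu : R) : -1 < mu -> bA mu 0 = 1.
Proof.
move=> mu1; apply: (has_sum_unique (bA_has_sum 0 mu1)) => e e0.
exists [fset 0%N]%fset => B hB.
rewrite (big_fsetD1 0%N) /=; last by apply: (fsubsetP hB); rewrite inE.
rewrite big_seq big1 ?addr0 => [|i].
  rewrite /bterm /bessel_coef muln0 !expr0 big_ord0 fact0 !mulr1 divr1 (_ : toC 1 = 1)//.
  by rewrite subrr cabs0.
rewrite !inE => /andP[i0 _]; rewrite /bterm expr0n muln_eq0 (negbTE i0) /=.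
by rewrite mulr0.
Qed.

Lemma has_sum_Im0 (R : realType) (I : choiceType) (u : I -> C R) (l : C R) :
  (forall i, complex.Im (u i) = 0) -> has_sum u l -> complex.Im l = 0.
Proof.
move=> u0 hu; apply/eqP; rewrite -normr_eq0 eq_le normr_ge0 andbT.
apply/ler_addgt0Pr => e e0; rewrite add0r.
have [A /(_ A (fsubset_refl _)) hA] := hu e e0.
have S0 : complex.Im (\sum_(i <- A) u i) = 0.
  elim: (enum_fset A) => [|i s IH]; first by rewrite big_nil.
  rewrite big_cons; move: (u0 i) IH; case: (u i) => a b; case: (\sum_(_ <- _) _) => c d /= -> ->.
  by rewrite addr0.
have -> : complex.Im l = - complex.Im (\sum_(i <- A) u i - l).
  by move: S0; case: l {hA hu} => a b; case: (\sum_(_ <- _) _) => c d /= ->; rewrite add0r opprK.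
by rewrite normrN; apply: le_trans (Im_le _) (ltW hA).
Qed.

(** * Restriction of A_mu to the real line and Bessel's equation *)

HB.lock Definition rA (R : realType) (mu x : R) : R := complex.Re (bA mu (toC x)).
Definition rA1 (R : realType) (mu x : R) : R := - (2^-1 / (mu + 1) * x * rA (mu + 1) x).

Lemma bA_real (R : realType) (mu x : R) : -1 < mu -> bA mu (toC x) = toC (rA mu x).
Proof.
move=> mu1; have : complex.Im (bA mu (toC x)) = 0.
  apply: (has_sum_Im0 _ (bA_has_sum (toC x) mu1)) => n.
  by rewrite /bterm -toCX -toCM.
by rewrite rA.unlock; case: (bA _ _) => a b /= ->.
Qed.

Lemma bA1_real (R : realType) (mu x : R) : -1 < mu -> bA1 mu (toC x) = toC (rA1 mu x).
Proof. by move=> mu1; rewrite /bA1 bA_real ?toCN ?toCM//; lra. Qed.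

Lemma rA_even (R : realType) (mu x : R) : rA mu (- x) = rA mu x.
Proof. by rewrite !rA.unlock toCN bA_even. Qed.

Lemma rA1_odd (R : realType) (mu x : R) : rA1 mu (- x) = - rA1 mu x.
Proof. by rewrite /rA1 rA_even; ring. Qed.

Lemma rA0 (R : realType) (mu : R) : -1 < mu -> rA mu 0 = 1.
Proof. by move=> mu1; rewrite rA.unlock (_ : toC 0 = 0)// bA0. Qed.

Lemma derive_quad (R : realType) (f : R -> R) (x d K : R) :
  (forall h, `|h| <= 1 -> `|f (x + h) - f x - h * d| <= K * `|h| ^+ 2) -> is_derive x 1 f d.
Proof.
move=> hK.
have K0 : 0 <= K.
  have := hK 1; rewrite normr1 expr1n mulr1 => /(_ (lexx _)); exact: le_trans.
have hl : (fun h : R => h^-1 *: (f (h *: 1 + x) - f x)) @ 0^' --> d.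
  apply/cvgrPdist_lt => e e0.
  have d1 : 0 < Num.min 1 (e / (K + 1)) by rewrite lt_min ltr01 divr_gt0// ltr_wpDl.
  exists (Num.min 1 (e / (K + 1))) => //=.
  move=> h /=; rewrite sub0r normrN lt_min => /andP[h1 hd] h0.
  have := hK h (ltW h1).
  have -> : d - h^-1 *: (f (h *: 1 + x) - f x) = - (h^-1 * (f (x + h) - f x - h * d)).
    rewrite -[h *: 1]/(h * 1) mulr1 (addrC h x).
    rewrite -[_ *: _]/(h^-1 * _). field. exact: h0.
  rewrite normrN normrM normfV.
  set X := `|f _ - _ - _| => hX.
  have ch : 0 < `|h| by rewrite normr_gt0.
  rewrite mulrC ltr_pdivrMr//; apply: le_lt_trans hX _.
  rewrite expr2 mulrA ltr_pM2r//.
  apply: (@le_lt_trans _ _ ((K + 1) * `|h|)); first by rewrite ler_wpM2r// lerDl.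
  by rewrite mulrC -ltr_pdivlMr// ltr_wpDl.
apply: DeriveDef; first by apply/cvg_ex; exists d.
by apply: cvg_lim => //; exact: norm_hausdorff.
Qed.

Lemma rA_derive (R : realType) (mu x : R) : -1 < mu -> is_derive x 1 (rA mu) (rA1 mu x).
Proof.
move=> mu1; have [K [_ _ hK]] := bA_qbound (toC x) mu1.
apply: (@derive_quad _ _ _ _ K) => h h1.
have := hK (toC h); rewrite cabs_toC => /(_ h1).
by rewrite -toCD !bA_real// bA1_real// -toCM -!toCB cabs_toC.
Qed.

(** Bessel's equation for A_mu: differentiating the formula for [rA1] brings in the orders mu+1 and
    mu+2, and [bA_contig] expresses A_mu through the same two. *)
Lemma rA1_derive (R : realType) (mu x : R) : -1 < mu -> x != 0 ->
  is_derive x 1 (rA1 mu) (- ((2 * mu + 1) / x * rA1 mu x) - rA mu x).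
Proof.
move=> mu1 x0; have mu2 : -1 < mu + 1 by lra.
have mu3 : -1 < mu + 1 + 1 by lra.
have h := is_deriveN (is_deriveM (is_deriveZ (2^-1 / (mu + 1)) (@is_derive_id _ _ x (1 : R))) (rA_derive x mu2)).
apply: is_derive_eq h _.
have e : rA mu x = rA (mu + 1) x - (4 * (mu + 1) * (mu + 1 + 1))^-1 * x ^+ 2 * rA (mu + 1 + 1) x.
  by apply: toC_inj; rewrite toCB 2!toCM toCX -!bA_real// bA_contig.
rewrite e /rA1 /GRing.scale /=.
have m2 : mu + 1 + 1 != 0 by rewrite gt_eqF//; lra.
have m1 : mu + 1 != 0 by rewrite gt_eqF//; lra.
rewrite -[_ *: x]/(_ * x). by field; rewrite x0 m1 m2.
Qed.

(** * Principal powers, and A_nu and B_nu in terms of power series *)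

Lemma cpowD (R : realType) (z : C R) (a b : R) : z != 0 -> cpow z (a + b) = cpow z a * cpow z b.
Proof.
move=> z0; rewrite /cpow; set r := cabs z.
have r0 : r != 0 by rewrite cabs_eq0.
rewrite powRD ?r0 ?implybT//; rewrite mulrDl cosD sinD.
by apply/eqP; rewrite eq_complex /=; apply/andP; split; apply/eqP; ring.
Qed.

Lemma cpow0 (R : realType) (z : C R) : cpow z 0 = 1.
Proof. by rewrite /cpow powRr0 mul0r cos0 sin0 mulr1 mulr0. Qed.

(** This amounts to [carg z] being an argument of z, the branch cut included: acos gives the cosine,
    and the sign chosen in [carg] makes the sine agree with Im z. It is what reduces z^(-nu)
    z^(nu+1) to z in B_nu. *)
Lemma cpow1 (R : realType) (z : C R) : z != 0 -> cpow z 1 = z.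
Proof.
move=> z0; rewrite /cpow mul1r powRr1 ?cabs_ge0//.
have r0 : 0 < cabs z by rewrite lt_neqAle cabs_ge0 eq_sym cabs_eq0 z0.
have hre := Re_le z.
have hq : -1 <= complex.Re z / cabs z <= 1.
  by rewrite -ler_norml normrM normfV (gtr0_norm r0) ler_pdivrMr// mul1r.
have hc : cos (carg z) = complex.Re z / cabs z.
  by rewrite /carg; case: ifP => _; rewrite ?cosN acosK// in_itv.
have r2 : cabs z ^+ 2 = complex.Re z ^+ 2 + complex.Im z ^+ 2.
  case: z {z0 r0 hre hq hc} => a b; rewrite /cabs/= sqr_sqrtr// addr_ge0 ?sqr_ge0//.
have hs : cabs z * Num.sqrt (1 - (complex.Re z / cabs z) ^+ 2) = `|complex.Im z|.
  have -> Y : cabs z * Num.sqrt Y = Num.sqrt (cabs z ^+ 2 * Y).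
    by rewrite sqrtrM ?sqr_ge0// sqrtr_sqr ger0_norm ?cabs_ge0.
  rewrite mulrBr mulr1 -exprMn mulrC divfK ?gt_eqF// r2 addrAC subrr add0r.
  by rewrite sqrtr_sqr.
have hsn : cabs z * sin (carg z) = complex.Im z.
  rewrite /carg; case: ifP => im0; rewrite ?sinN sin_acos// ?mulrN hs.
    by rewrite ger0_norm.
  by rewrite ltr0_norm ?opprK// ltNge im0.
rewrite hc mulrC divfK ?gt_eqF// hsn.
by case: (z).
Qed.

Lemma GammaD (R : realType) (nu : R) n : -1 < nu ->
  Gamma (n%:R + nu + 1) = Gamma (nu + 1) * \prod_(i < n) (nu + 1 + i%:R).
Proof.
move=> nu1; elim: n => [|n IH]; first by rewrite big_ord0 mulr1 add0r.
rewrite big_ord_recr /= mulrA -IH -natr1.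
have -> : n%:R + 1 + nu + 1 = (n%:R + nu + 1) + 1 by ring.
rewrite GammaS; last by rewrite -addrA ltr_wpDl//; lra.
by rewrite mulrC; congr (_ * _); ring.
Qed.

Lemma besselJE (R : realType) (nu : R) (z : C R) : -1 < nu ->
  besselJ nu z = cpow (z / 2) nu * (toC (Gamma (nu + 1))^-1 * bA nu z).
Proof.
move=> nu1; rewrite /besselJ; congr (_ * _).
apply: cvg_lim; first exact: norm_hausdorff.
have hs := has_sum_series (has_sumZ (toC (Gamma (nu + 1))^-1) (bA_has_sum z nu1)).
rewrite [X in series X](_ : _ = (fun n => toC (Gamma (nu + 1))^-1 * bterm nu z n)) //.
apply/funext => n.
have two : (2 : C R) = toC 2 by rewrite toC_nat.
set G := Gamma _; have g0 : Gamma (nu + 1) != 0 by rewrite gt_eqF// Gamma_gt0//; lra.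
have -> : (-1) ^+ n / (n`!%:R * toC G) = toC ((-1) ^+ n / (n`!%:R * G)).
  by rewrite toCM toCX toCN toCV toCM toC_nat.
rewrite two -toCV exprMn -toCX /bterm [LHS](_ : _ = toC ((-1) ^+ n / (n`!%:R * G) * 2^-1 ^+ (2 * n)) * z ^+ (2 * n)); last first.
  by rewrite [in RHS]toCM; ring.
rewrite mulrA -toCM; congr (toC _ * _).
have e4 : 4 ^+ n = 2 ^+ (2 * n) :> R by rewrite exprM; congr (_ ^+ _); ring.
rewrite /bessel_coef /G GammaD// e4 exprVn !invfM; ring.
Qed.

(** The means of evaluating A_nu, B_nu and the summands: it suffices to exhibit a formula that is
    continuous at the exceptional point. *)
Lemma cont_extE (R : realType) (g F : C R -> C R) (a : C R) :
  (forall y, y != a -> g y = F y) -> {for a, continuous F} -> cont_ext g a = F.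
Proof.
move=> gF cF; apply/funext => z; rewrite /cont_ext; case: eqVneq => [->|]; last exact: gF.
apply: cvg_lim; first exact: norm_hausdorff.
have : F y @[y --> a^'] --> F a by apply: cvg_within_filter.
apply: cvg_trans; apply: near_eq_cvg.
by apply: nbhs_dnbhs_neq_ || (near=> y; symmetry; apply: gF; near: y; exact: nbhs_dnbhs_neq).
Unshelve. all: by end_near. Qed.

Lemma qbound_continuous (R : realType) (F : C R -> C R) (z F1 : C R) (K : R) :
  qbound F z F1 K -> {for z, continuous F}.
Proof. by move=> /qbound_derive [h _]; apply/differentiable_continuous/derivable1_diffP. Qed.

Lemma bA_continuous (R : realType) (mu : R) (z : C R) : -1 < mu -> {for z, continuous (bA mu)}.
Proof. by move=> mu1; have [K /qbound_continuous] := bA_qbound z mu1. Qed.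

Lemma besselAE (R : realType) (nu : R) : -1 < nu -> besselA nu = bA nu.
Proof.
move=> nu1; apply: cont_extE; last exact: bA_continuous.
move=> y y0; have y20 : y / 2 != 0 by rewrite mulf_neq0// invr_neq0// (pnatr_eq0 _ 2).
rewrite besselJE// [LHS](_ : _ = (cpow (y / 2) (- nu) * cpow (y / 2) nu) *
  (toC (Gamma (nu + 1)) * toC (Gamma (nu + 1))^-1 * bA nu y)); last by ring.
rewrite -cpowD// addNr cpow0 mul1r -toCM divff ?[toC 1]/(1)%R ?mul1r//.
by rewrite gt_eqF// Gamma_gt0//; lra.
Qed.

Lemma besselBE (R : realType) (nu : R) : -1 < nu ->
  besselB nu = (fun z => toC (2^-1 / (nu + 1)) * z * bA (nu + 1) z).
Proof.
move=> nu1; have nu2 : -1 < nu + 1 by lra.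
apply: cont_extE; last first.
  apply: (@continuousM _ _ (fun z => toC (2^-1 / (nu + 1)) * z) (bA (nu + 1))); last exact: bA_continuous.
  exact: (qbound_continuous (qboundZ (lexx (cabs (toC (2^-1 / (nu + 1))))) (qbound_id 0))).
move=> y y0; have y20 : y / 2 != 0 by rewrite mulf_neq0// invr_neq0// (pnatr_eq0 _ 2).
rewrite besselJE// [LHS](_ : _ = (cpow (y / 2) (- nu) * cpow (y / 2) (nu + 1)) *
  (toC (Gamma (nu + 1)) * (toC (Gamma (nu + 1 + 1))^-1 * bA (nu + 1) y))); last by ring.
rewrite -cpowD// addrA addNr add0r cpow1//.
have g0 : 0 < Gamma (nu + 1) by apply: Gamma_gt0; lra.
have n0 : 0 < nu + 1 by lra.
have two : (2 : C R) = toC 2 by rewrite toC_nat.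
rewrite two -toCV [LHS](_ : _ = toC (2^-1 * Gamma (nu + 1) * (Gamma (nu + 1 + 1))^-1) * y * bA (nu + 1) y); last first.
  by rewrite !toCM; ring.
congr (toC _ * _ * _); rewrite (GammaS n0).
by field; rewrite !gt_eqF.
Qed.

Lemma besselJ_eq0 (R : realType) (nu x : R) : -1 < nu -> 0 < x ->
  besselJ nu (toC x) = 0 <-> rA nu x = 0.
Proof.
move=> nu1 x0; have g0 : Gamma (nu + 1) != 0 by rewrite gt_eqF// Gamma_gt0//; lra.
have x20 : toC x / 2 != 0.
  by rewrite mulf_neq0 ?invr_neq0// ?(pnatr_eq0 _ 2)// (inj_eq (@toC_inj R) x 0) gt_eqF.
have c0 : cpow (toC x / 2) nu != 0.
  apply/eqP => c0; have := cpowD nu (- nu) x20.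
  by rewrite c0 mul0r subrr cpow0 => /eqP; rewrite oner_eq0.
rewrite besselJE// bA_real//; split => [/eqP|->]; last by rewrite (_ : toC 0 = 0)// !mulr0.
rewrite !mulf_eq0 (negbTE c0) /= (inj_eq (@toC_inj R) _ 0) invr_eq0 (negbTE g0) /=.
by rewrite (inj_eq (@toC_inj R) _ 0) => /eqP.
Qed.

(** * Solutions of u'' = (q/x^2 - 1) u *)

Lemma deriveM_real (R : realType) (f g : R -> R) (x a b : R) :
  is_derive x 1 f a -> is_derive x 1 g b ->
  is_derive x 1 (fun t => f t * g t) (a * g x + f x * b).
Proof.
move=> hf hg; apply: is_derive_eq (is_deriveM hf hg) _.
by rewrite /GRing.scale /=; ring.
Qed.
Lemma deriveD_real (R : realType) (f g : R -> R) (x a b : R) :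
  is_derive x 1 f a -> is_derive x 1 g b -> is_derive x 1 (fun t => f t + g t) (a + b).
Proof. by move=> hf hg; exact: is_deriveD hf hg. Qed.
Lemma deriveN_real (R : realType) (f : R -> R) (x a : R) :
  is_derive x 1 f a -> is_derive x 1 (fun t => - f t) (- a).
Proof. by move=> hf; exact: is_deriveN hf. Qed.
Lemma deriveV_real (R : realType) (f : R -> R) (x a : R) : f x != 0 ->
  is_derive x 1 f a -> is_derive x 1 (fun t => (f t)^-1) (- a / f x ^+ 2).
Proof.
move=> f0 hf; apply: is_derive_eq (is_deriveV f0 hf) _.
by rewrite /GRing.scale /=; ring.
Qed.
Lemma derive_expR_real (R : realType) (f : R -> R) (x a : R) :
  is_derive x 1 f a -> is_derive x 1 (fun t => expR (f t)) (expR (f x) * a).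
Proof. by move=> hf; exact: is_derive1_comp (is_derive_expR _) hf. Qed.
Lemma derive_cos_real (R : realType) (f : R -> R) (x a : R) :
  is_derive x 1 f a -> is_derive x 1 (fun t => cos (f t)) (- sin (f x) * a).
Proof. by move=> hf; exact: is_derive1_comp (is_derive_cos _) hf. Qed.
Lemma derive_sin_real (R : realType) (f : R -> R) (x a : R) :
  is_derive x 1 f a -> is_derive x 1 (fun t => sin (f t)) (cos (f x) * a).
Proof. by move=> hf; exact: is_derive1_comp (is_derive_sin _) hf. Qed.
Lemma derive_cst_real (R : realType) (c x : R) : is_derive x 1 (fun _ : R => c) 0.
Proof. exact: is_derive_cst. Qed.

Lemma derive_conv (R : realType) (f : R -> R) (x a b : R) :
  is_derive x 1 f a -> a = b -> is_derive x 1 f b.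
Proof. by move=> h <-. Qed.

Lemma mean_value (R : realType) (f df : R -> R) (a b : R) : a < b ->
  (forall x, a <= x <= b -> is_derive x 1 f (df x)) ->
  exists2 c, a < c < b & f b - f a = df c * (b - a).
Proof.
move=> ab h; have [] := @MVT R f df a b ab.
- by move=> x; rewrite in_itv/= => /andP[xa xb]; apply: h; rewrite !ltW.
- apply: derivable_within_continuous => x; rewrite in_itv/= => hx.
  by have [] := h x hx.
by move=> c; rewrite in_itv/= => hc e; exists c.
Qed.

Lemma nondecr_derive (R : realType) (f df : R -> R) (a b : R) : a <= b ->
  (forall x, a <= x <= b -> is_derive x 1 f (df x)) ->
  (forall x, a <= x <= b -> 0 <= df x) -> f a <= f b.
Proof.
rewrite le_eqVlt => /predU1P[->//|ab] h h0.
have [c /andP[ca cb] e] := mean_value ab h.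
by rewrite -subr_ge0 e mulr_ge0 ?h0 ?subr_ge0 ?(ltW ab)// !ltW.
Qed.

(* The last clause excludes u = 0 without appealing to uniqueness for the Cauchy problem. *)
Definition sturm (R : realType) (q : R) (u u1 : R -> R) : Prop :=
  [/\ forall x : R, 0 < x -> is_derive x 1 u (u1 x),
      forall x : R, 0 < x -> is_derive x 1 u1 ((q / x ^+ 2 - 1) * u x) &
      forall x : R, 0 < x -> exists y, 0 < y <= x /\ u y != 0].

Definition energy (R : realType) (u u1 : R -> R) (x : R) : R := u x ^+ 2 + u1 x ^+ 2.

Lemma energy_ge0 (R : realType) (u u1 : R -> R) (x : R) : 0 <= energy u u1 x.
Proof. by rewrite addr_ge0 ?sqr_ge0. Qed.

Lemma energy_derive (R : realType) (q : R) (u u1 : R -> R) (x : R) :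
  sturm q u u1 -> 0 < x -> is_derive x 1 (energy u u1) (2 * (q / x ^+ 2) * u x * u1 x).
Proof.
move=> [hu hu1 _] x0.
have h := deriveD_real (deriveM_real (hu x x0) (hu x x0)) (deriveM_real (hu1 x x0) (hu1 x x0)).
have -> : energy u u1 = (fun t => u t * u t + u1 t * u1 t).
  by apply/funext => t; rewrite /energy !expr2.
by apply: derive_conv h _; ring.
Qed.

(* energy * e^(c/x) is monotone for c = |q| and c = - |q|, so the energy is bounded
   away from 0 and oo, and nearly constant, at infinity. *)
Lemma energy_expR_derive (R : realType) (q c : R) (u u1 : R -> R) (x : R) :
  sturm q u u1 -> 0 < x ->
  is_derive x 1 (fun t => energy u u1 t * expR (c * t^-1))
    (expR (c * x^-1) / x ^+ 2 * (2 * q * u x * u1 x - c * energy u u1 x)).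
Proof.
move=> hs x0; have xn : x != 0 by rewrite gt_eqF.
have hV := @deriveV_real R id x 1 xn (is_derive_id _ _).
have h := deriveM_real (energy_derive hs x0) (derive_expR_real (deriveM_real (derive_cst_real c x) hV)).
apply: derive_conv h _; rewrite /id /=; field. exact: xn.
Qed.

Lemma cross_le (R : realType) (q a b : R) : `|2 * q * a * b| <= `|q| * (a ^+ 2 + b ^+ 2).
Proof.
rewrite -mulrA -mulrA mulrCA normrM ler_wpM2l//.
by rewrite ler_norml; apply/andP; split; have := sqr_ge0 (a - b); have := sqr_ge0 (a + b); rewrite !expr2; nra.
Qed.

Lemma energy_ub (R : realType) (q : R) (u u1 : R -> R) (x y : R) :
  sturm q u u1 -> 0 < x -> x <= y ->
  energy u u1 y * expR (`|q| * y^-1) <= energy u u1 x * expR (`|q| * x^-1).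
Proof.
move=> hs x0 xy.
have := @nondecr_derive R (fun t => - (energy u u1 t * expR (`|q| * t^-1))) _ x y xy
  (fun t ht => deriveN_real (@energy_expR_derive R q `|q| u u1 t hs (lt_le_trans x0 (proj1 (andP ht))))).
rewrite lerN2; apply=> t /andP[xt _]; have t0 := lt_le_trans x0 xt.
rewrite oppr_ge0 mulr_ge0_le0 ?divr_ge0 ?expR_ge0 ?sqr_ge0// subr_le0.
exact: le_trans (ler_norm _) (cross_le _ _ _).
Qed.

Lemma energy_lb (R : realType) (q : R) (u u1 : R -> R) (x y : R) :
  sturm q u u1 -> 0 < x -> x <= y ->
  energy u u1 x * expR (- `|q| * x^-1) <= energy u u1 y * expR (- `|q| * y^-1).
Proof.
move=> hs x0 xy.
apply: (@nondecr_derive R (fun t => (energy u u1 t * expR (- `|q| * t^-1))) _ x y xy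
  (fun t ht => (@energy_expR_derive R q (- `|q|) u u1 t hs (lt_le_trans x0 (proj1 (andP ht)))))).
move=> t /andP[xt _]; have t0 := lt_le_trans x0 xt.
rewrite mulr_ge0 ?divr_ge0 ?expR_ge0 ?sqr_ge0// mulNr opprK.
have := cross_le q (u t) (u1 t); rewrite ler_norml => /andP[h _].
by rewrite -lerBlDr sub0r.
Qed.

(** The last clause of [sturm] gives a point before x with positive energy, and [energy_lb] carries
    positivity forward to x. *)
Lemma energy_gt0 (R : realType) (q : R) (u u1 : R -> R) (x : R) :
  sturm q u u1 -> 0 < x -> 0 < energy u u1 x.
Proof.
move=> hs x0; have [_ _ /(_ x x0)[y [/andP[y0 yx] uy]]] := hs.
have := energy_lb hs y0 yx.
have hy : 0 < energy u u1 y by rewrite ltr_pwDl ?sqr_ge0// exprn_even_gt0.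
move=> h; have : 0 < energy u u1 x * expR (- `|q| / x).
  by apply: lt_le_trans h; rewrite mulr_gt0// expR_gt0.
by rewrite pmulr_lgt0// expR_gt0.
Qed.

(** Symmetric in x and y, with a factor that tends to 1 as [N] grows: the near constancy of the
    amplitude that [sturm_kernel] needs. *)
Lemma energy_ratio (R : realType) (q : R) (u u1 : R -> R) (N x y : R) :
  sturm q u u1 -> 0 < N -> N <= x -> N <= y ->
  energy u u1 x <= energy u u1 y * expR (`|q| / N).
Proof.
move=> hs N0 Nx Ny; have x0 := lt_le_trans N0 Nx; have y0 := lt_le_trans N0 Ny.
have q0 := normr_ge0 q.
have le_N z : 0 < z -> N <= z -> `|q| / z <= `|q| / N.
  by move=> z0 Nz; rewrite ler_wpM2l// lef_pV2.
have pos z : 0 < z -> 0 <= `|q| / z by move=> z0; rewrite divr_ge0// ltW.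
have [yx|xy] := leP y x.
  have := energy_ub hs y0 yx => h.
  apply: (@le_trans _ _ (energy u u1 x * expR (`|q| / x))).
    by rewrite -[leLHS]mulr1 ler_wpM2l ?energy_ge0// -expR0 ler_expR pos.
  by apply: (le_trans h); rewrite ler_wpM2l ?energy_ge0// ler_expR le_N.
have := energy_lb hs x0 (ltW xy) => h.
rewrite -ler_pdivrMr ?expR_gt0// -expRN.
apply: le_trans (_ : energy u u1 x * expR (- `|q| / x) <= _).
  by rewrite ler_wpM2l ?energy_ge0// ler_expR mulNr lerN2 le_N.
apply: (le_trans h); rewrite -[leRHS]mulr1 ler_wpM2l ?energy_ge0// -expR0 ler_expR mulNr.
by rewrite oppr_le0 pos.
Qed.

Lemma sturm_bound (R : realType) (q : R) (u u1 : R -> R) (N : R) :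
  sturm q u u1 -> 0 < N -> exists m M, [/\ 0 < m, 0 < M &
    forall x, N <= x -> [/\ m <= energy u u1 x, energy u u1 x <= M, `|u x| <= M, `|u1 x| <= M &
      `|(q / x ^+ 2 - 1) * u x| <= M]].
Proof.
move=> hs N0; pose E := energy u u1 N; pose c := expR (`|q| / N).
have E0 : 0 < E by exact: energy_gt0 hs N0.
have c0 : 0 < c by exact: expR_gt0.
(* [M0] bounds |u| and |u1| because |a| <= a^2 + 1; the additional factor of [M] bounds |q/x^2 -
   1|. *)
pose M0 := E * c + 1.
have M01 : 1 <= M0 by rewrite lerDr ltW// mulr_gt0.
pose M := (`|q| / N ^+ 2 + 1) * M0.
have k1 : 1 <= `|q| / N ^+ 2 + 1 by rewrite lerDr divr_ge0// sqr_ge0.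
have MM : M0 <= M by rewrite ler_peMl//; lra.
exists (E / c), M; split; [exact: divr_gt0|lra|].
move=> x Nx; have x0 := lt_le_trans N0 Nx.
have e1 : energy u u1 x <= E * c by exact: energy_ratio hs N0 Nx (lexx _).
have e2 : E <= energy u u1 x * c by exact: energy_ratio hs N0 (lexx _) Nx.
have sq (a b : R) : a ^+ 2 + b ^+ 2 <= E * c -> `|a| <= M0.
  move=> h; have := sqr_ge0 b; have := sqr_ge0 (`|a| - 1); rewrite -(real_normK (num_real a)) in h.
  rewrite /M0 !expr2 in h *; nra.
have ux : `|u x| <= M0 by exact: sq e1.
have u1x : `|u1 x| <= M0 by apply: (@sq _ (u x)); rewrite addrC.
split.
- by rewrite ler_pdivrMr.
- by apply: le_trans e1 _; apply: le_trans MM; rewrite lerDl.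
- exact: le_trans MM.
- exact: le_trans MM.
rewrite normrM; apply: ler_pM => //.
apply: le_trans (ler_normB _ _) _; rewrite normr1 lerD2r normrM ler_wpM2l//.
rewrite ger0_norm; last by rewrite invr_ge0 sqr_ge0.
by rewrite lef_pV2 ?posrE ?exprn_gt0// ler_pXn2r// nnegrE ltW.
Qed.

Lemma lipschitz_derive (R : realType) (f df : R -> R) (N M : R) :
  (forall x, N <= x -> is_derive x 1 f (df x)) -> (forall x, N <= x -> `|df x| <= M) ->
  forall x y, N <= x -> N <= y -> `|f x - f y| <= M * `|x - y|.
Proof.
move=> h hM x y; wlog xy : x y / x < y => [H|] Nx Ny.
  have [/eqP ->|] := boolP (x == y); first by rewrite !subrr normr0 mulr0.
  rewrite neq_lt => /orP[|] hxy; first exact: H.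
  by rewrite distrC (distrC x y); exact: H.
have [c /andP[xc cy] e] := @mean_value R f df x y xy (fun t ht => h t (le_trans Nx (proj1 (andP ht)))).
rewrite distrC e normrM (distrC x y) ler_wpM2r// hM//.
by apply: le_trans Nx _; exact: ltW.
Qed.

Lemma sturm_lipschitz (R : realType) (q : R) (u u1 : R -> R) (N : R) :
  sturm q u u1 -> 0 < N -> exists2 M, 0 < M &
    forall x y, N <= x -> N <= y -> `|u x - u y| <= M * `|x - y|.
Proof.
move=> hs N0; have [m [M [m0 M0 hM]]] := sturm_bound hs N0.
exists M => //; apply: (@lipschitz_derive _ _ u1).
  by case: hs => h _ _ x Nx; apply: h; exact: lt_le_trans Nx.
by move=> x /hM[].
Qed.

(** By Rolle u1 vanishes at some c between s and t, while |u1 s| >= sqrt m because u vanishes at s.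
    As u1 is M-Lipschitz, c - s is at least sqrt m / M. *)
Lemma sturm_separated (R : realType) (q : R) (u u1 : R -> R) (N : R) :
  sturm q u u1 -> 0 < N -> exists2 d, 0 < d &
    forall s t, N <= s -> s < t -> u s = 0 -> u t = 0 -> s + d <= t.
Proof.
move=> hs N0; have [m [M [m0 M0 hM]]] := sturm_bound hs N0.
have [hu hu1 _] := hs.
exists (Num.sqrt m / M); first by rewrite divr_gt0// sqrtr_gt0.
move=> s t Ns st us ut.
have pos x : N <= x -> 0 < x by exact: lt_le_trans.
have [c /andP[sc ct] e] := @mean_value R u u1 s t st (fun x hx => hu x (pos x (le_trans Ns (proj1 (andP hx))))).
have c0 : u1 c = 0.
  apply/eqP; move/eqP: e; rewrite us ut subrr eq_sym mulf_eq0 subr_eq0 => /orP[//|].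
  by rewrite gt_eqF.
have Nc : N <= c by apply: le_trans Ns (ltW sc).
have := @lipschitz_derive R u1 _ N M (fun x hx => hu1 x (pos x hx)) (fun x hx => let: And5 _ _ _ _ h := hM x hx in h) c s Nc Ns.
rewrite c0 sub0r normrN (gtr0_norm (x := c - s)) ?subr_gt0// => h.
have [ms _ _ _ _] := hM s Ns.
have : Num.sqrt m <= `|u1 s|.
  by rewrite -sqrtr_sqr ler_sqrt ?sqr_ge0//; move: ms; rewrite /energy us expr0n add0r.
move=> h2; rewrite -lerBrDl ler_pdivrMr// mulrC.
apply: (le_trans h2); apply: (le_trans h); rewrite ler_wpM2l ?(ltW M0)//.
by rewrite lerD2r ltW.
Qed.

(** The derivative of the Prüfer angle: with u = r sin phi, u1 = r cos phi and r^2 the energy, phi'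
    = (u1^2 - u u1') / r^2. *)
Definition phase_rate (R : realType) (q : R) (u u1 : R -> R) (x : R) : R :=
  1 - q / x ^+ 2 * (u x ^+ 2 / energy u u1 x).

Lemma phase_rate_bound (R : realType) (q : R) (u u1 : R -> R) (x : R) :
  sturm q u u1 -> 0 < x -> `|phase_rate q u u1 x - 1| <= `|q| / x ^+ 2.
Proof.
move=> hs x0; have E0 := energy_gt0 hs x0.
rewrite /phase_rate addrAC subrr add0r normrN normrM.
rewrite normrM (ger0_norm (x := (x ^+ 2)^-1)) ?invr_ge0 ?sqr_ge0//.
rewrite -[leRHS]mulr1 ler_wpM2l ?divr_ge0 ?sqr_ge0//.
rewrite ger0_norm; last by rewrite divr_ge0 ?sqr_ge0// ltW.
by rewrite ler_pdivrMr// mul1r lerDl sqr_ge0.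
Qed.

(** No branch of the angle has to be followed: phi is obtained by integrating [phase_rate] from a
    suitable initial value. With P = u cos phi - u1 sin phi, the quotient P^2 / energy is the
    squared sine of the discrepancy of the two angles; its derivative is 0 and it vanishes at [N].
    Stating only the squares leaves the sign of r aside. *)
Lemma sturm_phase (R : realType) (q : R) (u u1 : R -> R) (N : R) :
  sturm q u u1 -> 0 < N -> exists phi : R -> R,
   (forall x : R, N <= x -> is_derive x 1 phi (phase_rate q u u1 x)) /\
   (forall x : R, N <= x -> u x ^+ 2 = energy u u1 x * sin (phi x) ^+ 2).
Proof.
move=> hs N0; have [hu hu1 _] := hs.
pose psi := phase_rate q u u1.
have cpsi (x : R) : 0 < x -> {for x, continuous psi}.
  move=> x0; have xn : x != 0 by rewrite gt_eqF.
  have En : energy u u1 x != 0 by rewrite gt_eqF// (energy_gt0 hs).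
  have d2 := deriveM_real (@is_derive_id _ _ x (1:R)) (@is_derive_id _ _ x (1:R)).
  have xn2 : id x * id x != 0 by rewrite mulf_neq0.
  have hV := @deriveV_real R (fun t => id t * id t) x _ xn2 d2.
  have h1 := deriveM_real (deriveM_real (derive_cst_real q x) hV) (deriveM_real (deriveM_real (hu x x0) (hu x x0)) (deriveV_real En (energy_derive hs x0))).
  have := is_derive_continuous (deriveD_real (derive_cst_real 1 x) (deriveN_real h1)).
  by congr {for x, continuous _}; apply/funext => t; rewrite /psi /phase_rate !expr2.
(* The integral starts at N/2 so that [N] is an interior point for the fundamental theorem. *)
pose Phi (x : R) := \int[@lebesgue_measure R]_(t in `[N / 2, x]) psi t.
have N20 : 0 < N / 2 by rewrite divr_gt0.
have dPhi (x : R) : N <= x -> is_derive x 1 Phi (psi x).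
  move=> Nx; have x0 : 0 < x by exact: lt_le_trans Nx.
  have xx1 : x < x + 1 by rewrite ltrDl.
  have int : (@lebesgue_measure R).-integrable `[N / 2, x + 1] (EFin \o psi).
    apply: continuous_compact_integrable; first exact: segment_compact.
    apply: continuous_in_subspaceT => t; rewrite inE/= in_itv/= => /andP[t1 _].
    exact/cpsi/(lt_le_trans N20 t1).
  have N2x : N / 2 < x by lra.
  have [d e] := continuous_FTC1_closed xx1 int N2x (cpsi x x0).
  by split; [exact: d|rewrite -derive1E; exact: e].
have [th hth] : exists th, u N * cos th = u1 N * sin th.
  have [u10|u10] := eqVneq (u1 N) 0.
    by exists (pi / 2); rewrite cos_pihalf u10 mulr0 mul0r.
  exists (atan (u N / u1 N)).
  have c0 : cos (atan (u N / u1 N)) != 0.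
    by rewrite gt_eqF// cos_gt0_pihalf//; have [/andP[h1 h2] _] := atan_def (u N / u1 N); rewrite h1 h2.
  have := atanK (u N / u1 N); rewrite /tan => e.
  have -> : sin (atan (u N / u1 N)) = u N / u1 N * cos (atan (u N / u1 N)) by apply: (mulIf (invr_neq0 c0)); rewrite mulfK.
  by rewrite mulrA mulrCA divff// mulr1.
pose phi x := Phi x + (th - Phi N).
have dphi (x : R) : N <= x -> is_derive x 1 phi (psi x).
  move=> Nx; apply: derive_conv (deriveD_real (dPhi x Nx) (derive_cst_real (th - Phi N) x)) _.
  by rewrite addr0.
exists phi; split => // x Nx.
pose P t := u t * cos (phi t) - u1 t * sin (phi t).
have dP (t : R) : N <= t -> is_derive t 1 (fun t => P t * P t / energy u u1 t) 0.
  move=> Nt; have t0 := lt_le_trans N0 Nt.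
  have E0 : energy u u1 t != 0 by rewrite gt_eqF// (energy_gt0 hs).
  have dp := deriveD_real (deriveM_real (hu t t0) (derive_cos_real (dphi t Nt)))
    (deriveN_real (deriveM_real (hu1 t t0) (derive_sin_real (dphi t Nt)))).
  have h := deriveM_real (deriveM_real dp dp) (deriveV_real E0 (energy_derive hs t0)).
  apply: derive_conv h _.
  have xn : t != 0 by rewrite gt_eqF.
  rewrite /psi /phase_rate.
  move: E0; rewrite /energy => E0.
  by field; rewrite E0 xn.
have PN : P N = 0 by rewrite /P /phi addrCA subrr addr0 hth subrr.
have P0 : P x = 0.
  have [<-//|Nx'] := eqVneq N x.
  have {}Nx' : N < x by rewrite lt_neqAle Nx' Nx.
  have [c _ e] := @mean_value R _ (fun _ => 0) N x Nx' (fun t ht => dP t (proj1 (andP ht))).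
  have E0 : energy u u1 x != 0 by rewrite gt_eqF// (energy_gt0 hs)// (lt_le_trans N0).
  move/eqP: e; rewrite PN !mul0r subr0 !mulf_eq0 invr_eq0 (negbTE E0) orbF orbb.
  by move/eqP.
have e : u x * cos (phi x) = u1 x * sin (phi x) by apply/eqP; rewrite -subr_eq0 -/(P x) P0.
by rewrite /energy mulrDl -(exprMn _ (u1 x)) -e exprMn -mulrDr addrC cos2Dsin2 mulr1.
Qed.

(** * Partial fractions of 1/sin^2 *)

Lemma sin_le_id (R : realType) (y : R) : 0 <= y -> sin y <= y.
Proof.
move=> y0; rewrite -subr_ge0.
have := @nondecr_derive R (fun t => t + - sin t) _ 0 y y0
  (fun t _ => deriveD_real (@is_derive_id _ _ t (1:R)) (deriveN_real (is_derive_sin t))).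
rewrite sin0 subrr; apply=> t _; rewrite subr_ge0; exact: cos_le1.
Qed.

Lemma abs_sin_le (R : realType) (y : R) : `|sin y| <= `|y|.
Proof.
wlog y0 : y / 0 <= y => [H|].
  have [/H//|y0] := leP 0 y.
  by rewrite -normrN -sinN -[leRHS]normrN; apply: H; lra.
have [y1|y1] := leP y pi.
  by rewrite !ger0_norm ?sin_le_id// sin_ge0_pi// y0.
rewrite (ger0_norm y0); apply: (@le_trans _ _ 1).
  by rewrite ler_norml sin_geN1 sin_le1.
by apply: ltW; apply: lt_trans y1; have := pi_ge2 R; lra.
Qed.

(** From y cos y <= sin y, squared. Read as 1/sin^2 y <= 1/y^2 + 1, it bounds the error of each term
    in [csc_lb]. *)
Lemma sin_sqr_lb (R : realType) (y : R) : `|y| <= pi / 2 -> y ^+ 2 <= sin y ^+ 2 * (1 + y ^+ 2).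
Proof.
wlog y0 : y / 0 <= y => [H|].
  have [/H//|y0] := leP 0 y.
  by rewrite -normrN => /H; rewrite sinN !sqrrN; apply; lra.
rewrite ger0_norm// => yp.
have p0 := pi_gt0 R.
have h : y * cos y <= sin y.
  rewrite -subr_ge0.
  have := @nondecr_derive R (fun t => sin t + - (t * cos t)) _ 0 y y0
    (fun t _ => deriveD_real (is_derive_sin t) (deriveN_real (deriveM_real (@is_derive_id _ _ t (1:R)) (is_derive_cos t)))).
  rewrite sin0 mul0r subrr; apply=> t /andP[t0 ty].
  rewrite mul1r opprD addrA subrr add0r mulrN opprK /id mulr_ge0// sin_ge0_pi// t0/=; lra.
have c0 : 0 <= cos y by rewrite cos_ge0_pihalf//; apply/andP; split; lra.
have h2 : (y * cos y) ^+ 2 <= sin y ^+ 2.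
  by rewrite ler_sqr ?nnegrE// ?mulr_ge0//; apply: le_trans h; exact: mulr_ge0.
move: h2; rewrite exprMn cos2sin2; nra.
Qed.

Lemma sin2_shift_nat (R : realType) (x : R) (n : nat) : sin (x + n%:R * pi) ^+ 2 = sin x ^+ 2.
Proof.
elim: n => [|n IH]; first by rewrite mul0r addr0.
by rewrite -natr1 mulrDl mul1r addrA sinDpi sqrrN.
Qed.

Lemma sin2_shift (R : realType) (x : R) (m : int) : sin (x + m%:~R * pi) ^+ 2 = sin x ^+ 2.
Proof.
case: m => n; first exact: sin2_shift_nat.
rewrite -(sin2_shift_nat (x + _) n.+1); congr (sin _ ^+ 2).
by rewrite NegzE mulrNz mulNr -addrA addNr addr0.
Qed.

Lemma csc_double (R : realType) (x : R) : sin x != 0 ->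
  (sin x ^+ 2)^-1 = 4^-1 * ((sin (x / 2) ^+ 2)^-1 + (sin ((x + pi) / 2) ^+ 2)^-1).
Proof.
move=> sx; have e : sin x = 2 * (sin (x / 2) * cos (x / 2)).
  by rewrite {1}(splitr x) sinD; ring.
have -> : sin ((x + pi) / 2) = cos (x / 2).
  by rewrite mulrDl sinD cos_pihalf sin_pihalf mulr0 add0r mulr1.
move: sx; rewrite e !mulf_eq0 !negb_or => /andP[_ /andP[s0 c0]].
have := cos2Dsin2 (x / 2); set s := sin _ in s0 *; set c := cos _ in c0 * => sc.
have -> : (s ^+ 2)^-1 + (c ^+ 2)^-1 = (s ^+ 2 * c ^+ 2)^-1.
  rewrite -[RHS]mul1r -sc; field; by rewrite s0 c0.
by field; rewrite s0 c0.
Qed.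

Lemma sum_even_odd (R : realType) (F : nat -> R) (n : nat) :
  \sum_(0 <= k < 2 * n) F k = \sum_(0 <= k < n) (F (2 * k)%N + F (2 * k).+1).
Proof.
elim: n => [|n IH]; first by rewrite muln0 !big_geq.
by rewrite mulnS add2n !big_nat_recr//= IH addrA.
Qed.

(* Iterating the duplication formula [csc_double]; as n -> oo the summand tends to
   1/(x + k pi)^2, uniformly enough for [csc_ub] and [csc_lb]. *)
Lemma csc_sum (R : realType) (n : nat) (x : R) : sin x != 0 ->
  (sin x ^+ 2)^-1 = (4 ^+ n)^-1 * \sum_(0 <= k < 2 ^ n) (sin ((x + k%:R * pi) / 2 ^+ n) ^+ 2)^-1.
Proof.
elim: n x => [|n IH] x sx.
  by rewrite expn0 big_nat1 !expr0 mul0r addr0 divr1 invr1 mul1r.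
have e : sin x = 2 * (sin (x / 2) * cos (x / 2)).
  by rewrite {1}(splitr x) sinD; ring.
have e2 : sin ((x + pi) / 2) = cos (x / 2).
  by rewrite mulrDl sinD cos_pihalf sin_pihalf mulr0 add0r mulr1.
have : sin x != 0 := sx.
rewrite e !mulf_eq0 !negb_or => /andP[_ /andP[s0 c0]].
rewrite -e csc_double// (IH _ s0) IH ?e2//.
rewrite expnS sum_even_odd -mulrDr -big_split /= exprS invfM mulrA; congr (_ * _).
apply: eq_bigr => k _; congr ((sin _ ^+ 2)^-1 + (sin _ ^+ 2)^-1).
  by rewrite exprS natrM invfM; field; rewrite expf_neq0.
have -> : (2 * k).+1%:R = 2 * k%:R + 1 :> R by rewrite -natrM natr1.
by rewrite exprS invfM; field; rewrite expf_neq0.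
Qed.

Lemma sin_half_neq0 (R : realType) (n : nat) (w : R) : sin w != 0 -> sin (w / 2 ^+ n) != 0.
Proof.
elim: n w => [|n IH] w sw; first by rewrite expr0 divr1.
rewrite exprS invfM mulrA; apply: IH.
by move: sw; rewrite {1}(splitr w) sinD; apply: contra => /eqP ->; rewrite mul0r mulr0 addr0.
Qed.

Lemma sum_le_sub (R : realType) (I : eqType) (F : I -> R) (s s' : seq I) :
  (forall i, 0 <= F i) -> uniq s -> {subset s <= s'} -> \sum_(i <- s) F i <= \sum_(i <- s') F i.
Proof.
move=> F0; elim: s s' => [|x s IH] s' /=; first by move=> _ _; rewrite big_nil sumr_ge0.
move=> /andP[xs us] sub; have xs' : x \in s' by apply: sub; rewrite mem_head.
rewrite (perm_big _ (perm_to_rem xs')) !big_cons lerD2l; apply: IH => // y ys.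
have : y \in s' by apply: sub; rewrite inE ys orbT.
rewrite (perm_mem (perm_to_rem xs')) inE => /orP[/eqP yx|//].
by rewrite -yx ys in xs.
Qed.

(** Since |sin w| <= |w|, each term of [csc_sum] dominates the corresponding 1/(x' + k pi)^2.
    Shifting x by -B pi, with B a bound for the integers of [s], places all of them in the window 0
    <= k < 2^n through k = B - m. *)
Lemma csc_ub (R : realType) (x : R) (s : seq int) : uniq s -> sin x != 0 ->
  \sum_(m <- s) sin x ^+ 2 / (x - m%:~R * pi) ^+ 2 <= 1.
Proof.
move=> us sx; have s2 : 0 < sin x ^+ 2 by rewrite exprn_even_gt0.
rewrite -mulr_sumr -ler_pdivlMl// mulr1.
pose B := (\max_(m <- s) `|m|)%N.
have hB m : m \in s -> (`|m| <= B)%N by move=> ms; apply: leq_bigmax_seq.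
pose n := (2 * B)%N; have nB : (2 * B < 2 ^ n)%N by exact: ltn_expl.
pose x' := x + (- (B%:Z))%:~R * pi.
have sx' : sin x' ^+ 2 = sin x ^+ 2 by rewrite /x' sin2_shift.
have sx0 : sin x' != 0 by rewrite -sqrf_eq0 sx' gt_eqF.
rewrite -sx' (csc_sum n sx0).
pose F (k : nat) : R := ((x' + k%:R * pi) ^+ 2)^-1.
have F0 k : 0 <= F k by rewrite invr_ge0 sqr_ge0.
apply: (@le_trans _ _ (\sum_(0 <= k < 2 ^ n) F k)); last first.
  rewrite mulr_sumr; apply: ler_sum => k _; rewrite /F.
  set w := x' + _.
  have sw : sin w != 0 by rewrite -sqrf_eq0 sin2_shift_nat sx' gt_eqF.
  have swn := sin_half_neq0 n sw.
  have w0 : w != 0 by apply: contra sw => /eqP ->; rewrite sin0.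
  have e4 : 4 ^+ n = (2 ^+ n) ^+ 2 :> R by rewrite exprAC; congr (_ ^+ _); ring.
  have sn2 : 0 < sin (w / 2 ^+ n) ^+ 2 by rewrite exprn_even_gt0.
  have w2 : 0 < w ^+ 2 by rewrite exprn_even_gt0.
  have n2 : 0 < (2 ^+ n) ^+ 2 :> R by rewrite exprn_even_gt0//= expf_neq0.
  rewrite e4 -invfM lef_pV2; [|exact: w2|exact: mulr_gt0].
  have := abs_sin_le (w / 2 ^+ n); rewrite -ler_sqr ?nnegrE// !real_normK ?num_real// => h.
  apply: le_trans (ler_wpM2l (sqr_ge0 _) h) _.
  by rewrite -exprMn mulrCA divff ?mulr1// expf_neq0.
pose g (m : int) : nat := `|B%:Z - m|%N.
have gE m : m \in s -> (g m)%:Z = B%:Z - m.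
  by move=> /hB h; rewrite /g gez0_abs//; lia.
rewrite [leLHS](_ : _ = \sum_(k <- map g s) F k); last first.
  rewrite big_map big_seq [RHS]big_seq; apply: eq_bigr => m ms; rewrite /F.
  congr ((_ ^+ 2)^-1); rewrite -[(g m)%:R]/((g m)%:Z%:~R) gE// /x' rmorphB rmorphN /=; ring.
apply: sum_le_sub => //.
  rewrite map_inj_in_uniq// => a b /gE ha /gE hb ab.
  have e : (g a)%:Z = (g b)%:Z by rewrite ab.
  by move: e; rewrite ha hb; lia.
move=> _ /mapP[m ms ->]; rewrite mem_index_iota /=.
by have := gE m ms; have := hB m ms; lia.
Qed.

(** By [sin_sqr_lb] each of the 2^n terms of [csc_sum] exceeds 1/(x' + k pi)^2 by at most 4^-n, so
    the total error is 2^-n. This requires x' + k pi to stay within 2^n0 pi of 0, hence a window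
    with 2^n0 multiples of pi on either side, centred with the help of [m0]. *)
Lemma csc_lb (R : realType) (x e : R) : sin x != 0 -> 0 < e ->
  exists2 s : seq int, uniq s & 1 - e <= \sum_(m <- s) sin x ^+ 2 / (x - m%:~R * pi) ^+ 2.
Proof.
move=> sx e0; have p0 := pi_gt0 R.
have [n0 hn0] : exists n, e^-1 <= 2 ^+ n :> R.
  exists (Num.truncn e^-1).+1; apply: le_trans (ltW (truncnS_gt _)) _.
  by rewrite -natrX ler_nat ltnW// ltn_expl.
pose n := n0.+1.
pose m0 := Num.floor (x / pi).
have /andP[h1 h2] : m0%:~R * pi <= x < m0%:~R * pi + pi.
  rewrite -ler_pdivlMr// floor_le /=.
  rewrite -{2}[pi]mul1r -mulrDl -ltr_pdivrMr//.
  by have := floorD1_gt (x / pi); rewrite intrD.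
pose g (k : nat) : int := m0 + (2 ^ n0)%:Z - k%:Z.
exists (map g (iota 0 (2 ^ n))).
  by rewrite map_inj_uniq ?iota_uniq// => a b; rewrite /g => h; apply/eqP; rewrite -eqz_nat; apply/eqP; lia.
rewrite big_map.
pose x' := x + (- m0 - (2 ^ n0)%:Z)%:~R * pi.
have sx' : sin x' ^+ 2 = sin x ^+ 2 by rewrite /x' sin2_shift.
have s2 : 0 < sin x ^+ 2 by rewrite exprn_even_gt0.
have sx0 : sin x' != 0 by rewrite -sqrf_eq0 sx' gt_eqF.
have := csc_sum n sx0; rewrite sx' => e1.
have -> : \sum_(i <- iota 0 (2 ^ n)) sin x ^+ 2 / (x - (g i)%:~R * pi) ^+ 2 =
   \sum_(0 <= k < 2 ^ n) sin x ^+ 2 * ((x' + k%:R * pi) ^+ 2)^-1.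
  rewrite /index_iota subn0; apply: eq_bigr => k _; congr (_ / _ ^+ 2).
  by rewrite /x' /g !rmorphB rmorphD !rmorphN /=; ring.
rewrite -mulr_sumr.
have key : (sin x ^+ 2)^-1 <= \sum_(0 <= k < 2 ^ n) ((x' + k%:R * pi) ^+ 2)^-1 + e.
  have e4 : 4 ^+ n = (2 ^+ n) ^+ 2 :> R by rewrite exprAC; congr (_ ^+ _); ring.
  rewrite e1; apply: (@le_trans _ _ (\sum_(0 <= k < 2 ^ n) (((x' + k%:R * pi) ^+ 2)^-1 + (4 ^+ n)^-1))).
    rewrite mulr_sumr big_nat [leRHS]big_nat; apply: ler_sum => k /andP[_ kn].
    set w := x' + _.
    have sw : sin w != 0 by rewrite -sqrf_eq0 sin2_shift_nat sx' gt_eqF.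
    have swn := sin_half_neq0 n sw.
    have w0 : w != 0 by apply: contra sw => /eqP ->; rewrite sin0.
    have hw : `|w / 2 ^+ n| <= pi / 2.
      rewrite normrM (ger0_norm (x := _^-1)) ?invr_ge0 ?exprn_ge0//.
      rewrite ler_pdivrMr ?exprn_gt0// /n exprS mulrA divfK//.
      have kb : k%:R <= 2 * 2 ^+ n0 - 1 :> R.
        by rewrite lerBrDr natr1 -natrX -natrM ler_nat -expnS.
      have k0 : 0 <= k%:R :> R by [].
      have a2 : 0 <= k%:R * pi :> R by apply: mulr_ge0 => //; rewrite ltW.
      have a1 : k%:R * pi <= 2 * (2 ^+ n0 * pi) - pi :> R.
        apply: (@le_trans _ _ ((2 * 2 ^+ n0 - 1) * pi)); first by rewrite ler_wpM2r// ltW.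
        by rewrite le_eqVlt; apply/orP; left; apply/eqP; ring.
      have -> : w = x - m0%:~R * pi - 2 ^+ n0 * pi + k%:R * pi.
        by rewrite /w /x' rmorphB rmorphN /= -pmulrn natrX; ring.
      rewrite [pi * _]mulrC ler_norml; move: h1 h2 a1 a2.
      move: (m0%:~R * pi) (k%:R * pi) (2 ^+ n0 * pi) => a b c h1 h2 a1 a2.
      by apply/andP; split; lra.
    have := sin_sqr_lb hw => h.
    have sn2 : 0 < sin (w / 2 ^+ n) ^+ 2 by rewrite exprn_even_gt0.
    have w2 : 0 < w ^+ 2 by rewrite exprn_even_gt0.
    have n2 : 0 < (2 ^+ n) ^+ 2 :> R by rewrite exprn_even_gt0//= expf_neq0.
    rewrite e4 -invfM -(ler_pM2r (mulr_gt0 n2 sn2)) mulVf ?(gt_eqF (mulr_gt0 n2 sn2))//.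
    rewrite -(ler_pM2r w2) mul1r.
    move: h; rewrite expr_div_n ler_pdivrMr// => h; apply: (le_trans h).
    rewrite le_eqVlt; apply/orP; left; apply/eqP; field.
    by rewrite w0 expf_neq0.
  rewrite big_split /= lerD2l big_const_nat subn0 iter_addr addr0 -[X in X <= _]mulr_natl.
  rewrite e4 natrX expr2 invfM mulrA divff ?expf_neq0// mul1r.
  rewrite invf_ple ?posrE ?exprn_gt0//; apply: (le_trans hn0).
  by rewrite /n exprS ler_peMl ?exprn_ge0//; lra.
have s1 : sin x ^+ 2 <= 1 by have := cos2Dsin2 x; have := sqr_ge0 (cos x); lra.
move: key; rewrite -(ler_pM2l s2) divff ?gt_eqF// mulrDr => h.
rewrite lerBlDr; apply: (le_trans h); rewrite lerD2l.
by rewrite ler_piMl// ltW.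
Qed.

(** * Inverse squares over separated sequences *)

Definition gapped (R : realType) (d : R) (s : seq R) : Prop :=
  forall a b, a \in s -> b \in s -> a < b -> a + d <= b.

(** Telescoping: 1/h^2 <= 1/(h(h-d)) = (1/(h-d) - 1/h)/d, and the next point k satisfies k - d >=
    h. *)
Lemma sum_inv_sqr_path (R : realType) (d : R) (s : seq R) (h : R) : 0 < d -> d < h ->
  path (fun a b => a + d <= b) h s ->
  \sum_(t <- h :: s) (t ^+ 2)^-1 <= (d * (h - d))^-1.
Proof.
move=> d0; elim: s h => [|k s IH] h dh /=.
  have h0 : 0 < h by exact: lt_trans dh.
  move=> _; rewrite big_seq1 lef_pV2 ?posrE ?mulr_gt0 ?exprn_gt0 ?subr_gt0//.
  by rewrite expr2; nra.
move=> /andP[hk pk]; rewrite big_cons.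
have h0 : 0 < h by exact: lt_trans dh.
have dk : d < k by lra.
apply: (@le_trans _ _ ((h ^+ 2)^-1 + (d * h)^-1)).
  rewrite lerD2l; apply: le_trans (IH k dk pk) _.
  by rewrite lef_pV2 ?posrE ?mulr_gt0 ?subr_gt0// ler_pM2l//; lra.
have hd : 0 < h - d by rewrite subr_gt0.
rewrite -subr_ge0.
have -> : (d * (h - d))^-1 - ((h ^+ 2)^-1 + (d * h)^-1) = d / (h ^+ 2 * (h - d)).
  by field; rewrite !gt_eqF.
by rewrite divr_ge0 ?mulr_ge0 ?sqr_ge0// ltW.
Qed.

Lemma sum_inv_sqr_separated (R : realType) (d m : R) (s : seq R) :
  0 < d -> d < m -> uniq s -> gapped d s -> (forall t, t \in s -> m <= t) ->
  \sum_(t <- s) (t ^+ 2)^-1 <= (d * (m - d))^-1.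
Proof.
move=> d0 dm us ss ms.
have ps : perm_eq s (sort <=%R s) by rewrite perm_sym perm_sort.
rewrite (perm_big _ ps) /=.
have : sorted <%R (sort <=%R s) by rewrite lt_sorted_uniq_le sort_uniq us sort_le_sorted.
have : {subset sort <=%R s <= s} by move=> t; rewrite mem_sort.
case: (sort _ s) => [|h s'] sub so.
  by rewrite big_nil invr_ge0 mulr_ge0 ?subr_ge0 ?(ltW d0)// ltW.
have mh : m <= h by apply/ms/sub; rewrite mem_head.
apply: (@le_trans _ _ (d * (h - d))^-1); last first.
  by rewrite lef_pV2 ?posrE ?mulr_gt0 ?subr_gt0 ?(lt_le_trans dm)// ler_pM2l// lerD2r.
apply: sum_inv_sqr_path => //; first exact: lt_le_trans mh.
change (sorted (fun a b => a + d <= b) (h :: s')).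
apply: (@sub_in_sorted _ (mem (h :: s')) <%R) so; last exact/allP.
by move=> a b /sub ha /sub hb; exact: ss.
Qed.

Lemma separated_sum_far (R : realType) (d y M : R) (s : seq R) :
  0 < d -> d < M -> uniq s -> gapped d s -> (forall t, t \in s -> M <= `|y - t|) ->
  \sum_(t <- s) ((y - t) ^+ 2)^-1 <= 2 * (d * (M - d))^-1.
Proof.
move=> d0 dM us ss Ms; rewrite (bigID (fun t => y <= t)) /= mulr2n mulrDl mul1r.
apply: lerD.
  rewrite -big_filter.
  have -> : \sum_(i <- [seq i <- s | y <= i]) ((y - i) ^+ 2)^-1 =
     \sum_(i <- map (fun t => t - y) [seq i <- s | y <= i]) (i ^+ 2)^-1.
    by rewrite big_map; apply: eq_bigr => i _; rewrite -sqrrN opprB.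
  apply: sum_inv_sqr_separated => //.
  - by rewrite map_inj_uniq ?filter_uniq//; exact: addIr.
  - move=> _ _ /mapP[a + ->] /mapP[b + ->]; rewrite !mem_filter => /andP[_ ha] /andP[_ hb].
    by rewrite ltrD2r => /(ss _ _ ha hb); lra.
  - move=> _ /mapP[a + ->]; rewrite !mem_filter => /andP[ya /Ms].
    by rewrite ler0_norm ?subr_le0// opprB.
rewrite -big_filter.
have -> : \sum_(i <- [seq i <- s | ~~ (y <= i)]) ((y - i) ^+ 2)^-1 =
   \sum_(i <- map (fun t => y - t) [seq i <- s | ~~ (y <= i)]) (i ^+ 2)^-1.
  by rewrite big_map.
apply: sum_inv_sqr_separated => //.
- by rewrite map_inj_uniq ?filter_uniq// => a b /addrI /oppr_inj.
- move=> _ _ /mapP[a + ->] /mapP[b + ->]; rewrite !mem_filter => /andP[_ ha] /andP[_ hb].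
  by rewrite ltrD2l ltrN2 => /(ss _ _ hb ha); lra.
- move=> _ /mapP[a + ->]; rewrite !mem_filter -ltNge => /andP[ya /Ms].
  by rewrite gtr0_norm ?subr_gt0.
Qed.

(** Since 1 + z^2 >= (1 + z)^2 / 2, each side of y reduces to a separated family starting at 1,
    which exceeds [d]; the bound is therefore uniform in y. *)
Lemma separated_sum_all (R : realType) (d y : R) (s : seq R) :
  0 < d -> d < 1 -> uniq s -> gapped d s ->
  \sum_(t <- s) (1 + (y - t) ^+ 2)^-1 <= 4 * (d * (1 - d))^-1.
Proof.
move=> d0 d1 us ss.
have key (z : R) : 0 <= z -> (1 + z ^+ 2)^-1 <= 2 * ((1 + z) ^+ 2)^-1.
  move=> z0; have h1 : 0 < 1 + z ^+ 2 by rewrite ltr_pwDl// sqr_ge0.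
  have h2 : 0 < (1 + z) ^+ 2 by rewrite exprn_gt0// ltr_pwDl.
  rewrite ler_pdivlMr// mulrC ler_pdivrMr//; have := sqr_ge0 (1 - z).
  by rewrite !expr2; lra.
rewrite (bigID (fun t => y <= t)) /= (_ : 4 * (d * (1 - d))^-1 = 2 * (d * (1 - d))^-1 + 2 * (d * (1 - d))^-1); last by ring.
apply: lerD.
  apply: (@le_trans _ _ (\sum_(i <- s | y <= i) 2 * ((1 + (i - y)) ^+ 2)^-1)).
    by apply: ler_sum => i yi; rewrite -sqrrN opprB key// subr_ge0.
  rewrite -mulr_sumr ler_wpM2l// -big_filter.
  have -> : \sum_(i <- [seq i <- s | y <= i]) ((1 + (i - y)) ^+ 2)^-1 =
     \sum_(i <- map (fun t => 1 + (t - y)) [seq i <- s | y <= i]) (i ^+ 2)^-1.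
    by rewrite big_map.
  apply: sum_inv_sqr_separated => //.
  - by rewrite map_inj_uniq ?filter_uniq// => a b /addrI /addIr.
  - move=> _ _ /mapP[a + ->] /mapP[b + ->]; rewrite !mem_filter => /andP[_ ha] /andP[_ hb].
    by rewrite ltrD2l ltrD2r => /(ss _ _ ha hb); lra.
  - by move=> _ /mapP[a + ->]; rewrite !mem_filter => /andP[ya _]; rewrite lerDl subr_ge0.
apply: (@le_trans _ _ (\sum_(i <- s | ~~ (y <= i)) 2 * ((1 + (y - i)) ^+ 2)^-1)).
  by apply: ler_sum => i; rewrite -ltNge => yi; rewrite key// subr_ge0 ltW.
rewrite -mulr_sumr ler_wpM2l// -big_filter.
have -> : \sum_(i <- [seq i <- s | ~~ (y <= i)]) ((1 + (y - i)) ^+ 2)^-1 =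
   \sum_(i <- map (fun t => 1 + (y - t)) [seq i <- s | ~~ (y <= i)]) (i ^+ 2)^-1.
  by rewrite big_map.
apply: sum_inv_sqr_separated => //.
- by rewrite map_inj_uniq ?filter_uniq// => a b /addrI /addrI /oppr_inj.
- move=> _ _ /mapP[a + ->] /mapP[b + ->]; rewrite !mem_filter => /andP[_ ha] /andP[_ hb].
  by rewrite ltrD2l ltrD2l ltrN2 => /(ss _ _ hb ha); lra.
- by move=> _ /mapP[a + ->]; rewrite !mem_filter -ltNge => /andP[ya _]; rewrite lerDl subr_ge0 ltW.
Qed.

(** * Zeros of A_mu and the interpolation kernel *)

Definition liouville (R : realType) (mu x : R) : R := x `^ (mu + 2^-1) * rA mu x.
Definition liouville1 (R : realType) (mu x : R) : R :=
  x `^ (mu + 2^-1) * (rA1 mu x + (mu + 2^-1) / x * rA mu x).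

Lemma rA_near0 (R : realType) (mu : R) : -1 < mu ->
  exists2 d, 0 < d & forall x : R, `|x| < d -> 2^-1 < rA mu x.
Proof.
move=> mu1; have := is_derive_continuous (rA_derive (0 : R) mu1).
move=> /cvgrPdist_lt /(_ 2^-1 (ltac:(by rewrite invr_gt0))) /=.
move=> [d /= d0 hd]; exists d => // x xd.
have := hd x; rewrite /= sub0r normrN => /(_ xd).
by rewrite rA0// ltr_norml => /andP[_]; lra.
Qed.

Lemma powR_derive_at (R : realType) (a x : R) : 0 < x ->
  is_derive x 1 (fun t : R => t `^ a) (a / x * x `^ a).
Proof.
move=> x0; apply: derive_conv (is_derive_powR a x0) _.
rewrite powRB; last by rewrite (gt_eqF x0) implybT.
by rewrite powRr1 ?(ltW x0)//; ring.
Qed.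

Lemma liouville_sturm (R : realType) (mu : R) : -1 < mu ->
  sturm ((mu + 2^-1) * (mu - 2^-1)) (liouville mu) (liouville1 mu).
Proof.
move=> mu1; split => x x0.
- have xn : x != 0 by rewrite gt_eqF.
  apply: derive_conv (deriveM_real (powR_derive_at (mu + 2^-1) x0) (rA_derive x mu1)) _.
  by rewrite /liouville1; ring.
- have xn : x != 0 by rewrite gt_eqF.
  have hV := @deriveV_real R id x 1 xn (is_derive_id _ _).
  apply: derive_conv (deriveM_real (powR_derive_at (mu + 2^-1) x0)
    (deriveD_real (rA1_derive mu1 xn) (deriveM_real (deriveM_real (derive_cst_real (mu + 2^-1) x) hV) (rA_derive x mu1)))) _.
  by rewrite /liouville /id; field.
- have [d d0 hd] := rA_near0 mu1.
  have m0 : 0 < Num.min x (d / 2) by rewrite lt_min x0 divr_gt0.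
  exists (Num.min x (d / 2)); split; first by rewrite m0 ge_min lexx.
  rewrite /liouville mulf_neq0 ?gt_eqF ?powR_gt0//.
  apply: lt_trans (hd _ _); first by rewrite invr_gt0.
  by rewrite gtr0_norm// gt_min; apply/orP; right; lra.
Qed.

Definition amp (R : realType) (mu y : R) : R := `|y| `^ (2 * mu + 1) * rA mu y ^+ 2.
Definition amp1 (R : realType) (mu t : R) : R := `|t| `^ (2 * mu + 1) * rA1 mu t ^+ 2.

Lemma rA_norm (R : realType) (mu y : R) : rA mu `|y| = rA mu y.
Proof. by case: (ler0P y) => _ //; rewrite rA_even. Qed.
Lemma rA1_norm_sqr (R : realType) (mu y : R) : rA1 mu `|y| ^+ 2 = rA1 mu y ^+ 2.
Proof. by case: (ler0P y) => _ //; rewrite rA1_odd sqrrN. Qed.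

Lemma powR_half (R : realType) (mu x : R) : 0 < x -> (x `^ (mu + 2^-1)) ^+ 2 = x `^ (2 * mu + 1).
Proof.
move=> x0; rewrite expr2 -powRD ?(gt_eqF x0) ?implybT//.
by congr (_ `^ _); field.
Qed.

Lemma ampE (R : realType) (mu y : R) : y != 0 -> amp mu y = liouville mu `|y| ^+ 2.
Proof.
by move=> y0; rewrite /amp /liouville exprMn powR_half ?normr_gt0// rA_norm.
Qed.

(** At a zero of A_mu only the term with A_mu' survives in the energy, so the denominator of the
    kernel inherits the lower bound of [sturm_bound]. *)
Lemma amp1E (R : realType) (mu t : R) : t != 0 -> rA mu t = 0 ->
  amp1 mu t = energy (liouville mu) (liouville1 mu) `|t|.
Proof.
move=> t0 rt; rewrite /amp1 /energy /liouville /liouville1 rA_norm rt !mulr0 expr0n add0r addr0.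
by rewrite exprMn powR_half ?normr_gt0// rA1_norm_sqr.
Qed.

Lemma amp_ge0 (R : realType) (mu y : R) : 0 <= amp mu y.
Proof. by rewrite mulr_ge0 ?powR_ge0 ?sqr_ge0. Qed.

Lemma zeros_facts (R : realType) (mu : R) : -1 < mu -> exists r d c : R,
  [/\ 0 < r, 0 < d < 2^-1 & 0 < c] /\
  [/\ forall t, rA mu t = 0 -> r <= `|t|,
      forall s t, rA mu s = 0 -> rA mu t = 0 -> s < t -> s + d <= t &
      forall t, rA mu t = 0 -> c <= amp1 mu t].
Proof.
move=> mu1; have [r r0 hr] := rA_near0 mu1.
have hs := liouville_sturm mu1.
have [d0 d00 hd] := sturm_separated hs r0.
have [m [M [m0 M0 hM]]] := sturm_bound hs r0.
have zr t : rA mu t = 0 -> r <= `|t|.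
  by move=> rt; rewrite leNgt; apply/negP => /hr; rewrite rt; lra.
have tn0 t : rA mu t = 0 -> t != 0.
  by move=> /zr h; rewrite -normr_gt0; exact: lt_le_trans h.
(* [d0] separates zeros of equal sign, [r] those of opposite sign, and 1/3 keeps [d] below 1/2, as
   sums starting at distance 1 require. *)
pose d := Num.min d0 (Num.min r 3^-1).
have [dd0 dr d3] : [/\ d <= d0, d <= r & d <= 3^-1].
  by rewrite /d !ge_min !lexx !orbT.
have dpos : 0 < d by rewrite /d !lt_min d00 r0 invr_gt0/=.
exists r, d, m; split; first by split => //; rewrite dpos /=; apply: le_lt_trans d3 _; lra.
split => //; last first.
  by move=> t rt; rewrite amp1E ?tn0//; have [] := hM _ (zr _ rt).
move=> s t rs rt st.
have lz z : rA mu z = 0 -> liouville mu z = 0 by move=> h; rewrite /liouville h mulr0.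
have zrs := zr _ rs; have zrt := zr _ rt.
have [s0|s0] := leP 0 s.
  have t0 : 0 <= t by lra.
  rewrite !ger0_norm// in zrs zrt.
  by have := hd s t zrs st (lz _ rs) (lz _ rt); lra.
have [t0|t0] := leP 0 t.
  by rewrite ltr0_norm// in zrs; rewrite ger0_norm// in zrt; lra.
rewrite !ltr0_norm// in zrs zrt.
have ts : - t < - s by rewrite ltrN2.
by have := hd (- t) (- s) zrt ts (lz _ (etrans (rA_even _ _) rt)) (lz _ (etrans (rA_even _ _) rs)); lra.
Qed.

(** At [y = t] division by zero gives 0; points y that are zeros of [rA mu] are kept out of the
    estimates and handled by [interp_sum_node]. *)
Definition kern (R : realType) (mu y t : R) : R := amp mu y / (amp1 mu t * (y - t) ^+ 2).

Lemma amp1_ge0 (R : realType) (mu t : R) : 0 <= amp1 mu t.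
Proof. by rewrite mulr_ge0 ?powR_ge0 ?sqr_ge0. Qed.

Lemma kern_ge0 (R : realType) (mu y t : R) : 0 <= kern mu y t.
Proof. by rewrite divr_ge0 ?amp_ge0// mulr_ge0 ?sqr_ge0 ?amp1_ge0. Qed.

Lemma rA_growth (R : realType) (mu : R) : -1 < mu ->
  exists2 K, 0 <= K & forall y : R, `|rA mu y| <= K * expR (2 * `|y|).
Proof.
move=> mu1; have [K K0 hK] := bA_growth mu1 (ltac:(lra) : (1 : R) < 2).
by exists K => // y; have := hK (toC y); rewrite bA_real// !cabs_toC.
Qed.

(** Energy bounds apply only away from the origin; for |y| < 1 the hypothesis on [mu] enters, making
    |y|^(2mu+1) at most 1. *)
Lemma amp_bound (R : realType) (mu : R) : - 2^-1 < mu ->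
  exists2 K, 0 < K & forall y, amp mu y <= K.
Proof.
move=> mu2; have mu1 : -1 < mu by lra.
have [m [M [m0 M0 hM]]] := sturm_bound (liouville_sturm mu1) ltr01.
have [K K0 hK] := rA_growth mu1.
exists (M + (K * expR 2) ^+ 2); first by rewrite ltr_pwDl// sqr_ge0.
move=> y; have [y1|y1] := leP 1 `|y|.
  have y0 : y != 0 by rewrite -normr_gt0; exact: lt_le_trans y1.
  rewrite ampE//; have [_ h _ _ _] := hM _ y1.
  apply: (@le_trans _ _ M); last by rewrite lerDl sqr_ge0.
  by apply: le_trans h; rewrite /energy lerDl sqr_ge0.
apply: (@le_trans _ _ ((K * expR 2) ^+ 2)); last by rewrite lerDr ltW.
rewrite /amp -[leRHS]mul1r ler_pM ?powR_ge0 ?sqr_ge0//.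
  have [->|y0] := eqVneq y 0; first by rewrite normr0 powR0// gt_eqF//; lra.
  by rewrite -[leRHS](powRr0 `|y|); apply: ger_powR; [rewrite normr_gt0 y0 ltW|lra].
rewrite -real_normK ?num_real// ler_sqr ?nnegrE ?mulr_ge0 ?expR_ge0//.
apply: le_trans (hK y) _; rewrite ler_wpM2l// ler_expR; lra.
Qed.

(** Off the origin amp is u(|y|)^2 with u Lipschitz and u(|t|) = 0. As u may fail to be Lipschitz at
    0, the range |y| < r/2 is treated apart: there |y - t| >= r/2 and a bound on amp is enough. *)
Lemma amp_near_zero (R : realType) (mu : R) : - 2^-1 < mu ->
  exists2 K, 0 < K & forall y t, rA mu t = 0 -> amp mu y <= K * (y - t) ^+ 2.
Proof.
move=> mu2; have mu1 : -1 < mu by lra.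
have [r [d [c [[r0 _ _] [hr _ _]]]]] := zeros_facts mu1.
have r20 : 0 < r / 2 by rewrite divr_gt0.
have [M M0 hM] := sturm_lipschitz (liouville_sturm mu1) r20.
have [K K0 hK] := amp_bound mu2.
exists (M ^+ 2 + K / (r / 2) ^+ 2); first by rewrite ltr_pwDl ?exprn_gt0// divr_ge0 ?sqr_ge0 ?ltW.
move=> y t rt; have rt' := hr _ rt.
have h2 : 0 <= (y - t) ^+ 2 := sqr_ge0 _.
have [yr|yr] := leP (r / 2) `|y|.
  have y0 : y != 0 by rewrite -normr_gt0; exact: lt_le_trans yr.
  have := hM `|y| `|t| yr (ltac:(lra)).
  have -> : liouville mu `|t| = 0 by rewrite /liouville rA_norm rt mulr0.
  rewrite subr0 => h; rewrite ampE//.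
  apply: (@le_trans _ _ (M ^+ 2 * (y - t) ^+ 2)); last first.
    by rewrite ler_wpM2r// lerDl divr_ge0 ?sqr_ge0 ?ltW.
  rewrite -exprMn -real_normK ?num_real// -[leRHS]real_normK ?num_real//.
  rewrite ler_sqr ?nnegrE// (normrM M) (gtr0_norm M0); apply: (le_trans h).
  by rewrite ler_wpM2l ?(ltW M0)//; exact: ler_dist_dist.
apply: (@le_trans _ _ (K / (r / 2) ^+ 2 * (y - t) ^+ 2)); last first.
  by rewrite ler_wpM2r// lerDr sqr_ge0.
apply: le_trans (hK y) _; rewrite mulrAC ler_pdivlMr ?exprn_gt0// ler_wpM2l ?(ltW K0)//.
rewrite -[leRHS]real_normK ?num_real// ler_sqr ?nnegrE ?(ltW r20)//.
have := lerB_dist t y; rewrite (distrC t y); lra.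
Qed.

(** The bounds amp <= K and amp <= L (y-t)^2 add up to amp (1 + (y-t)^2) <= (K+L) (y-t)^2, which
    removes the singularity at y = t. *)
Lemma kern_bound (R : realType) (mu : R) : - 2^-1 < mu ->
  exists2 K, 0 < K & forall y t, rA mu t = 0 -> y != t -> kern mu y t <= K * (1 + (y - t) ^+ 2)^-1.
Proof.
move=> mu2; have mu1 : -1 < mu by lra.
have [r [d [c [[r0 _ c0] [_ _ hc]]]]] := zeros_facts mu1.
have [K K0 hK] := amp_bound mu2; have [L L0 hL] := amp_near_zero mu2.
exists ((K + L) / c); first by rewrite divr_gt0// addr_gt0.
move=> y t rt yt; have c1 := hc _ rt.
have a0 : 0 < amp1 mu t by exact: lt_le_trans c1.
have z0 : 0 < (y - t) ^+ 2 by rewrite exprn_even_gt0//= subr_eq0.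
have z1 : 0 < 1 + (y - t) ^+ 2 by lra.
rewrite /kern ler_pdivrMr; last exact: mulr_gt0.
rewrite -mulrA mulrAC; rewrite [leRHS](_ : _ = (K + L) * (amp1 mu t / c) * ((y - t) ^+ 2 / (1 + (y - t) ^+ 2))); last by ring.
apply: (@le_trans _ _ ((K + L) * ((y - t) ^+ 2 / (1 + (y - t) ^+ 2)))); last first.
  rewrite ler_wpM2r ?divr_ge0 ?(ltW z0) ?(ltW z1)// ler_peMr ?addr_ge0 ?(ltW K0) ?(ltW L0)//.
  by rewrite ler_pdivlMr// mul1r.
rewrite mulrA ler_pdivlMr// mulrDr mulr1 mulrDl [leRHS]addrC lerD ?hL//.
by rewrite ler_wpM2r ?hK// ltW.
Qed.

(** Items (i) and (ii) of the overview: [kern_bound] summed over separated zeros. The constant found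
    for (i) also serves for (ii), because M >= 1 > 2d. *)
Lemma kern_sums (R : realType) (mu : R) : - 2^-1 < mu -> exists2 K, 0 < K &
  (forall y (s : seq R), uniq s -> (forall t, t \in s -> rA mu t = 0 /\ y != t) ->
     \sum_(t <- s) kern mu y t <= K) /\
  (forall y M (s : seq R), uniq s -> (forall t, t \in s -> rA mu t = 0 /\ y != t) -> 1 <= M ->
     (forall t, t \in s -> M <= `|y - t|) -> \sum_(t <- s) kern mu y t <= K / M).
Proof.
move=> mu2; have mu1 : -1 < mu by lra.
have [r [d [c [[r0 /andP[d0 d1] c0] [_ hsep _]]]]] := zeros_facts mu1.
have [K K0 hK] := kern_bound mu2.
have d10 : 0 < d * (1 - d) by rewrite mulr_gt0//; lra.
exists (K * (4 * (d * (1 - d))^-1)); first by rewrite !mulr_gt0// invr_gt0.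
have sp y (s : seq R) : (forall t, t \in s -> rA mu t = 0 /\ y != t) -> gapped d s.
  by move=> h a b /h[ra _] /h[rb _]; exact: hsep.
split=> [y s us hz|y M s us hz M1 hM].
  apply: (@le_trans _ _ (\sum_(t <- s) K * (1 + (y - t) ^+ 2)^-1)).
    by rewrite big_seq [leRHS]big_seq; apply: ler_sum => t /hz[rt yt]; exact: hK.
  rewrite -mulr_sumr ler_wpM2l ?(ltW K0)//; apply: separated_sum_all => //; first lra.
  exact: sp hz.
apply: (@le_trans _ _ (\sum_(t <- s) K * ((y - t) ^+ 2)^-1)).
  rewrite big_seq [leRHS]big_seq; apply: ler_sum => t /hz[rt yt]; apply: le_trans (hK _ _ rt yt) _.
  have z0 : 0 < (y - t) ^+ 2 by rewrite exprn_even_gt0//= subr_eq0.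
  by rewrite ler_wpM2l ?(ltW K0)// lef_pV2 ?posrE//; lra.
rewrite -mulr_sumr -mulrA ler_wpM2l ?(ltW K0)//.
have dM : d < M by lra.
apply: le_trans (separated_sum_far d0 dM us (sp _ _ hz) hM) _.
have dM0 : 0 < M - d by rewrite subr_gt0.
have M0 : 0 < M by lra.
rewrite -mulrA -invfM -subr_ge0.
have -> : 4 * (d * (1 - d) * M)^-1 - 2 * (d * (M - d))^-1 = 2 * (2 * (M - d) - (1 - d) * M) / (d * (1 - d) * M * (M - d)).
  by field; rewrite !gt_eqF//; lra.
apply: divr_ge0; first nra.
by apply: mulr_ge0; [|exact: ltW]; apply: mulr_ge0; [exact: ltW|exact: ltW].
Qed.

(** * The kernel sums are close to 1 far from the origin *)

Lemma sin_eq0_int (R : realType) (x : R) : sin x = 0 -> exists m : int, x = m%:~R * pi.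
Proof.
move=> sx; have p0 := pi_gt0 R; pose m := Num.floor (x / pi); exists m.
have h1 : m%:~R * pi <= x by rewrite -ler_pdivlMr// floor_le.
have h2 : x < m%:~R * pi + pi.
  rewrite -{2}[pi]mul1r -mulrDl -ltr_pdivrMr//.
  by have := floorD1_gt (x / pi); rewrite intrD.
have h3 : sin (x - m%:~R * pi) = 0.
  apply/eqP; rewrite -sqrf_eq0.
  have := sin2_shift x (- m); rewrite rmorphN mulNr => ->.
  by rewrite sx expr0n.
apply/eqP; apply: contraT => ne.
have h4 : 0 < x - m%:~R * pi by rewrite subr_gt0 lt_neqAle eq_sym ne h1.
have h5 : 0 < x - m%:~R * pi < pi by rewrite h4 /=; lra.
by have := sin_gt0_pi h5; rewrite h3 ltxx.
Qed.

(** Beyond N >= |q|/h the phase rate is within h of 1 and the energy varies by a factor of at most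
    exp(h) <= 1/(1-h). Comparing with sin^2(phi y) / (phi y - phi t)^2 thus costs (1+h)^2/(1-h), at
    most 1 + 7h for h <= 1/2, from above, and (1-h)^3 from below. The constant 5 comes from (1-h)^3
    (1-2h) >= 1 - 5h, one h being lost in [csc_lb] and one on the multiples of pi below phi N. *)
Lemma sturm_kernel (R : realType) (q : R) (u u1 : R -> R) (h : R) :
  sturm q u u1 -> 0 < h -> h <= 2^-1 -> exists N : R, [/\ 1 <= N,
   (forall y (s : seq R), N <= y -> u y != 0 -> uniq s ->
      (forall t, t \in s -> N <= t /\ u t = 0) ->
      \sum_(t <- s) u y ^+ 2 / (energy u u1 t * (y - t) ^+ 2) <= 1 + 7 * h) &
   exists2 Y, N <= Y & forall y, Y <= y -> u y != 0 -> exists s : seq R, [/\ uniq s,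
      (forall t, t \in s -> N <= t /\ u t = 0) &
      1 - 5 * h <= \sum_(t <- s) u y ^+ 2 / (energy u u1 t * (y - t) ^+ 2)]].
Proof.
move=> hs h0 h1; pose N := Num.max 1 (`|q| / h).
have N1 : 1 <= N by rewrite le_max lexx.
have N0 : 0 < N by exact: lt_le_trans N1.
have qN : `|q| / N <= h.
  by rewrite ler_pdivrMr// mulrC -ler_pdivrMr// le_max lexx orbT.
have [phi [dphi sphi]] := sturm_phase hs N0.
have pos t : N <= t -> 0 < t by exact: lt_le_trans.
have Epos t : N <= t -> 0 < energy u u1 t by move=> /pos; exact: energy_gt0 hs.
have rate t : N <= t -> 1 - h <= phase_rate q u u1 t <= 1 + h.
  move=> Nt; have := phase_rate_bound hs (pos t Nt); rewrite ler_distl.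
  have : `|q| / t ^+ 2 <= h.
    apply: le_trans qN; rewrite ler_wpM2l// lef_pV2 ?posrE ?exprn_gt0 ?pos//.
    by apply: (le_trans Nt); rewrite expr2 ler_peMl ?(ltW (pos t Nt))//; exact: le_trans Nt.
  by move=> a /andP[b c]; apply/andP; split; lra.
have mono a b : N <= a -> a <= b -> (1 - h) * (b - a) <= phi b - phi a /\ phi b - phi a <= (1 + h) * (b - a).
  move=> Na; rewrite le_eqVlt => /predU1P[->|ab]; first by rewrite !subrr !mulr0.
  have [c /andP[ac cb] ->] := @mean_value R phi _ a b ab (fun x hx => dphi x (le_trans Na (proj1 (andP hx)))).
  have /andP[r1 r2] := rate c (le_trans Na (ltW ac)).
  have ba : 0 <= b - a by rewrite subr_ge0 ltW.
  by split; rewrite ler_wpM2r.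
have sqd a b : N <= a -> N <= b ->
    ((1 - h) ^+ 2 * (a - b) ^+ 2 <= (phi a - phi b) ^+ 2) /\ ((phi a - phi b) ^+ 2 <= (1 + h) ^+ 2 * (a - b) ^+ 2).
  wlog ab : a b / a <= b => [H|] Na Nb.
    have [ab|ba] := leP a b; first exact: H.
    by rewrite -(opprB b a) -(opprB (phi b)) !sqrrN; apply: H => //; exact: ltW.
  have [m1 m2] := mono a b Na ab.
  have ba : 0 <= b - a by rewrite subr_ge0.
  have z1 : 0 <= (1 - h) * (b - a) by rewrite mulr_ge0//; lra.
  rewrite -(opprB b a) -(opprB (phi b)) !sqrrN -!exprMn.
  by split; rewrite ler_sqr ?nnegrE//; lra.
have pinj a b : N <= a -> N <= b -> phi a = phi b -> a = b.
  move=> Na Nb ab; have [+ _] := sqd a b Na Nb; rewrite ab subrr expr0n /=.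
  rewrite pmulr_rle0 ?exprn_gt0//; last lra.
  by move=> z; apply/eqP; rewrite -subr_eq0 -sqrf_eq0 eq_le z sqr_ge0.
have eh : expR h * (1 - h) <= 1.
  have := expR_ge1Dx (- h) => z; apply: (@le_trans _ _ (expR h * expR (- h))).
    by rewrite ler_wpM2l ?expR_ge0.
  by rewrite -expRD subrr expR0.
have ratio y t : N <= y -> N <= t -> (1 - h) * energy u u1 y <= energy u u1 t.
  move=> Ny Nt; have := energy_ratio hs N0 Ny Nt => z.
  apply: (@le_trans _ _ ((1 - h) * (energy u u1 t * expR h))).
    rewrite ler_wpM2l//; first lra.
    apply: (le_trans z); rewrite ler_wpM2l ?energy_ge0//.
    by rewrite ler_expR.
  by rewrite mulrC -mulrA -[leRHS]mulr1 ler_wpM2l ?energy_ge0.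
pose K y t := u y ^+ 2 / (energy u u1 t * (y - t) ^+ 2).
pose S y t := sin (phi y) ^+ 2 / (phi y - phi t) ^+ 2.
have KS y t : N <= y -> N <= t -> y != t ->
    (K y t <= (1 + 7 * h) * S y t) /\ ((1 - h) ^+ 3 * S y t <= K y t).
  move=> Ny Nt yt; have [d1 d2] := sqd y t Ny Nt.
  have z0 : 0 < (y - t) ^+ 2 by rewrite exprn_even_gt0//= subr_eq0.
  have D0 : 0 < (phi y - phi t) ^+ 2.
    rewrite exprn_even_gt0//= subr_eq0; apply: contra yt => /eqP /pinj e.
    by apply/eqP/e.
  have e1 := ratio y t Ny Nt; have e2 := ratio t y Nt Ny.
  have Ey := Epos y Ny; have Et := Epos t Nt.
  rewrite /K /S sphi//; set sn := sin _ ^+ 2; have sn0 : 0 <= sn by exact: sqr_ge0.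
  have h1h : 0 < 1 - h by lra.
  split.
    rewrite ler_pdivrMr ?(mulr_gt0 Et z0)//.
    rewrite mulrC [leRHS](_ : _ = sn * ((1 + 7 * h) * energy u u1 t * (y - t) ^+ 2 / (phi y - phi t) ^+ 2)); last by ring.
    rewrite ler_wpM2l// ler_pdivlMr//.
    apply: (@le_trans _ _ (energy u u1 y * ((1 + h) ^+ 2 * (y - t) ^+ 2))).
      by rewrite ler_wpM2l ?(ltW Ey).
    rewrite mulrA ler_wpM2r ?(ltW z0)//.
    rewrite -(ler_pM2l h1h).
    apply: (@le_trans _ _ (energy u u1 t * (1 + h) ^+ 2)).
      by rewrite mulrA ler_wpM2r ?sqr_ge0.
    rewrite [leRHS](_ : _ = energy u u1 t * ((1 - h) * (1 + 7 * h))); last by ring.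
    rewrite ler_wpM2l ?(ltW Et)// expr2; nra.
  rewrite ler_pdivlMr ?(mulr_gt0 Et z0)//.
  rewrite [leLHS](_ : _ = sn * ((1 - h) ^+ 3 * energy u u1 t * (y - t) ^+ 2 / (phi y - phi t) ^+ 2)); last by ring.
  rewrite [leRHS]mulrC ler_wpM2l// ler_pdivrMr//.
  apply: (@le_trans _ _ (energy u u1 y * ((1 - h) ^+ 2 * (y - t) ^+ 2))); last first.
    by rewrite ler_wpM2l ?(ltW Ey).
  rewrite [leLHS](_ : _ = (1 - h) * energy u u1 t * ((1 - h) ^+ 2 * (y - t) ^+ 2)); last by ring.
  by apply: ler_wpM2r => //; rewrite mulr_ge0 ?sqr_ge0.
have snz y : N <= y -> u y != 0 -> sin (phi y) != 0.
  move=> Ny; apply: contra => /eqP sy; have := sphi y Ny; rewrite sy expr0n mulr0 => /eqP.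
  by rewrite sqrf_eq0.
have zsn t : N <= t -> u t = 0 -> exists m : int, phi t = m%:~R * pi.
  move=> Nt ut; apply: sin_eq0_int; apply/eqP; rewrite -sqrf_eq0.
  have /eqP := sphi t Nt; rewrite ut expr0n eq_sym mulf_eq0 => /orP[|//].
  by rewrite gt_eqF ?Epos.
exists N; split => //.
  (* Upper bound: phi is injective beyond [N], so distinct zeros give distinct multiples of pi and
     [csc_ub] applies. *)
  move=> y s Ny uy us hsz.
  have [m hm] : {m : R -> int & forall t, N <= t /\ u t = 0 -> phi t = (m t)%:~R * pi}.
    apply: (@choice _ _ (fun t m => N <= t /\ u t = 0 -> phi t = m%:~R * pi)) => t.
    have [[Nt ut]|nt] := pselect (N <= t /\ u t = 0); last by exists 0.
    by have [k hk] := zsn t Nt ut; exists k.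
  have yt t : t \in s -> y != t by move=> /hsz[_ ut]; apply: contra uy => /eqP ->; rewrite ut.
  apply: (@le_trans _ _ (\sum_(t <- s) (1 + 7 * h) * S y t)).
    rewrite big_seq [leRHS]big_seq; apply: ler_sum => t ts.
    have [Nt ut] := hsz t ts; by have [] := KS y t Ny Nt (yt t ts).
  rewrite -mulr_sumr -[leRHS]mulr1 ler_wpM2l//; first lra.
  have -> : \sum_(t <- s) S y t = \sum_(k <- map m s) sin (phi y) ^+ 2 / (phi y - k%:~R * pi) ^+ 2.
    rewrite big_map big_seq [RHS]big_seq; apply: eq_bigr => t ts.
    by rewrite /S (hm t (hsz t ts)).
  apply: csc_ub; last exact: snz.
  rewrite map_inj_in_uniq// => a b sa sb ab.
  have [Na _] := hsz a sa; have [Nb _] := hsz b sb.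
  by apply: pinj => //; rewrite (hm a (hsz a sa)) (hm b (hsz b sb)) ab.
(* As phi' >= 1/2, this ensures phi y - phi N >= 1 + 2/h. The multiples of pi below phi N, which
   need not come from zeros beyond [N], then contribute at most 2/(2/h) = h. *)
pose Y := N + 2 * (1 + 2 / h).
have hi0 : 0 < 2 / h by rewrite divr_gt0.
exists Y; first by rewrite /Y; lra.
move=> y Yy uy; have Ny : N <= y by rewrite /Y in Yy; lra.
have sy := snz y Ny uy.
have [s us hsum] := csc_lb sy h0.
(* Every multiple of pi above phi N is attained, by the intermediate value theorem: the slope of phi
   is at least 1/2, so twice the gap suffices as interval length. The point [tt m] where it is
   attained is a zero of u. *)
pose P (m : int) := phi N <= m%:~R * pi.
have [tt htt] : {tt : int -> R & forall m, P m -> N <= tt m /\ phi (tt m) = m%:~R * pi}.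
  apply: (@choice _ _ (fun m t => P m -> N <= t /\ phi t = m%:~R * pi)) => m.
  have [Pm|nP] := boolP (P m); last by exists 0.
  pose b := N + 2 * (m%:~R * pi - phi N).
  have Nb : N <= b by rewrite /b lerDl mulr_ge0// subr_ge0.
  have [mb _] := mono N b (lexx _) Nb.
  have hb : m%:~R * pi <= phi b.
    have : 0 <= m%:~R * pi - phi N by rewrite subr_ge0.
    by move: mb; rewrite /b; nra.
  have cphi : {within `[N, b], continuous phi}.
    apply: derivable_within_continuous => x; rewrite in_itv/= => /andP[Nx _].
    by have [] := dphi x Nx.
  have [|c cNb hc] := @IVT R phi N b (m%:~R * pi) Nb cphi.
    by rewrite ge_min le_max hb; apply/andP; split => //; rewrite ?orbT//; apply/orP; left.
  by exists c => _; split => //; move: cNb; rewrite in_itv/= => /andP[].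
have utt m : P m -> u (tt m) = 0.
  move=> /htt[Nt ht]; apply/eqP; rewrite -sqrf_eq0 sphi// ht.
  by have := sin2_shift (0 : R) m; rewrite add0r sin0 => ->; rewrite expr0n mulr0.
exists (map tt (seq.filter P s)); split.
- rewrite map_inj_in_uniq ?filter_uniq// => a b; rewrite !mem_filter => /andP[Pa _] /andP[Pb _] ab.
  have [_ ha] := htt a Pa; have [_ hb] := htt b Pb.
  have := ha; rewrite ab hb => /(mulIf (lt0r_neq0 (pi_gt0 R))) /eqP.
  by rewrite eqr_int => /eqP ->.
- move=> _ /mapP[m + ->]; rewrite mem_filter => /andP[Pm _]; split; last exact: utt.
  by have [] := htt m Pm.
rewrite big_map.
apply: (@le_trans _ _ (\sum_(m <- seq.filter P s) (1 - h) ^+ 3 * (sin (phi y) ^+ 2 / (phi y - m%:~R * pi) ^+ 2))); last first.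
  rewrite big_seq [leRHS]big_seq; apply: ler_sum => m; rewrite mem_filter => /andP[Pm _].
  have [Nt ht] := htt m Pm.
  have yt : y != tt m by apply: contra uy => /eqP ->; rewrite utt.
  by have [_] := KS y _ Ny Nt yt; rewrite /S ht.
rewrite -mulr_sumr.
have far : \sum_(m <- s | ~~ P m) sin (phi y) ^+ 2 / (phi y - m%:~R * pi) ^+ 2 <= h.
  have p1 : 1 <= pi :> R by have := pi_ge2 R; lra.
  have [m1 _] := mono N y (lexx _) Ny.
  have M1 : 1 + 2 / h <= phi y - phi N.
    apply: le_trans m1; apply: (@le_trans _ _ (2^-1 * (y - N))); last by rewrite ler_wpM2r ?subr_ge0//; lra.
    by rewrite /Y in Yy; lra.
  have M1' : 1 < phi y - phi N by lra.
  apply: (@le_trans _ _ (\sum_(t <- map (fun m : int => m%:~R * pi) (seq.filter (fun m => ~~ P m) s)) ((phi y - t) ^+ 2)^-1)).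
    rewrite big_map big_filter; apply: ler_sum => m _.
    rewrite ler_piMl ?invr_ge0 ?sqr_ge0//; have := cos2Dsin2 (phi y); have := sqr_ge0 (cos (phi y)); lra.
  apply: le_trans (@separated_sum_far R 1 (phi y) (phi y - phi N) _ ltr01 M1' _ _ _) _.
  - rewrite map_inj_uniq ?filter_uniq// => a b /(mulIf (lt0r_neq0 (pi_gt0 R))) /eqP.
    by rewrite eqr_int => /eqP.
  - move=> _ _ /mapP[a _ ->] /mapP[b _ ->]; rewrite ltr_pM2r ?pi_gt0// ltr_int => ab.
    have : (a + 1)%:~R <= b%:~R :> R by rewrite ler_int lezD1.
    rewrite intrD => ab1; apply: (@le_trans _ _ ((a%:~R + 1) * pi)); last by rewrite ler_wpM2r// pi_ge0.
    by rewrite mulrDl mul1r lerD2l.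
  - move=> _ /mapP[m + ->]; rewrite mem_filter /P -ltNge => /andP[hm _].
    apply: le_trans (ler_norm _); lra.
  rewrite mul1r -ler_pdivlMl//; rewrite mulrC.
  rewrite -[leRHS]invf_div lef_pV2 ?posrE ?divr_gt0//; lra.
have split_s : 1 - h <= \sum_(m <- [seq x <- s | P x]) sin (phi y) ^+ 2 / (phi y - m%:~R * pi) ^+ 2 + h.
  apply: (le_trans hsum); rewrite (bigID P) /= big_filter lerD2l; exact: far.
set T := \sum_(m <- _) _ in split_s *.
apply: (@le_trans _ _ ((1 - h) ^+ 3 * (1 - 2 * h))).
  rewrite !exprS expr0; nra.
by rewrite ler_wpM2l ?exprn_ge0//; lra.
Qed.

(** [sturm_kernel] sees a half-line only. As [rA mu] is even, multiplying by the sign [sg] of y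
    moves y to |y|. The zeros with sg t < N, among them all those of opposite sign, are far from y:
    they are negligible in the upper bound and left out of the family chosen for the lower one. *)
Lemma kern_sum_near1 (R : realType) (mu e : R) : - 2^-1 < mu -> 0 < e -> exists2 Y : R, 0 < Y &
  forall y, Y <= `|y| -> rA mu y != 0 ->
   (forall s : seq R, uniq s -> (forall t, t \in s -> rA mu t = 0) -> \sum_(t <- s) kern mu y t <= 1 + e) /\
   (exists s : seq R, [/\ uniq s, forall t, t \in s -> rA mu t = 0 & 1 - e <= \sum_(t <- s) kern mu y t]).
Proof.
move=> mu2 e0; have mu1 : -1 < mu by lra.
have [K K0 [_ hfar]] := kern_sums mu2.
(* 7h <= e/2 covers the zeros beyond [N]; the others, at distance at least |y| - N >= 2K/e, get the
   second half of e. *)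
pose h := Num.min 2^-1 (e / 14).
have h0 : 0 < h by rewrite lt_min invr_gt0 ltr0n /= divr_gt0.
have h2 : h <= 2^-1 by rewrite ge_min lexx.
have he : 14 * h <= e by rewrite mulrC -ler_pdivlMr// ge_min lexx orbT.
have [N [N1 hub [Y0 NY0 hlb]]] := sturm_kernel (liouville_sturm mu1) h0 h2.
have Ke : 0 < 2 * K / e by rewrite divr_gt0// mulr_gt0.
exists (Y0 + 1 + 2 * K / e); first lra.
move=> y Yy ry.
have y0 : y != 0 by rewrite -normr_gt0; lra.
pose sg := Num.sg y.
have sg1 : sg * sg = 1 by rewrite -expr2 sqr_sg y0.
have ysg : y = sg * `|y| by exact: numEsg.
have uy : liouville mu `|y| != 0.
  by rewrite /liouville mulf_neq0 ?rA_norm// gt_eqF// powR_gt0// normr_gt0.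
have rsg t : rA mu (sg * t) = rA mu t.
  have : sg == 1 \/ sg == -1.
    by apply/orP; move: y0; rewrite neq_lt => /orP[yn|yp]; rewrite /sg ?(ltr0_sg yn) ?(gtr0_sg yp) eqxx ?orbT.
  by case=> /eqP ->; rewrite ?mul1r// mulN1r rA_even.
have kE t : N <= sg * t -> rA mu t = 0 ->
    kern mu y t = liouville mu `|y| ^+ 2 / (energy (liouville mu) (liouville1 mu) (sg * t) * (`|y| - sg * t) ^+ 2).
  move=> Nt rt; have st0 : 0 < sg * t by lra.
  have t0 : t != 0 by apply: contraTneq st0 => ->; rewrite mulr0 ltxx.
  have nt : `|t| = sg * t.
    by rewrite -(gtr0_norm st0) normrM normr_sg y0 mul1r.
  rewrite /kern ampE// amp1E// nt; congr (_ / (_ * _)).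
  have -> : y - t = sg * (`|y| - sg * t) by rewrite mulrBr mulrA sg1 mul1r -ysg.
  by rewrite exprMn [sg ^+ 2]expr2 sg1 mul1r.
have z0 (t : R) : N <= t -> liouville mu t = 0 -> rA mu t = 0.
  move=> Nt; have tp : 0 < t by lra.
  by move/eqP; rewrite /liouville mulf_eq0 (gt_eqF (powR_gt0 _ tp)) /= => /eqP.
split=> [s us sz|].
  rewrite (bigID (fun t => N <= sg * t)) /=.
  apply: (@le_trans _ _ ((1 + 7 * h) + e / 2)); last lra.
  apply: lerD.
    rewrite -big_filter.
    have -> : \sum_(t <- [seq t <- s | N <= sg * t]) kern mu y t =
      \sum_(t <- map (fun t => sg * t) [seq t <- s | N <= sg * t])
         liouville mu `|y| ^+ 2 / (energy (liouville mu) (liouville1 mu) t * (`|y| - t) ^+ 2).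
      rewrite big_map big_seq [RHS]big_seq; apply: eq_bigr => t.
      by rewrite mem_filter => /andP[Nt /sz rt]; exact: kE.
    apply: hub => //; first lra.
      rewrite map_inj_uniq ?filter_uniq// => a b ab.
      by rewrite -[a]mul1r -[b]mul1r -sg1 -!mulrA ab.
    move=> _ /mapP[t + ->]; rewrite mem_filter => /andP[Nt /sz rt]; split => //.
    by rewrite /liouville rsg rt mulr0.
  rewrite -big_filter.
  have M1 : 1 <= `|y| - N by lra.
  apply: le_trans (hfar y (`|y| - N) _ _ _ M1 _) _.
  - by rewrite filter_uniq.
  - move=> t; rewrite mem_filter => /andP[_ /sz rt]; split => //.
    by apply: contra ry => /eqP ->; rewrite rt.
  - move=> t; rewrite mem_filter -ltNge => /andP[Nt _].
    apply: (@le_trans _ _ (sg * (y - t))).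
      rewrite mulrBr {2}ysg mulrA sg1 mul1r lerD2l lerN2; exact: ltW.
    apply: le_trans (ler_norm _) _; rewrite normrM normr_sg y0 mul1r.
    by [].
  rewrite ler_pdivrMr; last lra.
  rewrite mulrC -ler_pdivrMr ?divr_gt0// invf_div; lra.
have [|s [us sz hs]] := hlb `|y| _ uy; first lra.
exists (map (fun t => sg * t) s).
have szz t : t \in s -> rA mu t = 0 by move=> /sz[Nt]; exact: z0.
split.
- rewrite map_inj_uniq// => a b ab.
  by rewrite -[a]mul1r -[b]mul1r -sg1 -!mulrA ab.
- by move=> _ /mapP[t /szz rt ->]; rewrite rsg.
rewrite big_map; apply: (@le_trans _ _ (1 - 5 * h)); first lra.
apply: (le_trans hs); rewrite le_eqVlt; apply/orP; left; apply/eqP.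
rewrite big_seq [RHS]big_seq; apply: eq_bigr => t ts.
have [Nt _] := sz t ts.
by rewrite kE ?rsg ?szz// mulrA sg1 mul1r.
Qed.

(** The argument for approximate identities: the error is the sum of K(y,t) (g(t/tau) - g x) plus g
    x times the defect of the kernel sum from 1. The first part splits at |t/tau - x| = d. In the
    second the defect is small for |y| >= Y, whereas for |y| < Y it is only bounded but g x is
    small, as g 0 = 0. *)
Lemma kern_approx (R : realType) (mu M : R) (g : R -> C R) : - 2^-1 < mu ->
  (forall x, cabs (g x) <= M) ->
  (forall e, 0 < e -> exists2 d, 0 < d & forall x x', `|x - x'| < d -> cabs (g x - g x') <= e) ->
  g 0 = 0 -> forall e, 0 < e -> exists2 tau0, 0 < tau0 & forall tau, tau0 <= tau -> forall x,
    rA mu (tau * x) != 0 -> exists A : {fset R}, forall B : {fset R}, (A `<=` B)%fset ->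
    cabs (\sum_(t <- B) (if rA mu t == 0 then toC (kern mu (tau * x) t) * g (t / tau) else 0) - g x) <= e.
Proof.
move=> mu2 gM gu g0 e e0; have mu1 : -1 < mu by lra.
have [K K0 [hall hfar]] := kern_sums mu2.
have M0 : 0 <= M by apply: le_trans (gM 0); exact: cabs_ge0.
(* e1 K is spent on the near nodes and e1 (K + 1 + M) on the defect, e/2 altogether; the other half
   is for the far nodes. *)
pose e1 := e / (2 * (2 * K + 1 + M)).
have D0 : 0 < 2 * K + 1 + M by lra.
have e10 : 0 < e1 by rewrite divr_gt0// mulr_gt0.
have e1E : e1 * (2 * K + 1 + M) = e / 2 by rewrite /e1; field; rewrite gt_eqF.
have [d d0 hd] := gu e1 e10.
have [Y Y0 hY] := kern_sum_near1 mu2 e10.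
(* The three summands ensure d tau >= 1, as (ii) requires, |x| < d whenever |tau x| < Y, and 2MK/(d
   tau) <= e/2. *)
pose tau0 := (1 + Y + 4 * M * K / e) / d.
have MKe : 0 <= 4 * M * K / e by rewrite !mulr_ge0 ?invr_ge0 ?(ltW K0) ?(ltW e0).
exists tau0; first by rewrite divr_gt0//; lra.
move=> tau tau0t x ry; set y := tau * x in ry *.
have dt : 1 + Y + 4 * M * K / e <= d * tau by rewrite [d * tau]mulrC -ler_pdivrMr.
have t0 : 0 < tau by apply: lt_le_trans tau0t; rewrite divr_gt0//; lra.
have main (s : seq R) : uniq s -> (forall t, t \in s -> rA mu t = 0) ->
   cabs (g x) * `|\sum_(t <- s) kern mu y t - 1| <= e1 * (K + 1 + M) ->
   cabs (\sum_(t <- s) toC (kern mu y t) * g (t / tau) - g x) <= e.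
  move=> us sz hc.
  have sz' t : t \in s -> rA mu t = 0 /\ y != t.
    by move=> /sz rt; split => //; apply: contra ry => /eqP ->; rewrite rt.
  have -> : \sum_(t <- s) toC (kern mu y t) * g (t / tau) - g x =
    \sum_(t <- s) toC (kern mu y t) * (g (t / tau) - g x) + g x * toC (\sum_(t <- s) kern mu y t - 1).
    rewrite toCB; have -> : toC (\sum_(t <- s) kern mu y t) = \sum_(t <- s) toC (kern mu y t).
      by rewrite /toC rmorph_sum.
    rewrite (toC_nat R 1) mulrBr mulr1 addrA mulr_sumr -big_split /=; congr (_ - _).
    by apply: eq_bigr => t _; ring.
  apply: le_trans (cabsD _ _) _.
  rewrite cabsM cabs_toC.
  have hf : cabs (\sum_(t <- s) toC (kern mu y t) * (g (t / tau) - g x)) <= e1 * K + 2 * M * (K / (d * tau)).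
    apply: le_trans (cabs_sum _ _ _) _.
    apply: (@le_trans _ _ (e1 * \sum_(t <- s) kern mu y t + 2 * M * \sum_(t <- s | d * tau <= `|y - t|) kern mu y t)).
      rewrite [in X in _ + X]big_mkcond /= !mulr_sumr -big_split /=; apply: ler_sum => t _.
      rewrite cabsM cabs_toC ger0_norm ?kern_ge0//.
      case: ifPn => hfar_t.
        rewrite [leLHS]mulrC.
        apply: (@le_trans _ _ (2 * M * kern mu y t)); last by rewrite lerDr mulr_ge0 ?kern_ge0// ltW.
        rewrite ler_wpM2r ?kern_ge0//; apply: le_trans (cabsB _ _) _.
        by rewrite mulr2n mulrDl mul1r lerD.
      rewrite mulr0 addr0 mulrC ler_wpM2r ?kern_ge0// hd//.
      have e2 : `|t / tau - x| * tau = `|y - t|.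
        by rewrite -[X in _ * X](gtr0_norm t0) -normrM mulrBl divfK ?gt_eqF// [x * tau]mulrC distrC.
      by rewrite -(ltr_pM2r t0) e2 ltNge.
    apply: lerD; first by rewrite ler_wpM2l ?(ltW e10)// hall.
    rewrite ler_wpM2l ?mulr_ge0// -big_filter; apply: hfar.
    - by rewrite filter_uniq.
    - by move=> t; rewrite mem_filter => /andP[_ /sz'].
    - lra.
    - by move=> t; rewrite mem_filter => /andP[].
  have hf2 : 2 * M * (K / (d * tau)) <= e / 2.
    have dt0 : 0 < d * tau by rewrite mulr_gt0.
    rewrite mulrA ler_pdivrMr//.
    have : 4 * M * K / e <= d * tau by lra.
    rewrite ler_pdivrMr// => hh; lra.
  move: e1E hc hf hf2; rewrite !mulrDr !mulr1; lra.
have red (B : {fset R}) : \sum_(t <- B) (if rA mu t == 0 then toC (kern mu y t) * g (t / tau) else 0) =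
   \sum_(t <- [seq t <- B | rA mu t == 0]) toC (kern mu y t) * g (t / tau).
  by rewrite big_filter -big_mkcond.
have fz (B : {fset R}) t : t \in [seq t <- B | rA mu t == 0] -> rA mu t = 0.
  by rewrite mem_filter => /andP[/eqP].
have [yY|yY] := leP Y `|y|.
  have [hu [s0 [us0 sz0 hl]]] := hY y yY ry.
  exists [fset t in s0]%fset => B AB.
  rewrite red; apply: main; rewrite ?filter_uniq ?fset_uniq//; first exact: fz.
  apply: (@le_trans _ _ (M * e1)).
    apply: ler_pM; rewrite ?cabs_ge0//.
    rewrite ler_distl; apply/andP; split; last first.
      by apply: hu; rewrite ?filter_uniq ?fset_uniq//; exact: fz.
    apply: (le_trans hl); apply: sum_le_sub => //; first by move=> t; exact: kern_ge0.
    move=> t ts; rewrite mem_filter sz0// eqxx /=; apply: (fsubsetP AB).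
    by rewrite !inE.
  by rewrite mulrC ler_wpM2l ?(ltW e10)//; lra.
exists fset0 => B _.
rewrite red; apply: main; rewrite ?filter_uniq ?fset_uniq//; first exact: fz.
have gx : cabs (g x) <= e1.
  rewrite -[g x]subr0 -g0; apply: hd; rewrite subr0.
  have e2 : `|x| * tau = `|y| by rewrite -[X in _ * X](gtr0_norm t0) -normrM mulrC.
  rewrite -(ltr_pM2r t0) e2; lra.
apply: (@le_trans _ _ (e1 * (K + 1))); last by rewrite ler_wpM2l ?(ltW e10)//; lra.
apply: ler_pM; rewrite ?cabs_ge0//.
apply: le_trans (ler_normB _ _) _; rewrite normr1 lerD2r ger0_norm; last first.
  by apply: sumr_ge0 => t _; exact: kern_ge0.
apply: hall; first by rewrite filter_uniq ?fset_uniq.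
move=> t /fz rt; split => //; apply: contra ry => /eqP ->; by rewrite rt.
Qed.

(** * The interpolation series *)

Definition bQ (R : realType) (mu t : R) (z : C R) : C R :=
  if z == toC t then bA1 mu (toC t) else bA mu z / (z - toC t).

(** The divided difference (w^n - t^n)/(w - t) as a polynomial, meaningful at w = t. *)
Definition dquot (R : realType) (t : R) (n : nat) (w : C R) : C R :=
  \sum_(i < n) w ^+ (n.-1 - i) * toC t ^+ i.

(** As A_mu(t) = 0, the quotient is (A_mu(w) - A_mu(t))/(w - t), expanded termwise. One series thus
    covers the node and all other points. *)
Lemma bQ_has_sum (R : realType) (mu t : R) (w : C R) : -1 < mu -> rA mu t = 0 ->
  has_sum (fun n => toC (bessel_coef mu n) * dquot t (2 * n) w) (bQ mu t w).
Proof.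
move=> mu1 rt; rewrite /bQ; case: eqVneq => [->|wt].
  have [h _] := bA_qbound_sum (toC t) mu1.
  move: h; congr has_sum; apply/funext => n; congr (_ * _).
  rewrite /dquot (eq_bigr (fun _ => toC t ^+ (2 * n).-1)).
    by rewrite sumr_const card_ord mulr_natl.
  move=> i _; rewrite -exprD subnK// -ltnS prednK ?ltn_ord//.
  by case: (2 * n)%N i => [[]|].
have wt0 : w - toC t != 0 by rewrite subr_eq0.
have := has_sumZ (w - toC t)^-1 (has_sumB (bA_has_sum w mu1) (bA_has_sum (toC t) mu1)).
rewrite [bA mu (toC t)]bA_real// rt (_ : toC 0 = 0)// subr0 mulrC.
congr has_sum; apply/funext => n.
by rewrite /bterm -mulrBr subrXX /dquot mulrCA mulKf.
Qed.

Lemma exp_pred_le (R : realType) (X : R) (m : nat) : 0 <= X -> m%:R * X ^+ m.-1 <= (X + 1) ^+ m.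
Proof.
move=> X0; elim: m => [|m IH]; first by rewrite mul0r expr0.
have X1 : 0 <= X + 1 by lra.
rewrite [leRHS]exprS mulrDl mul1r -natr1 mulrDl mul1r /= lerD//; last first.
  by apply: lerXn2r; rewrite ?nnegrE//; lra.
apply: le_trans (ler_wpM2l X0 IH).
by case: m {IH} => [|m]; rewrite /= ?mul0r ?mulr0// exprS mulrCA.
Qed.

Lemma cabs_dquot_le (R : realType) (t X : R) (w : C R) n : cabs w <= X -> `|t| <= X ->
  cabs (dquot t n w) <= (X + 1) ^+ n.
Proof.
move=> wX tX; have X0 : 0 <= X by apply: le_trans wX; exact: cabs_ge0.
apply: le_trans (exp_pred_le n X0).
apply: le_trans (cabs_sum _ _ _) _.
apply: (@le_trans _ _ (\sum_(i < n) X ^+ n.-1)); last by rewrite sumr_const card_ord mulr_natl.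
apply: ler_sum => i _; rewrite cabsM !cabsX cabs_toC.
have -> : X ^+ n.-1 = X ^+ (n.-1 - i) * X ^+ i.
  by rewrite -exprD subnK// -ltnS prednK ?ltn_ord//; case: n i => [[]|].
by apply: ler_pM; rewrite ?exprn_ge0 ?cabs_ge0// lerXn2r ?nnegrE ?cabs_ge0.
Qed.

Lemma qboundD (R : realType) (F G : C R -> C R) (z F1 G1 : C R) (K L : R) :
  qbound F z F1 K -> qbound G z G1 L ->
  qbound (fun w => F w + G w) z (F1 + G1) (K + L).
Proof.
move=> hF [g0 g1 g2]; have hG : qbound (fun w => - G w) z (- G1) L.
  split; rewrite ?cabsN// => h h1.
  rewrite (_ : _ - _ - _ = - (G (z + h) - G z - h * G1)) ?cabsN; last by ring.
  exact: g2.
have := qboundB hF hG; rewrite opprK.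
by congr (qbound _ _ _ _); apply/funext => w; rewrite opprK.
Qed.

Lemma qbound_cst (R : realType) (c z : C R) : qbound (fun _ => c) z 0 (cabs c).
Proof.
split => //; first by rewrite cabs0 cabs_ge0.
by move=> h _; rewrite mulr0 subr0 subrr cabs0 mulr_ge0 ?cabs_ge0 ?sqr_ge0.
Qed.

Lemma qbound_bigsum (R : realType) (I : Type) (s : seq I) (F : I -> C R -> C R) (z : C R)
    (K : I -> R) : (forall i, exists V, qbound (F i) z V (K i)) ->
  exists V, qbound (fun w => \sum_(i <- s) F i w) z V (\sum_(i <- s) K i).
Proof.
move=> h; elim: s => [|i s [V IH]].
  exists 0; have := qbound_cst (0 : C R) z; rewrite cabs0 big_nil.
  by congr (qbound _ _ _ _); apply/funext => w; rewrite big_nil.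
have [W hW] := h i; exists (W + V).
have := qboundD hW IH; rewrite [in X in _ -> X]big_cons.
by congr (qbound _ _ _ _); apply/funext => w; rewrite big_cons.
Qed.

Lemma qbound_dquot (R : realType) (t X : R) (z : C R) n : 6 * (cabs z + 1) <= X -> `|t| <= X ->
  exists V, qbound (dquot t n) z V ((X + 1) ^+ n).
Proof.
move=> zX tX; have c0 := cabs_ge0 z; have X0 : 0 <= X by lra.
have := @qbound_bigsum R _ (index_enum 'I_n) (fun (i : 'I_n) w => w ^+ (n.-1 - i) * toC t ^+ i) z (fun i => X ^+ n.-1).
case=> [i|V hV].
  have e : X ^+ n.-1 = X ^+ i * X ^+ (n.-1 - i).
    by rewrite -exprD subnKC// -ltnS prednK ?ltn_ord//; case: (n) i => [[]|].
  exists (toC t ^+ i * ((n.-1 - i)%:R * z ^+ (n.-1 - i).-1)); rewrite e.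
  have ti : cabs (toC t ^+ i) <= X ^+ i by rewrite cabsX cabs_toC lerXn2r ?nnegrE.
  have := qboundZ ti (qbound_exp (n.-1 - i) zX).
  by congr (qbound _ _ _ _); apply/funext => w; rewrite mulrC.
exists V; apply: (qbound_le _ hV).
apply: le_trans (exp_pred_le n X0).
by rewrite sumr_const card_ord mulr_natl.
Qed.

Lemma qbound_ext (R : realType) (F G : C R -> C R) (z V : C R) (K : R) :
  (forall w, cabs (w - z) <= 1 -> F w = G w) -> qbound F z V K -> qbound G z V K.
Proof.
move=> e [h0 h1 h2].
have ez : F z = G z by apply: e; rewrite subrr cabs0.
by split; rewrite -?ez// => h hh; rewrite -e ?h2// addrC addKr.
Qed.

Lemma qbound_inv (R : realType) (a z : C R) : 3 <= cabs (z - a) ->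
  qbound (fun w => (w - a)^-1) z (- (z - a)^-1 ^+ 2) 1.
Proof.
move=> h3; have z0 : z - a != 0 by rewrite -cabs_eq0 gt_eqF//; lra.
have i1 : (cabs (z - a))^-1 <= 1 by rewrite invf_le1//; lra.
have i0 : 0 <= (cabs (z - a))^-1 by rewrite invr_ge0 cabs_ge0.
split.
- by rewrite cabsV.
- by rewrite cabsN cabsX cabsV expr_le1.
move=> h h1.
have h2 : 1 <= cabs (z + h - a).
  have -> : z + h - a = (z - a) - (- h) by ring.
  have := cabsD (z - a - - h) (- h); rewrite subrK cabsN; lra.
have zh0 : z + h - a != 0 by rewrite -cabs_eq0 gt_eqF//; lra.
have -> : (z + h - a)^-1 - (z - a)^-1 - h * - (z - a)^-1 ^+ 2 = h ^+ 2 * ((z - a)^-1 ^+ 2 * (z + h - a)^-1).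
  by field; rewrite zh0 z0.
rewrite cabsM cabsX mul1r ler_piMr ?sqr_ge0// cabsM cabsX !cabsV.
rewrite mulr_ile1 ?exprn_ge0 ?invr_ge0 ?cabs_ge0 ?expr_le1//.
by rewrite invf_le1//; lra.
Qed.

(** The point is that [K] precedes [t]. If |z - t| >= 3 then 1/(w - t) is under control for w in the
    unit disc around z; otherwise |t| <= |z| + 3 <= X and the divided differences are dominated by
    the series of A_mu at X + 1. *)
Lemma bQ_qbound (R : realType) (mu : R) (z : C R) : -1 < mu ->
  exists K, forall t, rA mu t = 0 -> exists V, qbound (bQ mu t) z V K.
Proof.
move=> mu1; have [K K0 hK] := bcoef_sum mu1 (ltac:(lra) : (1 : R) < 2).
have [L hL] := bA_qbound z mu1.
have L0 : 0 <= L by case: hL => h _ _; apply: le_trans h; exact: cabs_ge0.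
have c0 := cabs_ge0 z.
pose X := 6 * (cabs z + 1).
exists (K * expR (2 * (X + 1)) + 6 * L * 1) => t rt.
have [h3|h3] := leP 3 (cabs (z - toC t)).
  exists (bA1 mu z * (z - toC t)^-1 + bA mu z * - (z - toC t)^-1 ^+ 2).
  apply: (qbound_le _ (qbound_ext _ (qboundM hL (qbound_inv h3)))).
    by rewrite lerDr mulr_ge0 ?expR_ge0.
  move=> w wz; rewrite /bQ; case: eqVneq => // wt.
  by move: h3; rewrite -{}wt -cabsN opprB => h3; exfalso; lra.
have tX : `|t| <= X.
  rewrite -cabs_toC; have -> : toC t = z - (z - toC t) by ring.
  apply: le_trans (cabsB _ _) _; rewrite /X; lra.
have X1 : 0 <= X + 1 by rewrite /X; lra.
have [V hV] : {V : nat -> C R & forall n, qbound (dquot t (2 * n)) z (V n) ((X + 1) ^+ (2 * n))}.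
  by apply: (@choice _ _ (fun n V => qbound (dquot t (2 * n)) z V ((X + 1) ^+ (2 * n)))) => n; exact: qbound_dquot.
have [W _ hW] := @qbound_sum R nat (fun n w => toC (bessel_coef mu n) * dquot t (2 * n) w) z _ _ _ _
   (fun n => qboundZ (le_of_eq (cabs_toC (bessel_coef mu n))) (hV n))
   (fun B => hK (X + 1) B X1) (fun w => bQ_has_sum w mu1 rt).
exists W; apply: (qbound_le _ hW).
by rewrite lerDl !mulr_ge0.
Qed.

Lemma bQ_mult (R : realType) (mu t : R) (w : C R) : -1 < mu -> rA mu t = 0 ->
  toC t * bQ mu t w = w * bQ mu t w - bA mu w.
Proof.
move=> mu1 rt; rewrite /bQ; case: eqVneq => [->|wt].
  by rewrite [bA mu (toC t)]bA_real// rt (_ : toC 0 = 0)// subr0.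
have wt0 : w - toC t != 0 by rewrite subr_eq0.
by field.
Qed.

Lemma bQ_growth (R : realType) (mu lam : R) : -1 < mu -> 1 < lam ->
  exists2 K, 0 <= K & forall t w, rA mu t = 0 ->
    cabs (toC t * bQ mu t w) <= K * ((1 + cabs w) * expR (lam * cabs w)).
Proof.
move=> mu1 l1; have [K K0 hK] := bcoef_sum mu1 l1; have [L L0 hL] := bA_growth mu1 l1.
have e1 : 1 <= expR (2 * lam) by rewrite -[leLHS]expR0 ler_expR; lra.
exists ((K + L) * expR (2 * lam)); first by rewrite mulr_ge0 ?addr_ge0 ?expR_ge0.
move=> t w rt; rewrite bQ_mult//; have c0 := cabs_ge0 w.
apply: le_trans (cabsB _ _) _; rewrite cabsM.
have hA : cabs (bA mu w) <= (K + L) * expR (2 * lam) * expR (lam * cabs w).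
  apply: le_trans (hL w) _; rewrite ler_wpM2r ?expR_ge0//.
  rewrite -[leLHS]mulr1 ler_pM//; lra.
suff hQ : cabs (bQ mu t w) <= (K + L) * expR (2 * lam) * expR (lam * cabs w).
  rewrite [leRHS](_ : _ = cabs w * ((K + L) * expR (2 * lam) * expR (lam * cabs w)) + (K + L) * expR (2 * lam) * expR (lam * cabs w)); last by ring.
  by rewrite lerD// ler_wpM2l.
have [h1|h1] := leP 1 (cabs (w - toC t)).
  rewrite /bQ; case: eqVneq => [wt|wt].
    by move: h1; rewrite wt subrr cabs0 => h1; lra.
  rewrite cabsM cabsV; apply: le_trans hA.
  by rewrite ler_piMr ?cabs_ge0// invf_le1//; lra.
have tX : `|t| <= cabs w + 1.
  rewrite -cabs_toC; have -> : toC t = w - (w - toC t) by ring.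
  apply: le_trans (cabsB _ _) _; lra.
apply: (has_sum_le (bQ_has_sum w mu1 rt)) => B; apply: le_trans (cabs_sum _ _ _) _.
(* One unit comes from |t| <= |w| + 1, the other from [cabs_dquot_le]; together they cost the factor
   exp(2 lam). *)
apply: (@le_trans _ _ (K * expR (lam * (cabs w + 1 + 1)))).
  apply: le_trans (hK (cabs w + 1 + 1) B _); last lra.
  apply: ler_sum => n _; rewrite cabsM cabs_toC ler_wpM2l//.
  by apply: cabs_dquot_le => //; lra.
rewrite (_ : lam * (cabs w + 1 + 1) = 2 * lam + lam * cabs w); last by ring.
by rewrite expRD mulrA ler_wpM2r ?expR_ge0// ler_wpM2r ?expR_ge0//; lra.
Qed.

(** The zeros stay at distance r from 0, so 1/t^2 <= (1 + 1/r^2)/(1 + t^2), and [separated_sum_all]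
    applies at y = 0. *)
Lemma zeros_inv_sqr (R : realType) (mu : R) : -1 < mu -> exists2 K, 0 <= K &
  forall B : {fset R}, \sum_(t <- B) (if rA mu t == 0 then (t ^+ 2)^-1 else 0) <= K.
Proof.
move=> mu1; have [r [d [c [[r0 /andP[d0 d1] c0] [hr hsep _]]]]] := zeros_facts mu1.
have d10 : 0 < d * (1 - d) by rewrite mulr_gt0//; lra.
have r2 : 0 < r ^+ 2 by rewrite exprn_gt0.
exists ((1 + (r ^+ 2)^-1) * (4 * (d * (1 - d))^-1)).
  by rewrite !mulr_ge0// ?addr_ge0 ?invr_ge0// ltW.
move=> B; rewrite -big_mkcond -big_filter /=.
have hz t : t \in [seq t <- B | rA mu t == 0] -> rA mu t = 0 by rewrite mem_filter => /andP[/eqP].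
apply: (@le_trans _ _ (\sum_(t <- [seq t <- B | rA mu t == 0]) (1 + (r ^+ 2)^-1) * (1 + (0 - t) ^+ 2)^-1)).
  rewrite big_seq [leRHS]big_seq; apply: ler_sum => t /hz/hr rt.
  have t2 : r ^+ 2 <= t ^+ 2 by rewrite -[leRHS]real_normK ?num_real// lerXn2r ?nnegrE// ltW.
  have t20 : 0 < t ^+ 2 by exact: lt_le_trans t2.
  rewrite sub0r sqrrN ler_pdivlMr; last lra.
  rewrite mulrDr mulr1 mulVf ?gt_eqF// addrC lerD2l lef_pV2 ?posrE//.
rewrite -mulr_sumr ler_wpM2l ?addr_ge0 ?invr_ge0 ?(ltW r2)//.
apply: separated_sum_all => //; first lra; first by rewrite filter_uniq ?fset_uniq.
by move=> a b /hz ra /hz rb; exact: hsep.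
Qed.

Definition zterm (R : realType) (mu : R) (c : R -> C R) (w : C R) (t : R) : C R :=
  if rA mu t == 0 then c t * bQ mu t w ^+ 2 else 0.

Lemma zero_series (R : realType) (mu L : R) (c : R -> C R) : -1 < mu ->
  (forall t, rA mu t = 0 -> cabs (c t) <= L) -> exists F : C R -> C R,
  [/\ forall w, has_sum (zterm mu c w) (F w), forall z, exists V K, qbound F z V K &
   forall lam, 1 < lam -> exists2 K, 0 <= K &
     forall w, cabs (F w) <= K * ((1 + cabs w) * expR (lam * cabs w)) ^+ 2].
Proof.
move=> mu1 hc; have [S S0 hS] := zeros_inv_sqr mu1.
have [r [d [a [[r0 _ _] [hr _ _]]]]] := zeros_facts mu1.
(* If no zero existed, [hc] would be void and [L] might be negative. *)
pose L' := Num.max 0 L.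
have L0 : 0 <= L' by rewrite le_max lexx.
have {}hc t : rA mu t = 0 -> cabs (c t) <= L' by move=> /hc h; rewrite le_max h orbT.
have tn0 t : rA mu t = 0 -> t != 0.
  by move=> /hr h; rewrite -normr_gt0; exact: lt_le_trans h.
have zE t w : rA mu t = 0 -> zterm mu c w t = (c t / toC t ^+ 2) * ((toC t * bQ mu t w) * (toC t * bQ mu t w)).
  move=> rt; rewrite /zterm rt eqxx.
  have tc : toC t != 0 by rewrite (inj_eq (@toC_inj R) t 0) tn0.
  by field.
have ct t : rA mu t = 0 -> cabs (c t / toC t ^+ 2) <= L' * (t ^+ 2)^-1.
  move=> rt; rewrite cabsM cabsV cabsX cabs_toC real_normK ?num_real//.
  by rewrite ler_wpM2r ?invr_ge0 ?sqr_ge0// hc.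
have key (K : R) (B : {fset R}) : 0 <= K ->
    \sum_(t <- B) (if rA mu t == 0 then L' * (t ^+ 2)^-1 * K else 0) <= L' * S * K.
  move=> K0; apply: (@le_trans _ _ (\sum_(t <- B) L' * K * (if rA mu t == 0 then (t ^+ 2)^-1 else 0))).
    by apply: ler_sum => t _; case: ifP => _; rewrite ?mulr0// mulrAC.
  by rewrite -mulr_sumr [leRHS]mulrAC ler_wpM2l ?mulr_ge0.
have qz z : exists2 K, 0 <= K & forall t, exists V, qbound (zterm mu c ^~ t) z V
    (if rA mu t == 0 then L' * (t ^+ 2)^-1 * K else 0).
  have [K hK] := bQ_qbound z mu1; have [M hM] := bA_qbound z mu1.
  pose K1 := 6 * (cabs z + 1) * K + M.
  exists (6 * K1 * K1).
    by rewrite -mulrA mulr_ge0// -expr2 sqr_ge0.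
  move=> t; case: eqVneq => [rt|rt]; last first.
    exists 0; have := qbound_cst (0 : C R) z; rewrite cabs0.
    by congr (qbound _ _ _ _); apply/funext => w; rewrite /zterm (negbTE rt).
  have [V hV] := hK t rt.
  have h1 := qboundB (qboundM (qbound_id z) hV) hM.
  have h2 := qboundZ (ct t rt) (qboundM h1 h1).
  eexists; apply: (qbound_ext _ h2) => w _.
  by rewrite zE// !bQ_mult.
have [F hF] : {F : C R -> C R & forall w, has_sum (zterm mu c w) (F w)}.
  apply: (@choice _ _ (fun w l => has_sum (zterm mu c w) l)) => w.
  have [K K0 hK] := qz w.
  apply: (@has_sum_ex _ _ _ (L' * S * K)).
  apply: (sum_cabs_bound (v := fun t => if rA mu t == 0 then L' * (t ^+ 2)^-1 * K else 0)).
    by move=> t; have [V []] := hK t.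
  by move=> B; exact: key.
exists F; split => //.
  move=> z; have [K K0 hK] := qz z.
  have [V hV] := choice hK.
  have [W _ hW] := qbound_sum hV (fun B => key K B K0) hF.
  by exists W, (L' * S * K).
move=> lam l1; have [K K0 hK] := bQ_growth mu1 l1.
exists (L' * S * K ^+ 2); first by rewrite !mulr_ge0 ?sqr_ge0.
move=> w; set E := (1 + _) * _.
have E0 : 0 <= E by rewrite mulr_ge0 ?expR_ge0 ?addr_ge0 ?cabs_ge0.
apply: (has_sum_le (hF w)) => B; apply: le_trans (cabs_sum _ _ _) _.
have KE : 0 <= K ^+ 2 * E ^+ 2 by rewrite mulr_ge0 ?sqr_ge0.
rewrite -mulrA; apply: le_trans (key _ B KE).
apply: ler_sum => t _; case: eqVneq => [rt|rt]; last by rewrite /zterm (negbTE rt) cabs0.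
rewrite zE// cabsM; apply: ler_pM; rewrite ?cabs_ge0//; first exact: ct.
rewrite cabsM -exprMn expr2; have := hK t w rt => h.
by apply: ler_pM; rewrite ?cabs_ge0.
Qed.

(** * Exponential type, essential suprema and continuity *)

Lemma exp_type_le (R : realType) (F : C R -> C R) (a : R) :
  (forall b, a < b -> exists K, forall z, cabs (F z) <= K * expR (b * cabs z)) ->
  (exp_type F <= a%:E)%E.
Proof.
move=> h; apply/lee_addgt0Pr => e e0.
have e20 : 0 < e / 2 by rewrite divr_gt0.
have [K0 hK0] := h (a + e / 2) (ltac:(lra)).
pose K := Num.max 1 K0.
have K1 : 0 < K by rewrite lt_max ltr01.
have {}hK z : cabs (F z) <= K * expR ((a + e / 2) * cabs z).
  by apply: le_trans (hK0 z) _; rewrite ler_wpM2r ?expR_ge0// le_max lexx orbT.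
(* Beyond [M] one has ln K <= (e/2)|z|, so the constant uses up the second half of e. *)
pose M := Num.max 0 (ln K / (e / 2)).
apply: (@le_trans _ _ (ereal_sup ((fun z : C R => (((cabs z)^-1)%:E * lne (cabs (F z))%:E)%E) @` [set z : C R | M < cabs z]))).
  apply: ereal_inf_lbound; exists [set z : C R | M < cabs z] => //.
  by exists M.
apply: ge_ereal_sup => _ [z Mz <-]; rewrite [_ z]/= in Mz.
move: Mz; rewrite /M gt_max => /andP[z0 zK].
have z0' : 0 < (cabs z)^-1 by rewrite invr_gt0.
have [F0|F0] := leP (cabs (F z)) 0.
  by rewrite le0_lneNy ?lee_fin// gt0_muleNy ?lte_fin// leNye.
rewrite lne_EFin// -EFinM -EFinD lee_fin mulrC ler_pdivrMr//.
have : ln (cabs (F z)) <= ln K + (a + e / 2) * cabs z.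
  rewrite -[X in _ + X]expRK -lnM ?posrE ?expR_gt0// ler_ln ?posrE ?mulr_gt0 ?expR_gt0//.
move: zK; rewrite ltr_pdivrMr// => zK; lra.
Qed.

(** The origin is a null set, so the arbitrary value of f there does not affect the norm. *)
Lemma Linfty_norm_le (R : realType) (g : R -> C R) (e : R) :
  (forall x, x != 0 -> cabs (g x) <= e) -> (Linfty_norm g <= e%:E)%E.
Proof.
move=> h; rewrite /Linfty_norm Lnorm.unlock; case: ifP => _.
  apply/ess_supP; exists [set 0]; split => //.
    exact: lebesgue_measure_set1.
  move=> x /=; rewrite ger0_norm ?cabs_ge0// lee_fin => hx.
  by apply: contrapT => /eqP/h.
by rewrite lee_fin (le_trans _ (h 1 (oner_neq0 _)))// cabs_ge0.
Qed.

(** A strict violation at a continuity point would persist on a ball, which has positive measure. *)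
Lemma continuous_ae_bound (R : realType) (h : R -> R) (M x : R) : {for x, continuous h} ->
  (\forall y \ae @lebesgue_measure R, h y <= M) -> h x <= M.
Proof.
move=> hc hM; rewrite leNgt; apply/negP => Mx.
have [d /= d0 hd] := cvgr_gt _ hc _ Mx.
have [A [mA A0 sA]] := hM.
have : (lebesgue_measure (ball x d) <= @lebesgue_measure R A)%E.
  apply: le_measure; rewrite ?inE//; first exact: measurable_ball.
  by move=> y /hd My; apply: sA => /=; apply/negP; rewrite -ltNge.
rewrite [leRHS]A0 lebesgue_measure_ball ?(ltW d0)// leNgt => /negP; apply.
by rewrite lte_fin mulrn_wgt0.
Qed.

(** [Lnorm] at +oo is an essential supremum only when the whole space has positive measure. *)
Lemma lebesgue_measureT_gt0 (R : realType) : (0 < @lebesgue_measure R setT)%E.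
Proof.
have : (lebesgue_measure (ball (0 : R)%R 1) <= @lebesgue_measure R setT)%E.
  by apply: le_measure; rewrite ?inE//; exact: measurable_ball.
apply: lt_le_trans; by rewrite lebesgue_measure_ball// lte_fin.
Qed.

Lemma cabs_continuous (R : realType) (f : R -> C R) (x : R) :
  {for x, continuous f} -> {for x, continuous (fun y => cabs (f y))}.
Proof.
move=> /cvgrPdist_lt fc; apply/cvgrPdist_lt => e e0.
have e0' : 0 < toC e by rewrite (lt_toC 0 e).
near=> y; have : `|f x - f y| < toC e by near: y; exact: fc.
rewrite normCE lt_toC; apply: le_lt_trans.
have h1 := cabsD (f x - f y) (f y); have h2 := cabsD (f y - f x) (f x).
rewrite subrK in h1; rewrite subrK -[cabs (f y - f x)]cabsN opprB in h2.
by rewrite ler_norml; apply/andP; split; lra.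
Unshelve. all: by end_near. Qed.

Lemma weight_continuous (R : realType) (nu x : R) : x != 0 -> {for x, continuous (weight nu)}.
Proof.
move=> x0; apply: (@continuous_comp _ _ _ (fun y : R => `|y|) (fun y => y `^ (2 * nu + 1))).
  exact: norm_continuous.
have /(is_derive_powR (2 * nu + 1)) : 0 < `|x| by rewrite normr_gt0.
exact: is_derive_continuous.
Qed.

Lemma weighted_bound (R : realType) (nu : R) (f : R -> C R) :
  (forall x : R, x != 0 -> {for x, continuous f}) ->
  (Linfty_norm (fun x : R => (f x * toC (weight nu x))%R) < +oo)%E ->
  exists2 M, 0 <= M & forall x, x != 0 -> cabs (f x * toC (weight nu x)) <= M.
Proof.
move=> fc; set N := Linfty_norm _ => hN.
have N0 : (0 <= N)%E by exact: Lnorm_ge0.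
have [M M0 NM] : exists2 M, 0 <= M & N = M%:E.
  by exists (fine N); rewrite ?fine_ge0// fineK// ge0_fin_numE.
exists M => // x x0; rewrite cabsM cabs_toC ger0_norm ?powR_ge0//.
apply: (@continuous_ae_bound _ (fun x => cabs (f x) * weight nu x)).
  apply: (@continuousM _ _ (fun x => cabs (f x)) (weight nu)).
    by apply: cabs_continuous; exact: fc.
  exact: weight_continuous.
have /ess_supP : (ess_sup lebesgue_measure (abse \o (fun x : R => (cabs (f x * toC (weight nu x)))%:E)) <= M%:E)%E.
  by rewrite -NM /N /Linfty_norm Lnorm.unlock lebesgue_measureT_gt0.
apply: filterS => y /=; rewrite lee_fin ger0_norm ?cabs_ge0//.
by rewrite cabsM cabs_toC ger0_norm ?powR_ge0.
Qed.

Lemma unif_continuous_dist (R : realType) (g : R -> C R) : unif_continuous g ->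
  forall e, 0 < e -> exists2 d, 0 < d & forall x x', `|x - x'| < d -> cabs (g x - g x') <= e.
Proof.
move=> gc e e0; have e0' : 0 < toC e by rewrite (lt_toC 0 e).
have : entourage [set xy : C R * C R | ball xy.1 (toC e) xy.2].
  by rewrite -entourage_ballE; exists (toC e).
move=> /gc; rewrite /= -entourage_ballE => -[d /= d0 hd]; exists d => // x x' xx.
have := hd (x, x') xx; rewrite /= /ball/= normCE lt_toC; exact: ltW.
Qed.

Lemma Linfty_norm_cvg0 (R : realType) (g : R -> R -> C R) :
  (forall e : R, 0 < e -> exists2 tau0, 0 < tau0 & forall tau, tau0 <= tau ->
     forall x, x != 0 -> cabs (g tau x) <= e) ->
  Linfty_norm (g tau) @[tau --> +oo%R] --> 0%E.
Proof.
move=> h; apply/fine_cvgP; split.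
  have [t0 _ ht] := h 1 ltr01.
  near=> t; have tt : t0 <= t by near: t; apply: nbhs_pinfty_ge; exact: num_real.
  have := Linfty_norm_le (ht t tt).
  by rewrite ge0_fin_numE ?Lnorm_ge0// => /le_lt_trans; apply; rewrite ltry.
apply/cvgrPdist_le => e e0; have [t0 _ ht] := h e e0.
near=> t; have tt : t0 <= t by near: t; apply: nbhs_pinfty_ge; exact: num_real.
have le_e := Linfty_norm_le (ht t tt).
have l0 : (0 <= Linfty_norm (g t))%E by exact: Lnorm_ge0.
rewrite sub0r normrN ger0_norm ?fine_ge0//= -lee_fin fineK//.
by rewrite ge0_fin_numE// (le_lt_trans le_e)// ltry.
Unshelve. all: by end_near. Qed.

(** * The interpolation series with weight |x|^(2nu+1) *)

(* E = prefactor k j * bA mu is A_nu for k = 1, j = 0, mu = nu, and B_nu for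
   k = 1/(2(nu+1)), j = 1, mu = nu+1; in both cases mu = nu + j. *)
Definition prefactor (R : realType) (k : R) (j : nat) (z : C R) : C R := toC k * z ^+ j.

Lemma prefactor_qbound (R : realType) (k : R) j (z : C R) : exists V K, qbound (prefactor k j) z V K.
Proof.
by do 2 eexists; exact: (qboundZ (lexx (cabs (toC k))) (qbound_exp j (lexx (6 * (cabs z + 1))))).
Qed.

Lemma zero_neq0 (R : realType) (mu t : R) : -1 < mu -> rA mu t = 0 -> t != 0.
Proof.
by move=> mu1 rt; apply/eqP => t0; move: rt; rewrite t0 rA0// => /eqP; rewrite oner_eq0.
Qed.

Lemma zero_rA1 (R : realType) (mu t : R) : -1 < mu -> rA mu t = 0 -> rA1 mu t != 0.
Proof.
move=> mu1 rt; have [r [d [c [[_ _ c0] [_ _ hc]]]]] := zeros_facts mu1.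
have := lt_le_trans c0 (hc _ rt); apply: contraTneq => r0.
by rewrite /amp1 r0 expr0n mulr0 ltxx.
Qed.

Lemma mem_bessel_zeros (R : realType) (mu t : R) : -1 < mu ->
  (t \in bessel_zeros mu) = (rA mu t == 0).
Proof.
move=> mu1; apply/idP/eqP => [|rt].
  rewrite inE => -[xi [xi0 /(besselJ_eq0 mu1 xi0) rx]] [|] ->//.
  by rewrite rA_even.
have t0 := zero_neq0 mu1 rt.
rewrite inE; exists `|t|; rewrite normr_gt0; split => //.
  by apply/(besselJ_eq0 mu1); rewrite ?normr_gt0// rA_norm.
by case: (ltP t 0) => h; [right; rewrite ltr0_norm ?opprK|left; rewrite ger0_norm].
Qed.

(** The factor of the summand that does not depend on z: at a zero t of A_mu the derivative of E is
    k t^j A_mu'(t). *)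
Definition icoef (R : realType) (mu k : R) j (tau : R) (f : R -> C R) (t : R) : C R :=
  f (tau^-1 * t) / (prefactor k j (toC t) * bA1 mu (toC t)) ^+ 2.

Lemma derive_prefactor_bA (R : realType) (mu k t : R) j : -1 < mu -> rA mu t = 0 ->
  derive1 (fun z => prefactor k j z * bA mu z) (toC t) = prefactor k j (toC t) * bA1 mu (toC t).
Proof.
move=> mu1 rt; have [V [K hV]] := prefactor_qbound k j (toC t); have [L hL] := bA_qbound (toC t) mu1.
have hd := qbound_derive (qboundM hV hL); rewrite derive1E (@derive_val _ _ _ _ _ _ _ hd).
by rewrite [bA mu (toC t)]bA_real// rt (_ : toC 0 = 0)// mulr0 add0r.
Qed.

Lemma continuous_dilate (R : realType) (a z : C R) (F : C R -> C R) :
  {for a * z, continuous F} -> {for z, continuous (fun w => F (a * w))}.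
Proof.
move=> cF.
have c1 : {for z, continuous (fun w : C R => a * w)}.
  exact: (qbound_continuous (qboundZ (lexx (cabs a)) (qbound_id z))).
exact: (continuous_comp c1 cF).
Qed.

Lemma derivable_dilate (R : realType) (a z : C R) (F : C R -> C R) :
  derivable F (a * z) 1 -> derivable (fun w => F (a * w)) z 1.
Proof.
move=> /derivable1_diffP dF; apply/derivable1_diffP.
have d1 : differentiable (fun w : C R => a * w) z.
  apply/derivable1_diffP.
  by have [] := qbound_derive (qboundZ (lexx (cabs a)) (qbound_id z)).
exact: (differentiable_comp d1 dF).
Qed.

Lemma interp_prefactor_bA (R : realType) (mu k tau t : R) j (f : R -> C R) (z : C R) :
  -1 < mu -> tau != 0 -> rA mu t = 0 ->
  interp_term (fun z => prefactor k j z * bA mu z) tau f z t =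
  prefactor k j (toC tau * z) ^+ 2 * (icoef mu k j tau f t * bQ mu t (toC tau * z) ^+ 2).
Proof.
move=> mu1 tau0 rt; rewrite /interp_term derive_prefactor_bA//.
pose G w := prefactor k j w ^+ 2 * (icoef mu k j tau f t * bQ mu t w ^+ 2).
suff -> : forall g : C R -> C R, (forall y, y != toC (tau^-1 * t) -> g y = G (toC tau * y)) ->
    cont_ext g (toC (tau^-1 * t)) = (fun y => G (toC tau * y)) => //.
  move=> y yt; rewrite /G /bQ /icoef ifN; first last.
    apply: contra yt => /eqP e; apply/eqP; rewrite toCM -e toCV mulKf//.
    by rewrite (inj_eq (@toC_inj R) tau 0).
  by rewrite exprMn expr_div_n invfM; ring.
move=> g hg; apply: cont_extE => //; apply: continuous_dilate.
set z0 := _ * _; have [V [K hV]] := prefactor_qbound k j z0; have [L hL] := bQ_qbound z0 mu1.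
have [W hW] := hL t rt.
have := qboundM (qboundM hV hV) (qboundZ (lexx (cabs (icoef mu k j tau f t))) (qboundM hW hW)).
exact: qbound_continuous.
Qed.

Lemma weightM (R : realType) (nu x y : R) : weight nu (x * y) = weight nu x * weight nu y.
Proof. by rewrite /weight normrM powRM. Qed.

Lemma weight_gt0 (R : realType) (nu x : R) : x != 0 -> 0 < weight nu x.
Proof. by move=> x0; rewrite powR_gt0// normr_gt0. Qed.

(** The reason B_nu leads to the kernel of order nu + 1: the factor z^(2j) of E^2 turns the weight
    of nu into that of mu. *)
Lemma weight_shift (R : realType) (nu x : R) j : x != 0 ->
  weight (nu + j%:R) x = x ^+ (2 * j) * weight nu x.
Proof.
move=> x0; have x0' : `|x| != 0 by rewrite normr_eq0.
rewrite /weight (_ : 2 * (nu + j%:R) + 1 = (2 * j)%:R + (2 * nu + 1)); last by rewrite natrM; ring.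
rewrite powRD ?x0' ?implybT// powR_mulrn// -normrX ger0_norm//.
by rewrite exprM exprn_ge0// sqr_ge0.
Qed.

(** Brings in f w_nu at t/tau, which is bounded, and [amp1], which is bounded below; hence
    coefficients bounded in t. *)
Lemma icoefE (R : realType) (nu mu k tau t : R) j (f : R -> C R) :
  -1 < mu -> mu = nu + j%:R -> k != 0 -> 0 < tau -> rA mu t = 0 ->
  icoef mu k j tau f t = toC (weight nu tau / (k ^+ 2 * amp1 mu t)) *
    (f (tau^-1 * t) * toC (weight nu (tau^-1 * t))).
Proof.
move=> mu1 e k0 tau0 rt; have t0 := zero_neq0 mu1 rt; have r0 := zero_rA1 mu1 rt.
have t2 : weight nu (tau^-1 * t) = (weight nu tau)^-1 * weight nu t.
  have -> : weight nu t = weight nu tau * weight nu (tau^-1 * t).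
    by rewrite -weightM mulVKf// gt_eqF.
  by rewrite mulKf// gt_eqF// weight_gt0// gt_eqF.
rewrite /icoef /prefactor bA1_real// -toCX -!toCM -toCX -toCV mulrCA -toCM; congr (_ * toC _).
rewrite t2 /amp1 -/(weight mu t) e weight_shift// -e.
have w1 := weight_gt0 nu t0; have w2 := weight_gt0 nu (negbT (gt_eqF tau0)).
rewrite mulnC exprM; move: (rA1 mu t) r0 => B r0; field.
by rewrite r0 expf_neq0 ?k0 ?t0// !gt_eqF.
Qed.

Lemma poly_le_expR (R : realType) (N : nat) (d : R) : 0 < d ->
  exists2 K, 0 <= K & forall s : R, 0 <= s -> (1 + s) ^+ N <= K * expR (d * s).
Proof.
move=> d0; pose e := Num.min 1 (d / N.+1%:R).
have e0 : 0 < e by rewrite lt_min ltr01 divr_gt0.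
have e1 : e <= 1 by rewrite ge_min lexx.
have ed : N%:R * e <= d.
  apply: (@le_trans _ _ (N.+1%:R * (d / N.+1%:R))); last by rewrite mulrC divfK.
  by apply: ler_pM; rewrite ?(ltW e0)// ?ler_nat// ge_min lexx orbT.
exists (e^-1 ^+ N); first by rewrite exprn_ge0// invr_ge0 ltW.
move=> s s0; apply: (@le_trans _ _ ((e^-1 * expR (e * s)) ^+ N)).
  rewrite lerXn2r ?nnegrE ?addr_ge0 ?mulr_ge0 ?invr_ge0 ?expR_ge0 ?(ltW e0)//.
  rewrite ler_pdivlMl//; apply: le_trans (expR_ge1Dx _).
  by rewrite mulrDr mulr1 lerD2r.
rewrite exprMn ler_wpM2l ?exprn_ge0 ?invr_ge0 ?(ltW e0)//.
by rewrite -expRM_natl ler_expR mulrA ler_wpM2r.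
Qed.

Lemma interp_sum_entire (R : realType) (nu mu k M : R) j (f : R -> C R) :
  -1 < mu -> mu = nu + j%:R -> k != 0 ->
  (forall x, x != 0 -> cabs (f x * toC (weight nu x)) <= M) ->
  forall tau, 0 < tau ->
  let E := fun z => prefactor k j z * bA mu z in
  let u := interp_term E tau f in
  (forall z, has_sum (fun t => if t \in bessel_zeros mu then u z t else 0)
     (sum_on (bessel_zeros mu) (u z))) /\
  entire_of_exp_type (2 * tau) (fun z => sum_on (bessel_zeros mu) (u z)).
Proof.
move=> mu1 e k0 hM tau tau0 E u; have tau0' := negbT (gt_eqF tau0).
have [r [d [c [[_ _ c0] [_ _ hc]]]]] := zeros_facts mu1.
have k20 : 0 < k ^+ 2 by rewrite exprn_even_gt0//= k0.
have hL t : rA mu t = 0 -> cabs (icoef mu k j tau f t) <= weight nu tau / (k ^+ 2 * c) * M.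
  move=> rt; have t0 := zero_neq0 mu1 rt; have a0 := lt_le_trans c0 (hc _ rt).
  rewrite (icoefE f mu1 e k0 tau0 rt) cabsM cabs_toC.
  have w0 := ltW (weight_gt0 nu tau0').
  apply: ler_pM; rewrite ?cabs_ge0//; last by apply: hM; rewrite mulf_neq0// invr_neq0.
  rewrite ger0_norm; last by apply: divr_ge0 => //; apply: mulr_ge0; exact: ltW.
  apply: ler_wpM2l => //; rewrite lef_pV2 ?posrE; first by apply: ler_wpM2l; [exact: ltW|exact: hc].
    exact: mulr_gt0.
  exact: mulr_gt0.
have [F [hF qF gF]] := zero_series mu1 hL.
have uS z : has_sum (fun t => if t \in bessel_zeros mu then u z t else 0)
    (prefactor k j (toC tau * z) ^+ 2 * F (toC tau * z)).
  have := has_sumZ (prefactor k j (toC tau * z) ^+ 2) (hF (toC tau * z)).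
  congr has_sum; apply/funext => t; rewrite mem_bessel_zeros// /zterm.
  by case: eqP => [rt|_]; [rewrite /u interp_prefactor_bA|rewrite mulr0].
have uE z : sum_on (bessel_zeros mu) (u z) = prefactor k j (toC tau * z) ^+ 2 * F (toC tau * z).
  by have [] := has_sum_summable (uS z).
split; first by move=> z; rewrite uE.
have -> : (fun z => sum_on (bessel_zeros mu) (u z)) = (fun z => prefactor k j (toC tau * z) ^+ 2 * F (toC tau * z)).
  exact/funext.
split.
  move=> z; apply: (@derivable_dilate _ _ _ (fun w => prefactor k j w ^+ 2 * F w)).
  have [V [K hV]] := prefactor_qbound k j (toC tau * z); have [W [L hW]] := qF (toC tau * z).
  by have [] := qbound_derive (qboundM (qboundM hV hV) hW).
(* In the variable w = tau z the allowed exponent is 2 + q. Taking lam = 1 + q/4 in the squared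
   growth bound uses half of q; the other half absorbs the polynomial factor of degree 2(j+1). *)
apply: exp_type_le => b hb; pose q := b / tau - 2.
have q0 : 0 < q by rewrite /q subr_gt0 ltr_pdivlMr.
have [K K0 hK] := gF (1 + q / 4) (ltac:(lra)).
have [L L0 hL'] := @poly_le_expR _ (2 * j.+1) (q / 2) (ltac:(lra)).
exists (k ^+ 2 * (K * L)) => z; set w := toC tau * z; pose s := cabs w.
have s0 : 0 <= s by exact: cabs_ge0.
have -> : b * cabs z = (2 + q) * s.
  by rewrite /s /w cabsM cabs_toC gtr0_norm// /q; field.
rewrite cabsM cabsX /prefactor cabsM cabs_toC cabsX -/s.
have h1 := hK w; rewrite -/s in h1.
apply: (@le_trans _ _ (k ^+ 2 * (s ^+ j) ^+ 2 * (K * ((1 + s) * expR ((1 + q / 4) * s)) ^+ 2))).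
  rewrite exprMn real_normK ?num_real//; apply: ler_wpM2l h1.
  by rewrite mulr_ge0 ?sqr_ge0.
have -> : k ^+ 2 * (s ^+ j) ^+ 2 * (K * ((1 + s) * expR ((1 + q / 4) * s)) ^+ 2) =
   k ^+ 2 * (K * (((s ^+ j) ^+ 2 * (1 + s) ^+ 2) * expR ((2 + q / 2) * s))).
  rewrite (_ : (2 + q / 2) * s = (1 + q / 4) * s + (1 + q / 4) * s); last by field.
  by rewrite expRD; ring.
have -> : k ^+ 2 * (K * L) * expR ((2 + q) * s) = k ^+ 2 * (K * (L * expR ((2 + q) * s))) by ring.
apply: ler_wpM2l; first exact: sqr_ge0.
apply: ler_wpM2l => //.
rewrite (_ : (2 + q) * s = q / 2 * s + (2 + q / 2) * s); last by field.
rewrite [in leRHS]expRD !mulrA; apply: ler_wpM2r; first exact: expR_ge0.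
apply: le_trans (hL' s s0).
have -> : (s ^+ j) ^+ 2 * (1 + s) * (1 + s) = (1 + s) ^+ 2 * (s ^+ j) ^+ 2 by rewrite -mulrA mulrC.
rewrite mulnS exprD mulnC exprM; apply: ler_wpM2l; first exact: sqr_ge0.
rewrite lerXn2r ?nnegrE ?exprn_ge0 ?addr_ge0// lerXn2r ?nnegrE ?addr_ge0//.
by rewrite lerDr.
Qed.

(** Every summand but that of t = tau x contains the factor A_mu(tau x) = 0; in the remaining one
    the two factors A_mu'(t)^2 cancel. *)
Lemma interp_sum_node (R : realType) (nu mu k M : R) j (f : R -> C R) :
  -1 < mu -> mu = nu + j%:R -> k != 0 ->
  (forall x, x != 0 -> cabs (f x * toC (weight nu x)) <= M) ->
  forall tau x : R, 0 < tau -> rA mu (tau * x) = 0 ->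
  sum_on (bessel_zeros mu) (interp_term (fun z => prefactor k j z * bA mu z) tau f (toC x)) = f x.
Proof.
move=> mu1 e k0 hM tau x tau0 ry; have tau0' := negbT (gt_eqF tau0).
have [hs _] := interp_sum_entire mu1 e k0 hM tau0.
set y := tau * x in ry; have y0 := zero_neq0 mu1 ry; have r0 := zero_rA1 mu1 ry.
apply/eqP; rewrite -subr_eq0 -cabs_eq0 eq_le cabs_ge0 andbT.
apply: (has_sum_near (A := [fset y]%fset) (hs (toC x))) => B; rewrite fsub1set => yB.
rewrite (big_fsetD1 y)//= mem_bessel_zeros// ry eqxx big1_fset.
  rewrite addr0 interp_prefactor_bA// -toCM -/y /bQ eqxx /icoef /y mulKf// -/y.
  rewrite (_ : _ - _ = 0) ?cabs0//; set D := prefactor k j (toC y); set E := bA1 _ _.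
  have D0 : D != 0.
    by rewrite /D /prefactor -toCX -toCM (inj_eq (@toC_inj R) _ 0) mulf_neq0// expf_neq0.
  have E0 : E != 0 by rewrite /E bA1_real// (inj_eq (@toC_inj R) _ 0).
  by field; rewrite D0 E0.
move=> t; rewrite !inE => /andP[ty _] _; rewrite mem_bessel_zeros//; case: eqP => // rt.
rewrite interp_prefactor_bA// -toCM -/y /bQ (inj_eq (@toC_inj R)) eq_sym (negbTE ty).
by rewrite bA_real// ry (_ : toC 0 = 0)// mul0r expr0n mulr0 mulr0.
Qed.

(** The normalisation k cancels between E^2 and E'(t)^2, and the weights at x, tau and t/tau combine
    by multiplicativity. *)
Lemma interp_weighted (R : realType) (nu mu k tau x t : R) j (f : R -> C R) :
  -1 < mu -> mu = nu + j%:R -> k != 0 -> 0 < tau -> x != 0 ->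
  rA mu t = 0 -> rA mu (tau * x) != 0 ->
  toC (weight nu x) * interp_term (fun z => prefactor k j z * bA mu z) tau f (toC x) t =
  toC (kern mu (tau * x) t) * (f (tau^-1 * t) * toC (weight nu (tau^-1 * t))).
Proof.
move=> mu1 e k0 tau0 x0 rt ry; have tau0' := negbT (gt_eqF tau0).
have yt : tau * x != t by apply: contraNneq ry => ->; rewrite rt.
have y0 : tau * x != 0 by rewrite mulf_neq0.
have r0 := zero_rA1 mu1 rt; have t0 := zero_neq0 mu1 rt.
rewrite interp_prefactor_bA// (icoefE f mu1 e k0 tau0 rt) -toCM /bQ (inj_eq (@toC_inj R)) (negbTE yt).
rewrite bA_real// -toCB -toCV -toCM /prefactor -toCX -toCM.
set g := _ * toC (weight nu (tau^-1 * t)).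
rewrite -!toCX [LHS](_ : _ = (toC (weight nu x) * toC ((k * (tau * x) ^+ j) ^+ 2) *
  toC (weight nu tau / (k ^+ 2 * amp1 mu t)) * toC ((rA mu (tau * x) / (tau * x - t)) ^+ 2)) * g); last by ring.
rewrite -!toCM; congr (toC _ * g).
rewrite /kern /amp -/(weight mu (tau * x)).
have -> : weight mu (tau * x) = (tau * x) ^+ (2 * j) * weight nu (tau * x) by rewrite e weight_shift.
rewrite mulnC exprM weightM.
have a0 : amp1 mu t != 0 by rewrite mulf_neq0 ?sqrf_eq0// gt_eqF// (weight_gt0 mu).
by field; rewrite k0 a0 subr_eq0 yt.
Qed.

Lemma interp_approx (R : realType) (nu mu k M : R) j (f g : R -> C R) :
  - 2^-1 < mu -> mu = nu + j%:R -> k != 0 ->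
  (forall x, x != 0 -> g x = f x * toC (weight nu x)) -> g 0 = 0 ->
  (forall x, cabs (g x) <= M) ->
  (forall e, 0 < e -> exists2 d, 0 < d & forall x x', `|x - x'| < d -> cabs (g x - g x') <= e) ->
  forall e, 0 < e -> exists2 tau0, 0 < tau0 & forall tau, tau0 <= tau -> forall x, x != 0 ->
    cabs ((sum_on (bessel_zeros mu) (interp_term (fun z => prefactor k j z * bA mu z) tau f (toC x)) - f x)
      * toC (weight nu x)) <= e.
Proof.
move=> mu2 em k0 gE g0 gM gu e e0; have mu1 : -1 < mu by lra.
have [tau0 t00 hk] := kern_approx mu2 gM gu g0 e0.
exists tau0 => // tau htau x x0; have tau1 : 0 < tau by exact: lt_le_trans htau.
have hM y : y != 0 -> cabs (f y * toC (weight nu y)) <= M by move=> /gE <-.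
have [ry|ry] := eqVneq (rA mu (tau * x)) 0.
  by rewrite (interp_sum_node mu1 em k0 hM tau1 ry) subrr mul0r cabs0 ltW.
have [hs _] := interp_sum_entire mu1 em k0 hM tau1.
have [A hA] := hk tau htau x ry.
have hs' := has_sumZ (toC (weight nu x)) (hs (toC x)).
rewrite mulrBl -gE// mulrC.
apply: (has_sum_near (A := A) hs') => B /hA; rewrite (eq_bigr (fun t => toC (weight nu x) *
  (if t \in bessel_zeros mu then
   interp_term (fun z => prefactor k j z * bA mu z) tau f (toC x) t else 0)))// => t _.
rewrite mem_bessel_zeros//; case: eqP => rt; last by rewrite mulr0.
have t0 := zero_neq0 mu1 rt.
rewrite (interp_weighted f mu1 em)// -gE; first by rewrite [t / tau]mulrC.
by rewrite mulf_neq0// invr_neq0// gt_eqF.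
Qed.


Theorem theorem1 (R : realType) (nu : R) (f : R -> C R)
  (nu_gtN1 : -1 < nu) (nu_neq : nu != - 2^-1)
  (f_cont : forall x : R, x != 0 -> {for x, continuous f})
  (fw_bounded : (Linfty_norm (fun x : R => (f x * toC (weight nu x))%R) < +oo)%E) :
  (forall tau : R, 0 < tau ->
     (G_summable nu tau f /\ entire_of_exp_type (2 * tau) (G_op nu tau f)) /\
     (H_summable nu tau f /\ entire_of_exp_type (2 * tau) (H_op nu tau f)))
  /\
  ((f x * toC (weight nu x) @[x --> (0 : R)^'] --> (0 : C R)) ->
   unif_continuous (cont_ext (fun x : R => f x * toC (weight nu x)) (0 : R)) ->
   (- 2^-1 < nu ->
      Linfty_norm (fun x : R => (G_op nu tau f (toC x) - f x) * toC (weight nu x))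
        @[tau --> +oo%R] --> 0%E)
   /\
   (nu < - 2^-1 ->
      Linfty_norm (fun x : R => (H_op nu tau f (toC x) - f x) * toC (weight nu x))
        @[tau --> +oo%R] --> 0%E)).
Proof.
have [M M0 hM] := weighted_bound f_cont fw_bounded.
have nu2 : -1 < nu + 1 by lra.
have AE : besselA nu = fun z => prefactor 1 0 z * bA nu z.
  by rewrite besselAE//; apply/funext => z; rewrite /prefactor expr0 mulr1 mul1r.
pose k : R := 2^-1 / (nu + 1).
have k0 : k != 0 by rewrite mulf_neq0 ?invr_neq0// gt_eqF//; lra.
have BE : besselB nu = fun z => prefactor k 1 z * bA (nu + 1) z by rewrite besselBE.
have e0 : nu = nu + 0%:R by rewrite addr0.
have e1 : nu + 1 = nu + 1%:R by [].
split.
  move=> tau tau0; rewrite /G_summable /H_summable /G_op /H_op AE BE.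
  have [sG tG] := interp_sum_entire nu_gtN1 e0 (oner_neq0 R) hM tau0.
  have [sH tH] := interp_sum_entire nu2 e1 k0 hM tau0.
  split; split; [move=> z|exact: tG|move=> z|exact: tH].
    by have [] := has_sum_summable (sG z).
  by have [] := has_sum_summable (sH z).
set g := cont_ext _ 0 => lim0 gc.
(* The limit hypothesis fixes the extended value at the origin, which makes g small where the kernel
   sums are not close to 1. *)
have g0 : g 0 = 0 by rewrite /g /cont_ext eqxx; apply: cvg_lim => //; exact: norm_hausdorff.
have gE x : x != 0 -> g x = f x * toC (weight nu x) by move=> x0; rewrite /g /cont_ext (negbTE x0).
have gM x : cabs (g x) <= M.
  by have [->|x0] := eqVneq x 0; [rewrite g0 cabs0|rewrite gE// hM].
have gu := unif_continuous_dist gc.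
split=> hnu; apply: (@Linfty_norm_cvg0 R (fun tau x => (_ - f x) * toC (weight nu x))) => e e_gt0.
  rewrite /G_op AE.
  exact: (interp_approx hnu e0 (oner_neq0 R) gE g0 gM gu e_gt0).
(* The shifted order nu + 1 is positive, so the kernel estimates apply with j = 1. *)
rewrite /H_op BE; have hnu' : - 2^-1 < nu + 1 by lra.
exact: (interp_approx hnu' e1 k0 gE g0 gM gu e_gt0).
Qed.
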